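(* The Weierstrass sigma function $\sigma(z,g_2,g_3)$, originally defined for $g_2^3-27g_3^2\neq0$, is entire (i.e. it extends to an entire function of three complex variables), and for all $(z,g_2,g_3)\in\mathbb C^3$ the equality $$ \sigma(z,g_2,g_3)=\sum_{m,n=0}^\infty a_{mn}\,g_2^m g_3^n z^{4m+6n+1} $$ holds, where the coefficients $a_{mn}$ are determined by $a_{00}=1$ and the recurrence relation $$ a_{mn}=\frac{12(m+1)a_{m+1,n-1}+\frac23(n+1)a_{m-2,n+1}-\frac1{12}a_{m-1,n}}{(4m+6n+1)(4m+6n)} $$ for all integers $m,n\ge0$, $(m,n)\ne(0,0)$, with the convention that $a_{mn}=0$ if $m<0$ or $n<0$.
   Context: For $(g_2,g_3)\in\mathbb C^2$ with $g_2^3-27g_3^2\ne0$, let $\Lambda\subset\mathbb C$ be the unique lattice with invariants $g_2=60\sum_{\lambda\in\Lambda\setminus0}\lambda^{-4}$, $g_3=140\sum_{\lambda\in\Lambda\setminus0}\lambda^{-6}$. The Weierstrass sigma function is $\sigma(z,g_2,g_3)=z\prod_{\lambda\in\Lambda\setminus0}\left(1-\frac z\lambda\right)e^{z/\lambda+z^2/(2\lambda^2)}$. *)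

(* Defs.v *)
From Stdlib Require Import Reals ZArith List.
From Coquelicot Require Import Coquelicot.

Local Open Scope C_scope.

Definition Cexp (z : C) : C :=
  RtoC (exp (Re z)) * (cos (Im z), sin (Im z)).

(** The finite subsets of [A], as duplicate-free lists, directed by inclusion:
    convergence along this filter is unconditional convergence. *)
Definition finite_subsets {T : Type} (A : T -> Prop) : (list T -> Prop) -> Prop :=
  fun P => exists l0 : list T,
    NoDup l0 /\ List.Forall A l0 /\
    forall l : list T, NoDup l -> List.Forall A l -> incl l0 l -> P l.

Definition is_sum {T : Type} (A : T -> Prop) (f : T -> C) (s : C) : Prop :=
  filterlim (fun l => fold_right Cplus 0 (map f l)) (finite_subsets A) (locally s).

(** The limit [p] may be [0]: the sigma product vanishes at the lattice points. *)
Definition is_prod {T : Type} (A : T -> Prop) (f : T -> C) (p : C) : Prop :=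
  filterlim (fun l => fold_right Cmult 1 (map f l)) (finite_subsets A) (locally p).

Definition is_lattice (L : C -> Prop) : Prop :=
  exists w1 w2 : C,
    (forall s t : R, RtoC s * w1 + RtoC t * w2 = 0 -> s = 0%R /\ t = 0%R) /\
    forall z : C,
      L z <-> exists m n : Z, z = RtoC (IZR m) * w1 + RtoC (IZR n) * w2.

Definition nonzero_points (L : C -> Prop) : C -> Prop := fun l => L l /\ l <> 0.

Definition has_invariants (L : C -> Prop) (g2 g3 : C) : Prop :=
  exists e4 e6 : C,
    is_sum (nonzero_points L) (fun l => / l ^ 4) e4 /\
    is_sum (nonzero_points L) (fun l => / l ^ 6) e6 /\
    g2 = 60 * e4 /\ g3 = 140 * e6.

(** [s] is the value at [z] of the sigma function of [L]; the convergence of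
    the product is part of the assertion. *)
Definition is_weierstrass_sigma (L : C -> Prop) (z s : C) : Prop :=
  exists p : C,
    is_prod (nonzero_points L)
      (fun l => (1 - z / l) * Cexp (z / l + z ^ 2 / (2 * l ^ 2))) p /\
    s = z * p.

(** Holomorphy on C^3: complex Frechet differentiability at every point. *)
Definition entire3 (F : C * C * C -> C) : Prop :=
  forall p : C * C * C, ex_filterdiff (K := C_AbsRing) F (locally p).

Definition is_sigma_coefficients (a : Z -> Z -> C) : Prop :=
  (forall m n : Z, (m < 0 \/ n < 0)%Z -> a m n = 0) /\
  a 0%Z 0%Z = 1 /\
  forall m n : Z, (0 <= m)%Z -> (0 <= n)%Z -> (m, n) <> (0%Z, 0%Z) ->
    a m n =
      (RtoC (IZR (12 * (m + 1))) * a (m + 1)%Z (n - 1)%Z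
       + 2 / 3 * RtoC (IZR (n + 1)) * a (m - 2)%Z (n + 1)%Z
       - 1 / 12 * a (m - 1)%Z n)
      / RtoC (IZR ((4 * m + 6 * n + 1) * (4 * m + 6 * n))).

(* Main.v *)
(** The recurrence for [a m n] expresses that [S = sum a_mn g2^m g3^n z^(4m+6n+1)] satisfies
    Weierstrass' heat equation [S'' = 12 g3 dS/dg2 + 2/3 g2^2 dS/dg3 - 1/12 g2 z^2 S].  It lowers
    the weight [k = 2m + 3n], whence [|a_mn| <= 2^k / k!] and [S] is entire.

    That the sigma function of a lattice has this expansion is obtained without complex analysis.
    Eisenstein's double sums give [E7 = E3 (E4 + 2 e4)] for [E_k(z) = sum (z - l)^-k] and
    [e4 = sum' l^-4], i.e. [wp^(5) = 60 wp' wp'' + 12 g2 wp'], which determines the Laurent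
    coefficients of [wp] from [g2] and [g3].  The formal solution of [wp'' = 6 wp^2 - g2/2] with coefficients depending on
    [g2], [g3] has the same coefficients.  For the derivation [L = 12 g3 d/dg2 + 2/3 g2^2 d/dg3],
    [W = L wp - (4 wp^2 + 2 zeta wp' - 2/3 g2)] solves Lame's equation [W'' = 12 wp W] and has no
    term in [z^4] or [z^-3], so [W = 0]; two integrations give the heat equation for sigma.

    Finally the partial products of the Weierstrass product are power series; their logarithmic
    derivatives show that the coefficients converge, and a uniform majorant that the values do. *)
Require Import Defs.
From Stdlib Require Import Reals ZArith Lra Lia Psatz.
From Stdlib Require Import Classical ClassicalEpsilon FunctionalExtensionality.
From Coquelicot Require Import Coquelicot.
From Stdlib Require Import List Permutation.

Local Open Scope C_scope.

(** * Unconditional sums *)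

(** The heat equation differentiates with respect to the invariants, whereas a lattice gives single
    numbers. Identities are therefore proved in an abstract differential C-algebra and used for
    series in z over two coefficient rings: formal series in a time, where the derivation of the
    invariants is a genuine derivative, and C, where the lattice lives. The two meet at time 0. The
    bridge is the fifth-order equation: it contains only g2, and a solution is fixed by its
    coefficients below degree 7, so g3 enters merely as the free coefficient g3/28 of degree 6. It
    is also the equation that absolutely convergent sums can give: wp itself, of weight 2, is never
    summed over the lattice, and of the conditionally convergent E_2 only differences occur. Laurent
    series are multiplied by the power of z that removes the pole, and d/dz is replaced by z d/dz.
    Each uniqueness statement then becomes the nonvanishing of an indicial polynomial. *)

Definition lsum {T : Type} (f : T -> C) (l : list T) : C :=
  fold_right Cplus 0 (map f l).

Definition rsum {T : Type} (f : T -> R) (l : list T) : R :=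
  fold_right Rplus 0%R (map f l).

(** Convergence along [finite_subsets] in terms of the modulus. The function of the finite set is
    arbitrary, because coefficients and values of partial products converge along the same net as
    sums. *)
Definition net_lim {T : Type} (A : T -> Prop) (F : list T -> C) (s : C) : Prop :=
  forall eps : R, (0 < eps)%R ->
    exists l0, NoDup l0 /\ Forall A l0 /\
      forall l, NoDup l -> Forall A l -> incl l0 l -> (Cmod (F l - s) < eps)%R.

(** Absolute summability with an explicit bound, which then passes to the sum, to products and to
    uniform majorants. *)
Definition summable {T : Type} (A : T -> Prop) (f : T -> R) (M : R) : Prop :=
  forall l, NoDup l -> Forall A l -> (rsum f l <= M)%R.

Lemma eq_dec_classical {T : Type} (x y : T) : {x = y} + {x <> y}.
Proof. apply excluded_middle_informative. Qed.

Lemma lists_union {T : Type} (A : T -> Prop) (l1 l2 : list T) :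
  Forall A l1 -> Forall A l2 ->
  exists l, NoDup l /\ Forall A l /\ incl l1 l /\ incl l2 l.
Proof.
  intros H1 H2. exists (nodup eq_dec_classical (l1 ++ l2)).
  split; [apply NoDup_nodup|]. split.
  - rewrite Forall_forall in *. intros x Hx. apply nodup_In, in_app_or in Hx.
    destruct Hx; auto.
  - split; intros x Hx; apply nodup_In, in_or_app; auto.
Qed.

Lemma finite_subsets_proper {T : Type} (A : T -> Prop) :
  ProperFilter (finite_subsets A).
Proof.
  constructor.
  - intros P (l0 & H1 & H2 & H3). exists l0. apply H3; auto. apply incl_refl.
  - constructor.
    + exists nil. repeat split; auto; constructor.
    + intros P Q (l1 & H1 & H2 & H3) (l2 & H4 & H5 & H6).
      destruct (lists_union A l1 l2 H2 H5) as (l & Hl1 & Hl2 & Hl3 & Hl4).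
      exists l; split; [exact Hl1|split; [exact Hl2|]]. intros l' Hn Hf Hi.
      split; [apply H3|apply H6]; auto; eapply incl_tran; eauto.
    + intros P Q HPQ (l1 & H1 & H2 & H3). exists l1; split; [|split]; auto.
Qed.

Lemma net_lim_filterlim {T : Type} (A : T -> Prop) (F : list T -> C) (s : C) :
  net_lim A F s <-> filterlim F (finite_subsets A) (locally s).
Proof.
  split.
  - intros H. pose proof (finite_subsets_proper A) as HP.
    apply (filterlim_locally (U := C_UniformSpace)).
    intros eps. destruct (H eps (cond_pos eps)) as (l0 & H1 & H2 & H3).
    exists l0; split; [exact H1|split; [exact H2|]]. intros l Hn Hf Hi.
    apply (C_NormedModule_mixin_compat1 s (F l)). apply H3; auto.
  - intros H eps Heps.
    (* Balls of the uniform structure on C are squares; comparing them with discs costs a factor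
       [sqrt 2]. *)
    assert (Hs : (0 < eps / sqrt 2)%R).
    { apply Rdiv_lt_0_compat; auto. apply sqrt_lt_R0. lra. }
    specialize (H (ball (M := C_UniformSpace) s (mkposreal _ Hs))).
    destruct H as (l0 & H1 & H2 & H3).
    { apply (locally_ball (T := C_UniformSpace) s (mkposreal _ Hs)). }
    exists l0; split; [exact H1|split; [exact H2|]]. intros l Hn Hf Hi.
    specialize (H3 l Hn Hf Hi).
    apply (C_NormedModule_mixin_compat2 s (F l)) in H3. simpl in H3.
    replace eps with (sqrt 2 * (eps / sqrt 2))%R; [exact H3|].
    field. apply Rgt_not_eq, sqrt_lt_R0. lra.
Qed.

Lemma is_sum_net {T : Type} (A : T -> Prop) (f : T -> C) (s : C) :
  is_sum A f s <-> net_lim A (lsum f) s.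
Proof. symmetry. apply net_lim_filterlim. Qed.

Lemma net_lim_unique {T : Type} (A : T -> Prop) (F : list T -> C) (s t : C) :
  net_lim A F s -> net_lim A F t -> s = t.
Proof.
  intros H1 H2. apply net_lim_filterlim in H1. apply net_lim_filterlim in H2.
  pose proof (finite_subsets_proper A) as HP.
  exact (filterlim_locally_unique (V := C_NormedModule) F s t H1 H2).
Qed.

Lemma is_sum_unique {T : Type} (A : T -> Prop) (f : T -> C) (s t : C) :
  is_sum A f s -> is_sum A f t -> s = t.
Proof. rewrite !is_sum_net. apply net_lim_unique. Qed.

Lemma net_lim_cauchy {T : Type} (A : T -> Prop) (F : list T -> C) :
  (forall eps : R, (0 < eps)%R -> exists l0, NoDup l0 /\ Forall A l0 /\
      forall l, NoDup l -> Forall A l -> incl l0 l -> (Cmod (F l - F l0) < eps)%R) ->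
  exists s, net_lim A F s.
Proof.
  intros H. pose proof (finite_subsets_proper A) as HP.
  destruct (proj1 (filterlim_locally_cauchy (U := C_R_CompleteNormedModule)
                     (F := finite_subsets A) F)) as [s Hs].
  - intros eps. destruct (H (eps / 2)%R) as (l0 & H1 & H2 & H3).
    { pose proof (cond_pos eps). lra. }
    exists (fun l => (Cmod (F l - F l0) < eps / 2)%R). split.
    + exists l0; split; [exact H1|split; [exact H2|]]. exact H3.
    + intros u v Hu Hv. apply (C_NormedModule_mixin_compat1 (F u) (F v)).
      change (minus (F v) (F u)) with (F v - F u).
      replace (F v - F u) with ((F v - F l0) + - (F u - F l0)) by ring.
      eapply Rle_lt_trans; [apply Cmod_triangle|]. rewrite Cmod_opp. lra.
  - exists s. apply net_lim_filterlim. exact Hs.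
Qed.

Lemma net_lim_ext {T : Type} (A : T -> Prop) (F G : list T -> C) (s : C) :
  (forall l, NoDup l -> Forall A l -> F l = G l) -> net_lim A F s -> net_lim A G s.
Proof.
  intros HE H eps He. destruct (H eps He) as (l0 & H1 & H2 & H3).
  exists l0; split; [exact H1|split; [exact H2|]]. intros l Hn Hf Hi.
  rewrite <- HE; auto.
Qed.

Lemma net_lim_const {T : Type} (A : T -> Prop) (s : C) :
  net_lim A (fun _ => s) s.
Proof.
  intros eps He. exists nil. repeat split; try constructor. intros l _ _ _.
  replace (s - s) with (RtoC 0) by ring. rewrite Cmod_0; auto.
Qed.

Lemma net_lim_plus {T : Type} (A : T -> Prop) (F G : list T -> C) (s t : C) :
  net_lim A F s -> net_lim A G t -> net_lim A (fun l => F l + G l) (s + t).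
Proof.
  intros HF HG eps He.
  destruct (HF (eps / 2)%R ltac:(lra)) as (l1 & H1 & H2 & H3).
  destruct (HG (eps / 2)%R ltac:(lra)) as (l2 & H4 & H5 & H6).
  destruct (lists_union A l1 l2 H2 H5) as (l & Hl1 & Hl2 & Hl3 & Hl4).
  exists l; split; [exact Hl1|split; [exact Hl2|]]. intros l' Hn Hf Hi.
  replace (F l' + G l' - (s + t)) with ((F l' - s) + (G l' - t)) by ring.
  eapply Rle_lt_trans; [apply Cmod_triangle|].
  assert (Cmod (F l' - s) < eps / 2)%R by (apply H3; auto; eapply incl_tran; eauto).
  assert (Cmod (G l' - t) < eps / 2)%R by (apply H6; auto; eapply incl_tran; eauto).
  lra.
Qed.

Lemma net_lim_mult {T : Type} (A : T -> Prop) (F G : list T -> C) (s t : C) :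
  net_lim A F s -> net_lim A G t -> net_lim A (fun l => F l * G l) (s * t).
Proof.
  intros HF HG eps He.
  set (N := (1 + Cmod s + Cmod t)%R).
  assert (HN : (1 <= N)%R).
  { unfold N. pose proof (Cmod_ge_0 s). pose proof (Cmod_ge_0 t). lra. }
  set (d := Rmin 1 (eps / (2 * N))).
  assert (Hd : (0 < d)%R).
  { apply Rmin_glb_lt; [lra|]. apply Rdiv_lt_0_compat; lra. }
  destruct (HF d Hd) as (l1 & H1 & H2 & H3).
  destruct (HG d Hd) as (l2 & H4 & H5 & H6).
  destruct (lists_union A l1 l2 H2 H5) as (l & Hl1 & Hl2 & Hl3 & Hl4).
  exists l; split; [exact Hl1|split; [exact Hl2|]]. intros l' Hn Hf Hi.
  assert (Ha : (Cmod (F l' - s) < d)%R) by (apply H3; auto; eapply incl_tran; eauto).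
  assert (Hb : (Cmod (G l' - t) < d)%R) by (apply H6; auto; eapply incl_tran; eauto).
  replace (F l' * G l' - s * t)
    with ((F l' - s) * (G l' - t) + ((F l' - s) * t + s * (G l' - t))) by ring.
  eapply Rle_lt_trans; [apply Cmod_triangle|].
  eapply Rle_lt_trans; [apply Rplus_le_compat_l, Cmod_triangle|].
  rewrite !Cmod_mult.
  pose proof (Cmod_ge_0 (F l' - s)). pose proof (Cmod_ge_0 (G l' - t)).
  pose proof (Cmod_ge_0 s). pose proof (Cmod_ge_0 t).
  assert (d <= 1)%R by apply Rmin_l.
  assert (d * N <= eps / 2)%R.
  { replace (eps / 2)%R with (eps / (2 * N) * N)%R by (field; lra).
    apply Rmult_le_compat_r; [lra|apply Rmin_r]. }
  unfold N in *. nra.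
Qed.

Lemma net_lim_le {T : Type} (A : T -> Prop) (F : list T -> C) (s : C) (M : R) :
  (forall l, NoDup l -> Forall A l -> (Cmod (F l) <= M)%R) ->
  net_lim A F s -> (Cmod s <= M)%R.
Proof.
  intros HM H. apply Rnot_lt_le. intros Hlt.
  destruct (H (Cmod s - M)%R ltac:(lra)) as (l0 & H1 & H2 & H3).
  specialize (H3 l0 H1 H2 (incl_refl _)). specialize (HM l0 H1 H2).
  assert (Cmod s <= Cmod (F l0) + Cmod (F l0 - s))%R.
  { replace s with (F l0 + - (F l0 - s)) at 1 by ring.
    eapply Rle_trans; [apply Cmod_triangle|]. rewrite Cmod_opp. lra. }
  lra.
Qed.

Lemma lsum_app {T : Type} (f : T -> C) l1 l2 :
  lsum f (l1 ++ l2) = lsum f l1 + lsum f l2.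
Proof.
  unfold lsum. induction l1 as [|a l1 IH]; simpl; [ring|]. rewrite IH. ring.
Qed.

Lemma rsum_app {T : Type} (f : T -> R) l1 l2 :
  rsum f (l1 ++ l2) = (rsum f l1 + rsum f l2)%R.
Proof.
  unfold rsum. induction l1 as [|a l1 IH]; simpl; [ring|]. rewrite IH. ring.
Qed.

Lemma lsum_perm {T : Type} (f : T -> C) l1 l2 :
  Permutation l1 l2 -> lsum f l1 = lsum f l2.
Proof.
  unfold lsum. induction 1; simpl; try congruence; ring.
Qed.

Lemma rsum_perm {T : Type} (f : T -> R) l1 l2 :
  Permutation l1 l2 -> rsum f l1 = rsum f l2.
Proof.
  unfold rsum. induction 1; simpl; try congruence; ring.
Qed.

Lemma lsum_le {T : Type} (f : T -> C) l :
  (Cmod (lsum f l) <= rsum (fun x => Cmod (f x)) l)%R.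
Proof.
  unfold lsum, rsum. induction l as [|a l IH]; simpl.
  - rewrite Cmod_0; lra.
  - eapply Rle_trans; [apply Cmod_triangle|]. lra.
Qed.

Lemma rsum_ge_0 {T : Type} (f : T -> R) l :
  (forall x, In x l -> 0 <= f x)%R -> (0 <= rsum f l)%R.
Proof.
  unfold rsum. induction l as [|a l IH]; simpl; intros H; [lra|].
  assert (0 <= f a)%R by auto.
  assert (0 <= fold_right Rplus 0 (map f l))%R by auto. lra.
Qed.

Lemma rsum_le {T : Type} (f g : T -> R) l :
  (forall x, In x l -> f x <= g x)%R -> (rsum f l <= rsum g l)%R.
Proof.
  unfold rsum. induction l as [|a l IH]; simpl; intros H; [lra|].
  assert (f a <= g a)%R by auto. 
  assert (fold_right Rplus 0 (map f l) <= fold_right Rplus 0 (map g l))%R by auto.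
  lra.
Qed.

Lemma lsum_ext {T : Type} (f g : T -> C) l :
  (forall x, In x l -> f x = g x) -> lsum f l = lsum g l.
Proof.
  unfold lsum. induction l as [|a l IH]; simpl; intros H; [auto|].
  rewrite H, IH; auto.
Qed.

Lemma rsum_scal {T : Type} (f : T -> R) (c : R) l :
  rsum (fun x => c * f x)%R l = (c * rsum f l)%R.
Proof.
  unfold rsum. induction l as [|a l IH]; simpl; [ring|]. rewrite IH. ring.
Qed.

Lemma lsum_scal {T : Type} (f : T -> C) (c : C) l :
  lsum (fun x => c * f x) l = c * lsum f l.
Proof.
  unfold lsum. induction l as [|a l IH]; simpl; [ring|]. rewrite IH. ring.
Qed.

Lemma lsum_plus {T : Type} (f g : T -> C) l :
  lsum (fun x => f x + g x) l = lsum f l + lsum g l.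
Proof.
  unfold lsum. induction l as [|a l IH]; simpl; [ring|]. rewrite IH. ring.
Qed.

Lemma rsum_map {T U : Type} (h : T -> U) (f : U -> R) l :
  rsum f (map h l) = rsum (fun x => f (h x)) l.
Proof. unfold rsum. rewrite map_map. reflexivity. Qed.

Lemma lsum_map {T U : Type} (h : T -> U) (f : U -> C) l :
  lsum f (map h l) = lsum (fun x => f (h x)) l.
Proof. unfold lsum. rewrite map_map. reflexivity. Qed.

(** Splits off a prescribed part, so that comparing two stages of a net becomes an estimate on a
    disjoint tail. *)
Lemma incl_split {T : Type} (l0 l : list T) :
  NoDup l0 -> NoDup l -> incl l0 l -> exists l1, NoDup (l0 ++ l1) /\ Permutation l (l0 ++ l1).
Proof.
  intros H0 Hl Hi.
  assert (H : exists l1, Permutation l (l0 ++ l1)).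
  { revert l Hl Hi. induction H0 as [|a l0 Ha H0 IH]; intros l Hl Hi.
    - exists l. simpl. apply Permutation_refl.
    - destruct (in_split a l) as (l2 & l3 & E); [apply Hi; left; auto|]. subst l.
      assert (HP : Permutation (l2 ++ a :: l3) (a :: (l2 ++ l3))).
      { symmetry. apply Permutation_middle. }
      assert (Hn : NoDup (a :: l2 ++ l3)) by (eapply Permutation_NoDup; eauto).
      inversion Hn; subst.
      destruct (IH (l2 ++ l3)) as [l1 H1]; auto.
      + intros x Hx. assert (Hx' : In x (l2 ++ a :: l3)) by (apply Hi; right; auto).
        apply (Permutation_in _ HP) in Hx'. destruct Hx' as [E|]; auto.
        subst; contradiction.
      + exists l1. simpl. etransitivity; [exact HP|]. constructor; auto. }
  destruct H as [l1 H1]. exists l1; split; auto. eapply Permutation_NoDup; eauto.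
Qed.

Lemma rsum_incl {T : Type} (f : T -> R) (l0 l : list T) :
  NoDup l0 -> NoDup l -> incl l0 l -> (forall x, In x l -> 0 <= f x)%R ->
  (rsum f l0 <= rsum f l)%R.
Proof.
  intros H0 Hl Hi Hp. destruct (incl_split l0 l H0 Hl Hi) as (l1 & H1 & H2).
  rewrite (rsum_perm _ _ _ H2), rsum_app.
  assert (0 <= rsum f l1)%R; [|lra]. apply rsum_ge_0. intros x Hx. apply Hp.
  eapply Permutation_in; [symmetry; exact H2|]. apply in_or_app; auto.
Qed.

(* A finite set almost realising the supremum of the finite sums leaves only small tails. *)
Lemma summable_tail {T : Type} (A : T -> Prop) (f : T -> R) (M : R) :
  (forall x, A x -> 0 <= f x)%R -> summable A f M ->
  forall eps : R, (0 < eps)%R -> exists l0, NoDup l0 /\ Forall A l0 /\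
    forall l1, NoDup (l0 ++ l1) -> Forall A l1 -> (rsum f l1 < eps)%R.
Proof.
  intros Hp HM eps He.
  set (E := fun y : R => exists l, NoDup l /\ Forall A l /\ y = rsum f l).
  destruct (completeness E) as [S [HS1 HS2]].
  - exists M. intros y (l & H1 & H2 & ->). auto.
  - exists 0%R, nil. repeat split; constructor.
  - assert (Hex : exists l, NoDup l /\ Forall A l /\ (S - eps < rsum f l)%R).
    { apply NNPP. intros Hno. assert (S <= S - eps)%R; [|lra].
      apply HS2. intros y (l & H1 & H2 & ->). apply Rnot_lt_le. intros Hlt.
      apply Hno. exists l; auto. }
    destruct Hex as (l0 & H1 & H2 & H3). exists l0. split; [|split]; auto.
    intros l1 Hn Hf. assert (rsum f (l0 ++ l1) <= S)%R.
    { apply HS1. exists (l0 ++ l1). split; [|split]; auto. apply Forall_app; auto. }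
    rewrite rsum_app in H. lra.
Qed.

Lemma ex_is_sum {T : Type} (A : T -> Prop) (f : T -> C) (M : R) :
  summable A (fun x => Cmod (f x)) M ->
  exists s, is_sum A f s /\ (Cmod s <= M)%R.
Proof.
  intros HM. destruct (net_lim_cauchy A (lsum f)) as [s Hs].
  - intros eps He.
    destruct (summable_tail A _ M (fun x _ => Cmod_ge_0 (f x)) HM eps He)
      as (l0 & H1 & H2 & H3).
    exists l0. split; [|split]; auto. intros l Hn Hf Hi.
    destruct (incl_split l0 l H1 Hn Hi) as (l1 & H4 & H5).
    rewrite (lsum_perm _ _ _ H5), lsum_app.
    replace (lsum f l0 + lsum f l1 - lsum f l0) with (lsum f l1) by ring.
    eapply Rle_lt_trans; [apply lsum_le|]. apply H3; auto.
    rewrite Forall_forall in *. intros x Hx. apply Hf.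
    eapply Permutation_in; [symmetry; exact H5|]. apply in_or_app; auto.
  - exists s. split; [apply is_sum_net; exact Hs|].
    apply (net_lim_le A (lsum f) s M); auto. intros l H1 H2.
    eapply Rle_trans; [apply lsum_le|]. apply HM; auto.
Qed.

Lemma is_sum_le {T : Type} (A : T -> Prop) (f : T -> C) (s : C) (M : R) :
  summable A (fun x => Cmod (f x)) M -> is_sum A f s -> (Cmod s <= M)%R.
Proof.
  intros HM Hs. destruct (ex_is_sum A f M HM) as (s' & Hs' & Hle).
  rewrite (is_sum_unique A f s s'); auto.
Qed.

Lemma summable_le {T : Type} (A : T -> Prop) (f g : T -> R) (M : R) :
  (forall x, A x -> f x <= g x)%R -> summable A g M -> summable A f M.
Proof.
  intros H HM l Hn Hf. eapply Rle_trans; [|apply (HM l Hn Hf)].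
  apply rsum_le. rewrite Forall_forall in Hf. auto.
Qed.

Lemma summable_scal {T : Type} (A : T -> Prop) (f : T -> R) (c M : R) :
  (0 <= c)%R -> summable A f M -> summable A (fun x => c * f x)%R (c * M).
Proof.
  intros Hc HM l Hn Hf. rewrite rsum_scal. apply Rmult_le_compat_l; auto.
Qed.

Lemma is_sum_ext {T : Type} (A : T -> Prop) (f g : T -> C) (s : C) :
  (forall x, A x -> f x = g x) -> is_sum A f s -> is_sum A g s.
Proof.
  intros HE. rewrite !is_sum_net. apply net_lim_ext. intros l _ Hf.
  apply lsum_ext. rewrite Forall_forall in Hf. auto.
Qed.

Lemma is_sum_plus {T : Type} (A : T -> Prop) (f g : T -> C) (s t : C) :
  is_sum A f s -> is_sum A g t -> is_sum A (fun x => f x + g x) (s + t).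
Proof.
  rewrite !is_sum_net. intros H1 H2.
  eapply net_lim_ext; [|apply net_lim_plus; eauto].
  intros; symmetry; apply lsum_plus.
Qed.

Lemma is_sum_scal {T : Type} (A : T -> Prop) (f : T -> C) (c s : C) :
  is_sum A f s -> is_sum A (fun x => c * f x) (c * s).
Proof.
  rewrite !is_sum_net. intros H1.
  eapply net_lim_ext; [|apply net_lim_mult; [apply net_lim_const|exact H1]].
  intros; symmetry; apply lsum_scal.
Qed.

Lemma is_sum_opp {T : Type} (A : T -> Prop) (f : T -> C) (s : C) :
  is_sum A f s -> is_sum A (fun x => - f x) (- s).
Proof.
  intros H. apply (is_sum_scal A f (- (1)) s) in H.
  replace (- s) with (- (1) * s) by ring.
  eapply is_sum_ext; [|exact H]. intros; simpl; ring.
Qed.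

Lemma is_sum_minus {T : Type} (A : T -> Prop) (f g : T -> C) (s t : C) :
  is_sum A f s -> is_sum A g t -> is_sum A (fun x => f x - g x) (s - t).
Proof. intros H1 H2. apply is_sum_plus; auto. apply is_sum_opp; auto. Qed.

Lemma is_sum_0 {T : Type} (A : T -> Prop) (f : T -> C) :
  (forall x, A x -> f x = 0) -> is_sum A f 0.
Proof.
  intros H. apply is_sum_net. eapply net_lim_ext; [|apply net_lim_const].
  intros l _ Hf. rewrite Forall_forall in Hf. symmetry.
  rewrite (lsum_ext f (fun x => 0 * f x)); [rewrite lsum_scal; ring|].
  intros x Hx. rewrite H; auto. ring.
Qed.

Lemma NoDup_map_inj {T U : Type} (A : T -> Prop) (h : T -> U) l :
  (forall x y, A x -> A y -> h x = h y -> x = y) ->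
  Forall A l -> NoDup l -> NoDup (map h l).
Proof.
  intros Hi Hf Hn. induction Hn as [|a l Ha Hn IH]; simpl; [constructor|].
  inversion Hf; subst. constructor; auto. intros Hin.
  apply in_map_iff in Hin. destruct Hin as (x & E & Hx).
  rewrite Forall_forall in *. apply Ha. rewrite <- (Hi x a); auto.
Qed.

Lemma summable_inj {T U : Type} (A : T -> Prop) (B : U -> Prop) (h : T -> U)
  (f : U -> R) (M : R) :
  (forall x, A x -> B (h x)) ->
  (forall x y, A x -> A y -> h x = h y -> x = y) ->
  summable B f M -> summable A (fun x => f (h x)) M.
Proof.
  intros H1 H2 H l Hn Hf. rewrite <- rsum_map. apply H.
  - eapply NoDup_map_inj; eauto.
  - rewrite Forall_forall in *. intros y Hy. apply in_map_iff in Hy.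
    destruct Hy as (x & <- & Hx); auto.
Qed.

Lemma is_sum_bij {T U : Type} (A : T -> Prop) (B : U -> Prop) (h : T -> U) (k : U -> T)
  (f : U -> C) (s : C) :
  (forall x, A x -> B (h x) /\ k (h x) = x) ->
  (forall y, B y -> A (k y) /\ h (k y) = y) ->
  is_sum B f s -> is_sum A (fun x => f (h x)) s.
Proof.
  intros Hh Hk. rewrite !is_sum_net. intros H eps He.
  destruct (H eps He) as (l0 & H1 & H2 & H3).
  exists (map k l0). split; [|split].
  - eapply (NoDup_map_inj B); eauto. intros x y Hx Hy E.
    apply Hk in Hx. apply Hk in Hy. destruct Hx as [_ <-], Hy as [_ <-]. congruence.
  - rewrite Forall_forall in *. intros x Hx. apply in_map_iff in Hx.
    destruct Hx as (y & <- & Hy). apply Hk; auto.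
  - intros l Hn Hf Hi. rewrite <- lsum_map. apply H3.
    + eapply (NoDup_map_inj A); eauto. intros x y Hx Hy E.
      apply Hh in Hx. apply Hh in Hy. destruct Hx as [_ <-], Hy as [_ <-]. congruence.
    + rewrite Forall_forall in *. intros y Hy. apply in_map_iff in Hy.
      destruct Hy as (x & <- & Hx). apply Hh; auto.
    + intros y Hy. rewrite Forall_forall in H2.
      destruct (Hk y (H2 y Hy)) as [_ E]. rewrite <- E. apply in_map. apply Hi.
      apply in_map; auto.
Qed.

Lemma lsum_filter_zero {T : Type} (P : T -> bool) (f : T -> C) l :
  (forall x, In x l -> P x = false -> f x = 0) -> lsum f (filter P l) = lsum f l.
Proof.
  induction l as [|a l IH]; simpl; intros H; [auto|].
  unfold lsum in *. simpl. destruct (P a) eqn:E; simpl; rewrite IH; auto.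
  rewrite (H a); auto. ring.
Qed.

Definition decb (P : Prop) : bool := if excluded_middle_informative P then true else false.

Lemma decb_intro (P : Prop) : P -> decb P = true.
Proof. unfold decb. destruct (excluded_middle_informative P); tauto. Qed.

Lemma decb_elim (P : Prop) : decb P = true -> P.
Proof. unfold decb. destruct (excluded_middle_informative P); [auto|discriminate]. Qed.

(** Vanishing terms may be added or dropped. This allows sums over nonzero lattice points to be
    treated as sums over a group, and finite sums as sums over everything. *)
Lemma is_sum_extend {T : Type} (A B : T -> Prop) (f : T -> C) (s : C) :
  (forall x, A x -> B x) -> (forall x, B x -> ~ A x -> f x = 0) ->
  is_sum A f s <-> is_sum B f s.
Proof.
  intros HAB H0.
  assert (HF : forall l, Forall B l ->
     lsum f (filter (fun x => decb (A x)) l) = lsum f l).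
  { intros l Hf. apply lsum_filter_zero. rewrite Forall_forall in Hf. intros x Hx E.
    apply H0; auto. intros HA. apply decb_intro in HA. congruence. }
  rewrite !is_sum_net. split; intros H eps He.
  - destruct (H eps He) as (l0 & H1 & H2 & H3). exists l0. split; [|split]; auto.
    { eapply Forall_impl; eauto. }
    intros l Hn Hf Hi. rewrite <- (HF l Hf). apply H3.
    + apply NoDup_filter; auto.
    + apply Forall_forall. intros x Hx. apply filter_In in Hx. apply decb_elim, Hx.
    + intros x Hx. apply filter_In. split; [apply Hi; auto|].
      apply decb_intro. rewrite Forall_forall in H2. auto.
  - destruct (H eps He) as (l0 & H1 & H2 & H3).
    exists (filter (fun x => decb (A x)) l0). split; [|split].
    + apply NoDup_filter; auto.
    + apply Forall_forall. intros x Hx. apply filter_In in Hx. apply decb_elim, Hx.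
    + intros l Hn Hf Hi.
      (* A list inside [A] need not contain the points of [l0] outside [A]; appending them leaves
         the sum unchanged. *)
      set (l' := l ++ filter (fun x => negb (decb (A x))) l0).
      assert (E : lsum f l' = lsum f l).
      { unfold l'. rewrite lsum_app.
        rewrite (lsum_ext f (fun x => 0 * f x) (filter _ _)), lsum_scal; [ring|].
        intros x Hx. apply filter_In in Hx. destruct Hx as [Hx1 Hx2].
        rewrite H0; [ring| |]. { rewrite Forall_forall in H2; auto. }
        intros HA. apply decb_intro in HA. rewrite HA in Hx2. discriminate. }
      rewrite <- E. apply H3; unfold l'.
      * apply NoDup_app; auto; [apply NoDup_filter; auto|].
        intros x Hx Hx'. apply filter_In in Hx'. destruct Hx' as [_ Hx'].
        rewrite Forall_forall in Hf. apply Hf, decb_intro in Hx. rewrite Hx in Hx'.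
        discriminate.
      * apply Forall_app. split; [eapply Forall_impl; eauto|].
        apply Forall_forall. intros x Hx. apply filter_In in Hx.
        rewrite Forall_forall in H2. apply H2, Hx.
      * intros x Hx. apply in_or_app. destruct (decb (A x)) eqn:EA.
        -- left. apply Hi. apply filter_In; auto.
        -- right. apply filter_In. rewrite EA. auto.
Qed.

Lemma lsum_zero {T : Type} (f : T -> C) l : (forall x, In x l -> f x = 0) -> lsum f l = 0.
Proof.
  intros H. rewrite (lsum_ext f (fun x => 0 * f x)); [rewrite lsum_scal; ring|].
  intros x Hx. rewrite H; auto. ring.
Qed.

(** One finite list has to be good twice: close to the fibre sums over [v], and large enough to
    contain the prescribed [l0] over [v], so that its sum is also close to the total. The error per
    fibre is free, hence can be chosen after [v]. *)
Lemma fiber_approx {T U : Type} (A : T -> Prop) (B : U -> Prop) (p : T -> U)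
  (f : T -> C) (g : U -> C) :
  (forall u, B u -> is_sum (fun t => A t /\ p t = u) f (g u)) ->
  forall (l0 : list T) (d : R), Forall A l0 -> (0 < d)%R ->
  forall v, NoDup v -> Forall B v ->
  exists l, NoDup l /\ Forall (fun t => A t /\ In (p t) v) l /\
    (forall t, In t l0 -> In (p t) v -> In t l) /\
    (Cmod (lsum f l - lsum g v) <= INR (length v) * d)%R.
Proof.
  intros Hg l0 d H0 Hd v Hn Hf.
  induction Hn as [|u v Hu Hn IH].
  - exists nil. split; [constructor|split; [constructor|split; [auto|]]].
    unfold lsum; simpl. replace (0 - 0) with (RtoC 0) by ring. rewrite Cmod_0. lra.
  - inversion Hf as [|? ? Hu1 Hv1]; subst. destruct IH as (l & I1 & I2 & I3 & I4); auto.
    destruct (proj1 (is_sum_net _ _ _) (Hg u Hu1) d Hd) as (m0 & M1 & M2 & M3).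
    destruct (lists_union (fun t => A t /\ p t = u) m0
                (filter (fun t => decb (p t = u)) l0)) as (m & N1 & N2 & N3 & N4); auto.
    { apply Forall_forall. intros x Hx. apply filter_In in Hx. destruct Hx as [Hx1 Hx2].
      apply decb_elim in Hx2. rewrite Forall_forall in H0. split; auto. }
    specialize (M3 m N1 N2 N3).
    exists (m ++ l). rewrite Forall_forall in N2, I2. split; [|split; [|split]].
    + apply NoDup_app; auto. intros x Hx Hx'. apply Hu.
      destruct (N2 x Hx) as [_ <-]. apply I2; auto.
    + apply Forall_forall. intros x Hx. apply in_app_or in Hx. destruct Hx as [Hx|Hx].
      * destruct (N2 x Hx) as [Ha <-]. split; auto. left; auto.
      * destruct (I2 x Hx). split; auto. right; auto.
    + intros t Ht [E|E]; apply in_or_app.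
      * left. apply N4, filter_In. split; auto. apply decb_intro; auto.
      * right. auto.
    + rewrite lsum_app. change (lsum g (u :: v)) with (g u + lsum g v).
      replace (lsum f m + lsum f l - (g u + lsum g v))
        with ((lsum f m - g u) + (lsum f l - lsum g v)) by ring.
      eapply Rle_trans; [apply Cmod_triangle|].
      change (length (u :: v)) with (S (length v)). rewrite S_INR. lra.
Qed.

(** Associativity of unconditional summation. All rearrangements rest on it: iterated sums, Cauchy
    products and the collection of a double series by degree. *)
Lemma is_sum_fibers {T U : Type} (A : T -> Prop) (B : U -> Prop) (p : T -> U)
  (f : T -> C) (g : U -> C) (s : C) :
  (forall t, A t -> B (p t)) ->
  (forall u, B u -> is_sum (fun t => A t /\ p t = u) f (g u)) ->
  is_sum A f s -> is_sum B g s.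
Proof.
  intros HB Hg. rewrite !is_sum_net. intros H eps He.
  destruct (H (eps / 2)%R ltac:(lra)) as (l0 & H1 & H2 & H3).
  exists (nodup eq_dec_classical (map p l0)). split; [apply NoDup_nodup|split].
  - apply Forall_forall. intros u Hu. apply nodup_In, in_map_iff in Hu.
    destruct Hu as (t & <- & Ht). rewrite Forall_forall in H2. auto.
  - intros v Hn Hf Hi.
    set (d := (eps / 2 / (INR (length v) + 1))%R).
    assert (HL : (0 <= INR (length v))%R) by apply pos_INR.
    assert (Hd : (0 < d)%R) by (apply Rdiv_lt_0_compat; lra).
    destruct (fiber_approx A B p f g Hg l0 d H2 Hd v Hn Hf) as (l & I1 & I2 & I3 & I4).
    assert (Hlt : (Cmod (lsum f l - s) < eps / 2)%R).
    { apply H3; auto.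
      - eapply Forall_impl; [|exact I2]. intros a Ha; apply Ha.
      - intros t Ht. apply I3; auto. apply Hi, nodup_In, in_map; auto. }
    assert (Hd2 : (INR (length v) * d <= eps / 2)%R).
    { replace (eps / 2)%R with ((INR (length v) + 1) * d)%R by (unfold d; field; lra).
      nra. }
    replace (lsum g v - s) with ((lsum f l - s) + - (lsum f l - lsum g v)) by ring.
    eapply Rle_lt_trans; [apply Cmod_triangle|]. rewrite Cmod_opp. lra.
Qed.

Lemma rsum_list_prod {T U : Type} (f : T -> R) (g : U -> R) l m :
  rsum (fun x => f (fst x) * g (snd x))%R (list_prod l m) = (rsum f l * rsum g m)%R.
Proof.
  induction l as [|a l IH]; simpl.
  - unfold rsum; simpl; ring.
  - rewrite rsum_app, IH, rsum_map. simpl. rewrite rsum_scal. unfold rsum; simpl; ring.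
Qed.

Lemma NoDup_list_prod {T U : Type} (l : list T) (m : list U) :
  NoDup l -> NoDup m -> NoDup (list_prod l m).
Proof.
  intros Hl Hm. induction Hl as [|a l Ha Hl IH]; simpl; [constructor|].
  apply NoDup_app; auto.
  - apply (NoDup_map_inj (fun _ => True)); auto; [|apply Forall_forall; auto].
    intros x y _ _ E. congruence.
  - intros x Hx Hx'. apply in_map_iff in Hx. destruct Hx as (y & <- & Hy).
    apply in_prod_iff in Hx'. tauto.
Qed.

Definition cross {T U : Type} (A : T -> Prop) (B : U -> Prop) : T * U -> Prop :=
  fun x => A (fst x) /\ B (snd x).

(** A finite set of pairs lies in the rectangle spanned by its two projections. *)
Lemma summable_prod {T U : Type} (A : T -> Prop) (B : U -> Prop)
  (f : T -> R) (g : U -> R) (M N : R) :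
  (forall x, 0 <= f x)%R -> (forall y, 0 <= g y)%R ->
  summable A f M -> summable B g N ->
  summable (cross A B) (fun x => f (fst x) * g (snd x))%R (M * N).
Proof.
  intros Hf Hg HM HN l Hn Hl. rewrite Forall_forall in Hl.
  set (l1 := nodup eq_dec_classical (map fst l)).
  set (l2 := nodup eq_dec_classical (map snd l)).
  assert (F1 : Forall A l1).
  { apply Forall_forall. intros x Hx. apply nodup_In, in_map_iff in Hx.
    destruct Hx as (y & <- & Hy). apply Hl; auto. }
  assert (F2 : Forall B l2).
  { apply Forall_forall. intros x Hx. apply nodup_In, in_map_iff in Hx.
    destruct Hx as (y & <- & Hy). apply Hl; auto. }
  assert (N1 : NoDup l1) by apply NoDup_nodup.
  assert (N2 : NoDup l2) by apply NoDup_nodup.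
  apply Rle_trans with (rsum (fun x => f (fst x) * g (snd x))%R (list_prod l1 l2)).
  - apply rsum_incl; auto.
    + apply NoDup_list_prod; auto.
    + intros [x y] Hx. apply in_prod_iff. split; apply nodup_In.
      * apply (in_map fst) in Hx. exact Hx.
      * apply (in_map snd) in Hx. exact Hx.
    + intros x _. apply Rmult_le_pos; auto.
  - rewrite rsum_list_prod. apply Rmult_le_compat; auto; apply rsum_ge_0; auto.
Qed.

Lemma is_sum_rows {T U : Type} (A : T -> Prop) (B : U -> Prop)
  (f : T * U -> C) (g : U -> C) (s : C) :
  (forall u, B u -> is_sum A (fun t => f (t, u)) (g u)) ->
  is_sum (cross A B) f s -> is_sum B g s.
Proof.
  intros Hg. apply is_sum_fibers with (p := snd).
  - intros t [_ H]; auto.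
  - intros u Hu.
    apply is_sum_ext with (f := fun x => (fun t => f (t, u)) (fst x)).
    { intros [x y] [_ E]. simpl in *. congruence. }
    apply (is_sum_bij _ A fst (fun t => (t, u)) (fun t => f (t, u))); auto.
    + intros [x y] [[H1 H2] E]. simpl in *. subst; auto.
    + intros y Hy. simpl. repeat split; auto.
Qed.

(** Absolute summability gives the existence of the double sum; summing it by rows identifies its
    value. *)
Lemma is_sum_prod {T U : Type} (A : T -> Prop) (B : U -> Prop)
  (f : T -> C) (g : U -> C) (M N : R) (s t : C) :
  summable A (fun x => Cmod (f x)) M -> summable B (fun x => Cmod (g x)) N ->
  is_sum A f s -> is_sum B g t ->
  is_sum (cross A B) (fun x => f (fst x) * g (snd x)) (s * t).
Proof.
  intros HM HN Hs Ht.
  destruct (ex_is_sum (cross A B) (fun x => f (fst x) * g (snd x)) (M * N))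
    as (u & Hu & _).
  { apply summable_le with (fun x => Cmod (f (fst x)) * Cmod (g (snd x)))%R.
    - intros x _. rewrite Cmod_mult. lra.
    - apply (summable_prod A B (fun x => Cmod (f x)) (fun x => Cmod (g x)));
        auto using Cmod_ge_0. }
  replace (s * t) with u; auto.
  apply (is_sum_unique B (fun y => s * g y)).
  - apply (is_sum_rows A B (fun x => f (fst x) * g (snd x))); auto.
    intros y Hy. simpl. apply (is_sum_scal A f (g y)) in Hs.
    rewrite (Cmult_comm s). eapply is_sum_ext; [|exact Hs]. intros; simpl; ring.
  - apply is_sum_scal; auto.
Qed.

Lemma Forall_True {T : Type} (l : list T) : Forall (fun _ => True) l.
Proof. apply Forall_forall; auto. Qed.

(** * Complex algebras and formal power series *)

(** Commutative C-algebras with plain equality, packaged so that [ring] works uniformly over C, over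
    series in time and over series in z. The map [scalar] supplies division by integers. *)
Record calg := CAlg {
  car :> Type;
  azero : car; aone : car;
  aadd : car -> car -> car; amul : car -> car -> car;
  asub : car -> car -> car; aopp : car -> car;
  scalar : C -> car;
  calg_ring : ring_theory azero aone aadd amul asub aopp eq;
  scalar_0 : scalar 0 = azero;
  scalar_1 : scalar 1 = aone;
  scalar_add : forall x y, scalar (x + y) = aadd (scalar x) (scalar y);
  scalar_mul : forall x y, scalar (x * y) = amul (scalar x) (scalar y)
}.

Arguments azero {c}. Arguments aone {c}.
Arguments aadd {c}. Arguments amul {c}. Arguments asub {c}. Arguments aopp {c}.
Arguments scalar {c}.

Declare Scope calg_scope.
Delimit Scope calg_scope with A.
Notation "0" := azero : calg_scope.
Notation "1" := aone : calg_scope.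
Notation "x + y" := (aadd x y) : calg_scope.
Notation "x * y" := (amul x y) : calg_scope.
Notation "x - y" := (asub x y) : calg_scope.
Notation "- x" := (aopp x) : calg_scope.

(** The integer constants of [ring]: coefficients on which the tactic computes and which can be
    cancelled by [zr_eq_0]. *)
Definition zr {A : calg} (n : Z) : A := scalar (RtoC (IZR n)).

Ltac zr_cst t :=
  match t with
  | zr ?n => match isZcst n with true => n | _ => constr:(NotConstant) end
  | _ => constr:(NotConstant)
  end.

Lemma scalar_opp {A : calg} (x : C) : @scalar A (- x) = aopp (scalar x).
Proof.
  pose proof (calg_ring A) as R.
  assert (H : aadd (scalar (- x)) (scalar x) = @azero A).
  { rewrite <- scalar_add, <- scalar_0. f_equal. ring. }
  rewrite <- (Radd_0_l R (scalar (- x))), (Radd_comm R), <- (Ropp_def R (scalar x)).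
  rewrite (Radd_assoc R), H, (Radd_0_l R). reflexivity.
Qed.

Lemma zr_morph (A : calg) :
  ring_morph (@azero A) aone aadd amul asub aopp eq
    0%Z 1%Z Z.add Z.mul Z.sub Z.opp Z.eqb zr.
Proof.
  constructor; unfold zr.
  - apply scalar_0.
  - apply scalar_1.
  - intros x y. rewrite plus_IZR, RtoC_plus. apply scalar_add.
  - intros x y. rewrite minus_IZR, RtoC_minus, (Rsub_def (calg_ring A)), <- scalar_opp.
    apply scalar_add.
  - intros x y. rewrite mult_IZR, RtoC_mult. apply scalar_mul.
  - intros x. rewrite opp_IZR, RtoC_opp. apply scalar_opp.
  - intros x y H. apply Z.eqb_eq in H. congruence.
Qed.

Lemma CC_ring : ring_theory (RtoC 0) (RtoC 1) Cplus Cmult Cminus Copp eq.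
Proof. exact (F_R C_field_theory). Qed.

Definition CC : calg :=
  CAlg C (RtoC 0) (RtoC 1) Cplus Cmult Cminus Copp (fun x => x) CC_ring
    eq_refl eq_refl (fun _ _ => eq_refl) (fun _ _ => eq_refl).

Section PowerSeries.
Variable A : calg.
Add Ring A_ring : (calg_ring A) (morphism (zr_morph A), constants [zr_cst]).
Local Open Scope calg_scope.

Definition tl {T : Type} (f : nat -> T) : nat -> T := fun n => f (S n).

(* The recursion on the first factor makes the ring laws plain inductions. *)
Fixpoint smul (f g : nat -> A) (n : nat) : A :=
  match n with
  | O => f O * g O
  | S m => f O * g (S m) + smul (tl f) g m
  end.

Definition sconst (c : A) : nat -> A := fun n => match n with O => c | S _ => 0 end.

Lemma smul_add_l f g h n : smul (fun i => f i + g i) h n = smul f h n + smul g h n.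
Proof.
  revert f g. induction n as [|n IH]; intros f g; simpl; [ring|].
  unfold tl. rewrite (IH (fun i => f (S i)) (fun i => g (S i))). unfold tl. ring.
Qed.

Lemma smul_scal_l c f h n : smul (fun i => c * f i) h n = c * smul f h n.
Proof.
  revert f. induction n as [|n IH]; intros f; simpl; [ring|].
  unfold tl. rewrite (IH (fun i => f (S i))). unfold tl. ring.
Qed.

Lemma smul_0_l h n : smul (fun _ => 0) h n = 0.
Proof. induction n as [|n IH]; simpl; [ring|]. unfold tl. rewrite IH. ring. Qed.

Lemma smul_const_l c h n : smul (sconst c) h n = c * h n.
Proof.
  destruct n; simpl; [ring|]. unfold tl. simpl.
  replace (fun n0 : nat => 0) with (fun _ : nat => @azero A) by reflexivity.
  rewrite smul_0_l. ring.
Qed.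

Lemma smul_S_r f g n : smul f g (S n) = f (S n) * g O + smul f (tl g) n.
Proof.
  revert f. induction n as [|n IH]; intros f.
  - simpl. unfold tl. ring.
  - change (smul f g (S (S n))) with (f O * g (S (S n)) + smul (tl f) g (S n)).
    rewrite IH. simpl. unfold tl. ring.
Qed.

Lemma smul_comm f g n : smul f g n = smul g f n.
Proof.
  revert f. induction n as [|n IH]; intros f; [simpl; ring|].
  rewrite (smul_S_r g f). simpl. rewrite IH. ring.
Qed.

Lemma smul_assoc f g h n : smul (smul f g) h n = smul f (smul g h) n.
Proof.
  revert f. induction n as [|n IH]; intros f; [simpl; ring|].
  change (smul (smul f g) h (S n))
    with ((f O * g O) * h (S n) + smul (fun i => f O * g (S i) + smul (tl f) g i) h n).
  rewrite smul_add_l, smul_scal_l, IH. simpl. unfold tl. ring.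
Qed.

Lemma series_ring :
  ring_theory (fun _ => 0) (sconst 1) (fun f g n => f n + g n) smul
    (fun f g n => f n - g n) (fun f n => - f n) eq.
Proof.
  constructor; intros; apply functional_extensionality; intros n; try ring.
  - rewrite smul_const_l. ring.
  - apply smul_comm.
  - symmetry; apply smul_assoc.
  - apply smul_add_l.
Qed.

(** Kept transparent, since later proofs read off coefficients by conversion. *)
Definition series : calg.
Proof.
  refine (CAlg (nat -> A) (fun _ => 0) (sconst 1) (fun f g n => f n + g n) smul
    (fun f g n => f n - g n) (fun f n => - f n) (fun c => sconst (scalar c))
    series_ring _ _ _ _).
  - apply functional_extensionality; intros [|n]; simpl; [apply scalar_0|reflexivity].
  - rewrite scalar_1. reflexivity.
  - intros x y. apply functional_extensionality; intros [|n]; simpl;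
      [apply scalar_add|ring].
  - intros x y. apply functional_extensionality; intros n.
    rewrite smul_const_l, scalar_mul. destruct n; simpl; ring.
Defined.

(** Nonzero integers are invertible through [scalar]; this replaces division in an algebra that may
    have zero divisors. *)
Lemma zr_eq_0 (n : Z) (x : A) : n <> 0%Z -> zr n * x = 0 -> x = 0.
Proof.
  intros Hn H.
  assert (E : scalar (/ RtoC (IZR n)) * (zr n * x) = x).
  { unfold zr. rewrite (Rmul_assoc (calg_ring A)), <- scalar_mul, Cinv_l, scalar_1; [ring|].
    intros E. apply RtoC_inj in E. apply eq_IZR in E. auto. }
  rewrite <- E, H. ring.
Qed.

Lemma zr_div (n : Z) (x : A) : n <> 0%Z -> zr n * (scalar (/ RtoC (IZR n)) * x) = x.
Proof.
  intros Hn. unfold zr.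
  rewrite (Rmul_assoc (calg_ring A)), <- scalar_mul, Cinv_r, scalar_1; [ring|].
  intros E. apply RtoC_inj in E. apply eq_IZR in E. auto.
Qed.

(** The form in which uniqueness arguments use a product: at the first index where [g] may be
    nonzero, only the constant term of [f] contributes. *)
Lemma smul_low (f g : nat -> A) n :
  (forall j, (j < n)%nat -> g j = 0) -> smul f g n = f O * g n.
Proof.
  revert f g. induction n as [|n IH]; intros f g H; [reflexivity|].
  rewrite smul_S_r, (H O) by lia. rewrite IH.
  - unfold tl. ring.
  - intros j Hj. apply H. lia.
Qed.

Lemma smul_ext (f f' g g' : nat -> A) n :
  (forall j, (j <= n)%nat -> f j = f' j) -> (forall j, (j <= n)%nat -> g j = g' j) ->
  smul f g n = smul f' g' n.
Proof.
  revert f f'. induction n as [|n IH]; intros f f' Hf Hg; simpl.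
  - rewrite Hf, Hg; auto.
  - rewrite Hf, Hg by lia. f_equal. apply IH; intros j Hj; [apply Hf|apply Hg]; lia.
Qed.

Definition sX : series := fun n => match n with 1%nat => 1 | _ => 0 end.

Lemma smul_X (f : series) n : (sX * f) n = match n with O => 0 | S m => f m end.
Proof.
  change ((sX * f) n) with (smul sX f n).
  destruct n as [|n]; simpl; [unfold sX; ring|].
  replace (tl sX) with (sconst 1).
  - rewrite smul_const_l. unfold sX. ring.
  - apply functional_extensionality. intros [|m]; reflexivity.
Qed.

(** The operator [z d/dz]. It is diagonal on coefficients, so a differential equation can be read
    off degree by degree. *)
Definition euler (f : series) : series := fun n => zr (Z.of_nat n) * f n.

End PowerSeries.

Definition cst {A : calg} (c : A) : series A := sconst A c.

Arguments smul {A}. Arguments sconst {A}. Arguments sX {A}. Arguments euler {A}.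

(** * Derivations of algebras of series *)

Record derivation {A : calg} (d : A -> A) : Prop := {
  d_add : forall x y, d (x + y)%A = (d x + d y)%A;
  d_mul : forall x y, d (x * y)%A = (d x * y + x * d y)%A;
  d_scalar : forall c, d (scalar c) = 0%A
}.

Section Derivations.
Variable A : calg.
Add Ring A_ring' : (calg_ring A) (morphism (zr_morph A), constants [zr_cst]).
Local Open Scope calg_scope.

Lemma d_zr (d : A -> A) n : derivation d -> d (zr n) = 0.
Proof. intros H. apply (d_scalar d H). Qed.

Lemma d_opp (d : A -> A) x : derivation d -> d (- x) = - d x.
Proof.
  intros H. replace (- x) with (zr (-1) * x) by ring.
  rewrite (d_mul d H), d_zr by auto. ring.
Qed.

Lemma d_sub (d : A -> A) x y : derivation d -> d (x - y) = d x - d y.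
Proof.
  intros H. replace (x - y) with (x + - y) by ring.
  rewrite (d_add d H), d_opp by auto. ring.
Qed.

Lemma euler_derivation : derivation (@euler A).
Proof.
  constructor.
  - intros x y. apply functional_extensionality; intros n. unfold euler; simpl. ring.
  - intros x y. apply functional_extensionality; intros n.
    change (zr (Z.of_nat n) * smul x y n = smul (euler x) y n + smul x (euler y) n).
    revert x. induction n as [|n IH]; intros x.
    + simpl. unfold euler. simpl. ring.
    + change (zr (Z.of_nat (S n)) * (x O * y (S n) + smul (tl x) y n) =
        zr 0 * x O * y (S n) + smul (tl (euler x)) y n +
        (x O * (zr (Z.of_nat (S n)) * y (S n)) + smul (tl x) (euler y) n)).
      assert (E : smul (tl (euler x)) y n = smul (euler (tl x)) y n + smul (tl x) y n).
      { rewrite <- smul_add_l. f_equal. apply functional_extensionality. intros i.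
        unfold tl, euler. rewrite Nat2Z.inj_succ. unfold Z.succ.
        rewrite (morph_add (zr_morph A)). ring. }
      rewrite E, Nat2Z.inj_succ. unfold Z.succ. rewrite (morph_add (zr_morph A)).
      transitivity (zr (Z.of_nat n) * smul (tl x) y n + smul (tl x) y n +
                    (zr (Z.of_nat n) + zr 1) * x O * y (S n)); [ring|].
      rewrite IH. ring.
  - intros c. apply functional_extensionality; intros [|n]; unfold euler; simpl; ring.
Qed.

(** A derivation of the coefficients that treats z as a constant. *)
Definition lift (d : A -> A) (f : series A) : series A := fun n => d (f n).

Lemma d_0 (d : A -> A) : derivation d -> d 0 = 0.
Proof. intros H. replace 0 with (@zr A 0) by ring. rewrite d_zr; auto. ring. Qed.

Lemma lift_derivation (d : A -> A) : derivation d -> derivation (lift d).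
Proof.
  intros H. constructor.
  - intros x y. apply functional_extensionality; intros n. apply (d_add d H).
  - intros x y. apply functional_extensionality; intros n. unfold lift. simpl.
    revert x. induction n as [|n IH]; intros x; simpl.
    + apply (d_mul d H).
    + rewrite (d_add d H), (d_mul d H). rewrite IH. unfold tl. ring.
  - intros c. apply functional_extensionality; intros [|n]; unfold lift; simpl.
    + apply (d_scalar d H).
    + apply d_0; auto.
Qed.

Lemma euler_lift (d : A -> A) f : derivation d -> euler (lift d f) = lift d (euler f).
Proof.
  intros H. apply functional_extensionality; intros n. unfold euler, lift.
  rewrite (d_mul d H), d_zr by auto. ring.
Qed.

(** The ordinary derivative, obtained from [euler] by dividing by the variable; it serves as d/dt
    for series in the time. *)
Definition sderiv (f : series A) : series A := tl (euler f).

Lemma sderiv_derivation : derivation sderiv.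
Proof.
  constructor.
  - intros x y. unfold sderiv. rewrite (d_add _ euler_derivation). reflexivity.
  - intros x y. unfold sderiv. rewrite (d_mul _ euler_derivation).
    apply functional_extensionality; intros n.
    change (smul (euler x) y (S n) + smul x (euler y) (S n) =
            smul (tl (euler x)) y n + smul x (tl (euler y)) n).
    rewrite (smul_S_r A x).
    change (smul (euler x) y (S n))
      with (zr 0 * x O * y (S n) + smul (tl (euler x)) y n).
    change (euler y O) with (zr 0 * y O). ring.
  - intros c. unfold sderiv. rewrite (d_scalar _ euler_derivation). reflexivity.
Qed.

End Derivations.

Arguments lift {A}. Arguments sderiv {A}.

Fixpoint approx {T : Type} (x0 : T) (Phi : (nat -> T) -> nat -> T) (n : nat) : nat -> T :=
  match n with O => fun _ => x0 | S m => Phi (approx x0 Phi m) end.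

(** The value at k of the n-th iterate no longer changes once n > k, so the diagonal is a fixed
    point. *)
Lemma course_of_values {T : Type} (x0 : T) (Phi : (nat -> T) -> nat -> T) :
  (forall f g k, (forall j, (j < k)%nat -> f j = g j) -> Phi f k = Phi g k) ->
  exists f, forall k, f k = Phi f k.
Proof.
  intros H.
  assert (HS : forall k n m, (k < n)%nat -> (k < m)%nat ->
                 approx x0 Phi n k = approx x0 Phi m k).
  { intros k. induction k as [k IH] using lt_wf_ind. intros [|n] [|m] Hn Hm; try lia.
    simpl. apply H. intros j Hj. apply IH; lia. }
  exists (fun k => approx x0 Phi (S k) k). intros k.
  change (approx x0 Phi (S k) k) with (Phi (approx x0 Phi k) k).
  apply H. intros j Hj. apply HS; lia.
Qed.

(** * Weierstrass' equations *)

(* Weierstrass' equations in a differential algebra: [D] stands for [z d/dz], [X] for [z],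
    [P], [Q], [Z] and [s] for [z^2 wp], [z^3 wp'], [z zeta] and [sigma / z], while [e = g2 / 2]
    and [L = 12 g3 d/dg2 + 2/3 g2^2 d/dg3]. *)
Section Weierstrass.
Variable A : calg.
Add Ring A_ring'' : (calg_ring A) (morphism (zr_morph A), constants [zr_cst]).
Local Open Scope calg_scope.
Variables (D : A -> A) (X e g3 P Q : A).
Hypothesis HD : derivation D.
Hypotheses (DX : D X = X) (De : D e = 0).
Hypothesis DP : D P = Q + zr 2 * P.
Hypothesis DQ : D Q = zr 6 * P * P - e * X * X * X * X + zr 3 * Q.

Ltac dsimp :=
  repeat rewrite ?(d_add D HD), ?(d_sub A D _ _ HD), ?(d_mul D HD), ?(d_opp A D _ HD),
    ?(d_zr A D _ HD), ?(d_0 A D HD), ?DX, ?De, ?DP, ?DQ.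

(** Equals [z^6 (wp'^2 - 4 wp^3 + g2 wp)], the first integral of [wp'' = 6 wp^2 - g2/2]. *)
Definition wp_integral : A := Q * Q - zr 4 * P * P * P + zr 2 * e * X * X * X * X * P.

Lemma D_wp_integral : D wp_integral = zr 6 * wp_integral.
Proof. unfold wp_integral. dsimp. ring. Qed.

(** If [x = z^n f], this is [z^(n+1) f']: the derivative of f, renormalized. *)
Definition shifted (n : Z) (x : A) : A := D x - zr n * x.

(** Differentiate the second-order equation three times and eliminate [wp^2] by that equation again.
    Here [Q] is [z^3 wp'], so the nested shifts produce [z^7 wp^(5)]. *)
Lemma fifth_order :
  shifted 6 (shifted 5 (shifted 4 (shifted 3 Q))) =
  zr 60 * Q * shifted 3 Q + zr 24 * e * X * X * X * X * Q.
Proof.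
  assert (E3 : shifted 3 Q = zr 6 * P * P - e * X * X * X * X).
  { unfold shifted. dsimp. ring. }
  assert (E4 : shifted 4 (shifted 3 Q) = zr 12 * P * Q).
  { rewrite E3. unfold shifted. dsimp. ring. }
  assert (E5 : shifted 5 (shifted 4 (shifted 3 Q)) = zr 12 * (Q * Q + P * shifted 3 Q)).
  { rewrite E4. unfold shifted. dsimp. ring. }
  rewrite E5, E3. unfold shifted. dsimp. ring.
Qed.

Variables (L : A -> A) (Z s : A).
Hypothesis HL : derivation L.
Hypothesis DL : forall x, D (L x) = L (D x).
Hypotheses (LX : L X = 0) (Le : L e = zr 6 * g3).
Hypothesis DZ : D Z = Z - P.
Hypothesis Ds : D s = Z * s - s.
Hypothesis integral : wp_integral = - (g3 * X * X * X * X * X * X).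

Ltac dlsimp :=
  repeat rewrite ?DL, ?(d_add D HD), ?(d_sub A D _ _ HD), ?(d_mul D HD), ?(d_opp A D _ HD),
    ?(d_zr A D _ HD), ?(d_0 A D HD), ?DX, ?De, ?DP, ?DQ, ?DZ, ?Ds,
    ?(d_add L HL), ?(d_sub A L _ _ HL), ?(d_mul L HL), ?(d_opp A L _ HL),
    ?(d_zr A L _ HL), ?(d_0 A L HL), ?LX, ?Le.

(** Equals [3 z^4 W] for the W of the overview; the factor 3 clears denominators. *)
Definition wp_defect : A :=
  zr 3 * X * X * L P - zr 12 * P * P - zr 6 * Z * Q + zr 4 * e * X * X * X * X.

(** The deviation from Lame's equation is -18 times the first integral plus [g3 z^6], so it vanishes
    precisely through the value of the first integral. *)
Lemma lame : shifted 5 (shifted 4 wp_defect) = zr 12 * P * wp_defect.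
Proof.
  assert (E : shifted 5 (shifted 4 wp_defect) - zr 12 * P * wp_defect =
    zr (-18) * (wp_integral + g3 * X * X * X * X * X * X)).
  { unfold shifted, wp_defect, wp_integral. dlsimp. ring. }
  rewrite integral in E.
  transitivity (shifted 5 (shifted 4 wp_defect) - zr 12 * P * wp_defect
                + zr 12 * P * wp_defect); [ring|]. rewrite E. ring.
Qed.

(** Equals [3 z^3 (L zeta + 2 zeta wp + wp' - g2 z / 6)], whose second factor has derivative
    [-W]. *)
Definition zeta_defect : A :=
  zr 3 * X * X * L Z + zr 6 * Z * P + zr 3 * Q - e * X * X * X * X.

Lemma D_zeta_defect : D zeta_defect = zr 3 * zeta_defect - wp_defect.
Proof. unfold zeta_defect, wp_defect. dlsimp. ring. Qed.

(** Equals [12 z (sigma'' - L sigma + g2 z^2 sigma / 12)], rewritten for [s = sigma / z]. *)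
Definition heat_defect : A :=
  zr 12 * (D (D s) + D s) - zr 12 * X * X * L s + zr 2 * e * X * X * X * X * s.

(** Divided by [12 z sigma], the heat defect is [zeta^2 - wp - L log sigma + g2 z^2 / 12], whose
    derivative is minus the second factor of [zeta_defect]. The identity states this free of
    quotients. *)
Lemma D_heat_defect :
  D heat_defect = heat_defect + Z * heat_defect - zr 4 * zeta_defect * s.
Proof. unfold heat_defect, zeta_defect. dlsimp. ring. Qed.

End Weierstrass.

(** * Formal series of wp, zeta and sigma in z *)

Section Coefficients.
Variable B : calg.
Add Ring B_ring : (calg_ring B) (morphism (zr_morph B), constants [zr_cst]).
Add Ring SB_ring : (calg_ring (series B)) (morphism (zr_morph (series B)), constants [zr_cst]).
Local Open Scope calg_scope.

Lemma coef_add (f g : series B) n : (f + g) n = f n + g n.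
Proof. reflexivity. Qed.

Lemma coef_sub (f g : series B) n : (f - g) n = f n - g n.
Proof. reflexivity. Qed.

Lemma coef_opp (f : series B) n : (- f) n = - f n.
Proof. reflexivity. Qed.

Lemma coef_mul (f g : series B) n : (f * g) n = smul f g n.
Proof. reflexivity. Qed.

Lemma coef_zr k (f : series B) n : (zr k * f) n = zr k * f n.
Proof. apply smul_const_l. Qed.

Lemma coef_const (c : B) (f : series B) n : (cst c * f) n = c * f n.
Proof. apply smul_const_l. Qed.

Lemma coef_mul_X (f : series B) n :
  (f * sX) n = match n with O => 0 | S m => f m end.
Proof. replace (f * sX) with (sX * f) by ring. apply smul_X. Qed.

Lemma coef_mul_X2 (f : series B) n :
  (f * sX * sX) n = match n with S (S m) => f m | _ => 0 end.
Proof. rewrite coef_mul_X. destruct n; [|rewrite coef_mul_X]; reflexivity. Qed.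

Lemma coef_mul_X4 (f : series B) n :
  (f * sX * sX * sX * sX) n = match n with S (S (S (S m))) => f m | _ => 0 end.
Proof. rewrite coef_mul_X2. destruct n as [|[|n]]; [| |rewrite coef_mul_X2]; reflexivity. Qed.

Lemma coef_mul_X6 (f : series B) n :
  (f * sX * sX * sX * sX * sX * sX) n =
  match n with S (S (S (S (S (S m))))) => f m | _ => 0 end.
Proof. rewrite coef_mul_X2. destruct n as [|[|n]]; [| |rewrite coef_mul_X4]; reflexivity. Qed.

Lemma coef_shifted k (f : series B) n :
  shifted _ euler k f n = (zr (Z.of_nat n) - zr k) * f n.
Proof. unfold shifted. rewrite coef_sub, coef_zr. unfold euler. ring. Qed.

Lemma zr_sub m n : @zr B (m - n) = zr m - zr n.
Proof. apply (morph_sub (zr_morph B)). Qed.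

Lemma zr_add m n : @zr B (m + n) = zr m + zr n.
Proof. apply (morph_add (zr_morph B)). Qed.

Lemma zr_mul m n : @zr B (m * n) = zr m * zr n.
Proof. apply (morph_mul (zr_morph B)). Qed.

(** How a differential equation forces a series to vanish: it suffices to kill the first coefficient
    that could be nonzero. *)
Lemma lowest_zero (f : series B) :
  (forall n, (forall j, (j < n)%nat -> f j = 0) -> f n = 0) -> f = 0.
Proof.
  intros H. apply functional_extensionality. intros n.
  induction n as [n IH] using lt_wf_ind. apply H. exact IH.
Qed.

Lemma euler_X : euler (@sX B) = sX.
Proof.
  apply functional_extensionality. intros [|[|n]]; unfold euler, sX; simpl; ring.
Qed.

Lemma euler_const c : euler (@cst B c) = 0.
Proof.
  apply functional_extensionality. intros [|n]; unfold euler, cst, sconst; simpl; ring.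
Qed.

Lemma lift_X (L : B -> B) : derivation L -> lift L (@sX B) = 0.
Proof.
  intros H. apply functional_extensionality. intros [|[|n]]; unfold lift, sX; simpl.
  - apply d_0; auto.
  - replace 1 with (@zr B 1) by ring. apply d_zr; auto.
  - apply d_0; auto.
Qed.

Lemma lift_const (L : B -> B) c : derivation L -> lift L (cst c) = cst (L c).
Proof.
  intros H. apply functional_extensionality. intros [|n]; unfold lift; simpl; auto.
  apply d_0; auto.
Qed.

(** The equation for [P = z^2 wp], multiplied by [z^7]; the term [24 e] is [12 g2]. *)
Definition satisfies_fifth_order (e : B) (P : series B) : Prop :=
  let Q := shifted _ euler 2 P in
  shifted _ euler 6 (shifted _ euler 5 (shifted _ euler 4 (shifted _ euler 3 Q))) =
  zr 60 * Q * shifted _ euler 3 Q + zr 24 * cst e * sX * sX * sX * sX * Q.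

(** At the first index where two solutions could differ, the equation becomes linear in the
    difference, and its indicial polynomial has no zero from 7 on. Its zero at 6 is the freedom of
    g3. *)
Lemma fifth_order_unique (e : B) (P P' : series B) :
  satisfies_fifth_order e P -> satisfies_fifth_order e P' ->
  P O = 1 -> (forall j, (j < 7)%nat -> P j = P' j) -> P = P'.
Proof.
  intros H H' P0 Hlow.
  assert (E : P - P' = 0).
  { apply lowest_zero. intros n IH.
    destruct (le_lt_dec 7 n) as [Hn|Hn].
    2:{ rewrite coef_sub, Hlow by auto. ring. }
    unfold satisfies_fifth_order in H, H'.
    set (Q := shifted _ euler 2 P) in *. set (Q' := shifted _ euler 2 P') in *.
    set (R := shifted _ euler 3 Q) in *. set (R' := shifted _ euler 3 Q') in *.
    set (d := (P - P') n). set (N := @zr B (Z.of_nat n)).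
    assert (EQ : forall j, (Q - Q') j = (zr (Z.of_nat j) - zr 2) * (P - P') j).
    { intros j. unfold Q, Q'. rewrite !coef_sub, !coef_shifted. ring. }
    assert (ER : forall j, (R - R') j = (zr (Z.of_nat j) - zr 3) * (Q - Q') j).
    { intros j. unfold R, R'. rewrite !coef_sub, !coef_shifted. ring. }
    (* Coefficient n of the difference of the two equations. Since the difference vanishes in lower
       degrees, the products only retain the leading coefficients -2 of [z^3 wp'] and 6 of
       [z^4 wp'']. *)
    assert (K : (N - zr 6) * ((N - zr 5) * ((N - zr 4) * ((N - zr 3) * (Q - Q') n))) =
      zr 60 * (zr (-2) * (R - R') n + zr 6 * (Q - Q') n)).
    { assert (Q0 : Q O = zr (-2)).
      { unfold Q. rewrite coef_shifted, P0. simpl. ring. }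
      assert (R0 : R' O = zr 6).
      { unfold R', Q'. rewrite !coef_shifted, <- Hlow, P0 by lia. simpl. ring. }
      transitivity (shifted _ euler 6 (shifted _ euler 5 (shifted _ euler 4 R)) n -
                    shifted _ euler 6 (shifted _ euler 5 (shifted _ euler 4 R')) n).
      { unfold R, R'. rewrite !coef_shifted, coef_sub. unfold N. ring. }
      rewrite H, H', <- coef_sub.
      replace (zr 60 * Q * R + zr 24 * cst e * sX * sX * sX * sX * Q -
         (zr 60 * Q' * R' + zr 24 * cst e * sX * sX * sX * sX * Q'))
        with (zr 60 * (Q * (R - R') + R' * (Q - Q')) +
              zr 24 * (cst e * (Q - Q') * sX * sX * sX * sX)) by ring.
      rewrite coef_add, !coef_zr, coef_add, ?coef_mul_X6, ?coef_mul_X4, ?coef_mul_X2.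
      assert (Hl : forall j, (j < n)%nat -> (Q - Q') j = 0).
      { intros j Hj. rewrite EQ, IH by auto. ring. }
      rewrite !coef_mul, !smul_low; auto.
      2:{ intros j Hj. rewrite ER, Hl by auto. ring. }
      rewrite Q0, R0.
      destruct n as [|[|[|[|m]]]]; try lia.
      cbv beta iota. rewrite coef_const, (Hl m) by lia. ring. }
    rewrite ER, EQ in K. fold d in K.
    set (k := Z.of_nat n) in *. assert (Hk : (7 <= k)%Z) by lia.
    (* The indicial polynomial: [(k-3)(k-4)(k-5)(k-6) + 120(k-3) - 360] equals
       [(k-6)(k+1)(k^2-13k+60)], and four times the quadratic factor is [(2k-13)^2 + 71]. *)
    apply (zr_eq_0 B ((k - 2) * (k - 6) * (k + 1) * (k * k - 13 * k + 60))%Z).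
    { assert (Hp : (0 < k * k - 13 * k + 60)%Z)
        by (pose proof (Z.square_nonneg (2 * k - 13)); lia).
      apply Z.neq_mul_0; split; [|lia].
      repeat (apply Z.neq_mul_0; split); lia. }
    repeat rewrite ?zr_mul, ?zr_sub, ?zr_add.
    change (zr k) with N in K |- *.
    match goal with |- ?l = _ => transitivity
      ((N - zr 6) * ((N - zr 5) * ((N - zr 4) * ((N - zr 3) * ((N - zr 2) * d)))) -
       zr 60 * (zr (-2) * ((N - zr 3) * ((N - zr 2) * d)) + zr 6 * ((N - zr 2) * d))) end.
    { ring. }
    rewrite K. ring. }
  transitivity (P - P' + P'); [ring|]. rewrite E. ring.
Qed.

(** Coefficient k of [z^4 wp'' = 6 P^2 - e z^4]. Moving the two terms [P_0 P_k] of the square to the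
    left changes [(k-2)(k-3)] into [(k-6)(k+1)], and the remaining convolution involves the indices
    from 1 to k-1 only. At the resonance k = 6 the free value is set to g3/28. *)
Definition wp_step (e g3 : B) (f : nat -> B) (k : nat) : B :=
  match k with
  | O => 1
  | 6%nat => scalar (/ RtoC (IZR 28)) * g3
  | S O => 0
  | S (S n) =>
      scalar (/ RtoC (IZR ((Z.of_nat k - 6) * (Z.of_nat k + 1)))) *
      (zr 6 * smul (tl f) (tl f) n - match k with 4%nat => e | _ => 0 end)
  end.

Lemma ex_wp_series (e g3 : B) : exists P : series B, forall k, P k = wp_step e g3 P k.
Proof.
  apply (course_of_values 0). intros f g k H.
  destruct k as [|[|n]]; try reflexivity. unfold wp_step.
  rewrite (smul_ext B (tl f) (tl g) (tl f) (tl g)).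
  - reflexivity.
  - intros j Hj. apply H. lia.
  - intros j Hj. apply H. lia.
Qed.

Section Formal.
Variables (e g3 : B) (P : series B).
Hypothesis HP : forall k, P k = wp_step e g3 P k.

Lemma wp_coef_0 : P O = 1.
Proof. rewrite HP. reflexivity. Qed.

Lemma wp_coef_1 : P 1%nat = 0.
Proof. rewrite HP. reflexivity. Qed.

Lemma wp_coef_6 : zr 28 * P 6%nat = g3.
Proof. rewrite HP. apply zr_div. lia. Qed.

Lemma wp_coef_rec n : zr ((Z.of_nat n - 4) * (Z.of_nat n + 3)) * P (S (S n)) =
  if Nat.eqb n 4 then 0 else
  zr 6 * smul (tl P) (tl P) n - match n with 2%nat => e | _ => 0 end.
Proof.
  destruct (Nat.eqb n 4) eqn:E.
  - apply Nat.eqb_eq in E. subst. simpl. ring.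
  - apply Nat.eqb_neq in E. rewrite HP.
    replace ((Z.of_nat n - 4) * (Z.of_nat n + 3))%Z
      with ((Z.of_nat (S (S n)) - 6) * (Z.of_nat (S (S n)) + 1))%Z by lia.
    replace (wp_step e g3 P (S (S n))) with
      (scalar (/ RtoC (IZR ((Z.of_nat (S (S n)) - 6) * (Z.of_nat (S (S n)) + 1)))) *
      (zr 6 * smul (tl P) (tl P) n - match S (S n) with 4%nat => e | _ => 0 end)).
    + rewrite zr_div by nia. destruct n as [|[|[|n]]]; reflexivity.
    + destruct n as [|[|[|[|[|n]]]]]; try reflexivity. lia.
Qed.

Lemma wp_coef_2 : P 2%nat = 0.
Proof.
  apply (zr_eq_0 B (-12)); [lia|]. etransitivity; [exact (wp_coef_rec 0)|]. cbn. unfold tl. rewrite wp_coef_1. ring.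
Qed.

Lemma wp_coef_3 : P 3%nat = 0.
Proof.
  apply (zr_eq_0 B (-12)); [lia|]. etransitivity; [exact (wp_coef_rec 1)|]. cbn. unfold tl.
  rewrite wp_coef_1, wp_coef_2. ring.
Qed.

Lemma wp_coef_4 : zr 10 * P 4%nat = e.
Proof.
  pose proof (wp_coef_rec 2 : zr (-10) * P 4%nat = _) as H.
  transitivity (- (zr (-10) * P 4%nat)); [ring|]. rewrite H. cbn. unfold tl.
  rewrite wp_coef_1, wp_coef_2, wp_coef_3. ring.
Qed.

Lemma wp_coef_5 : P 5%nat = 0.
Proof.
  apply (zr_eq_0 B (-6)); [lia|]. etransitivity; [exact (wp_coef_rec 3)|]. cbn. unfold tl.
  rewrite wp_coef_1, wp_coef_2, wp_coef_3. ring.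
Qed.

Lemma wp_coef_7 : P 7%nat = 0.
Proof.
  apply (zr_eq_0 B 8); [lia|]. etransitivity; [exact (wp_coef_rec 5)|]. cbn. unfold tl.
  rewrite wp_coef_1, wp_coef_2, wp_coef_3, wp_coef_5. ring.
Qed.

(** The first nonlinear relation between the coefficients. It is what makes the resonance of Lame's
    equation at degree 8 harmless. *)
Lemma wp_coef_8 : zr 3 * P 8%nat = P 4%nat * P 4%nat.
Proof.
  assert (E : zr 6 * (zr 3 * P 8%nat - P 4%nat * P 4%nat) = 0).
  { transitivity (zr 18 * P 8%nat - zr 6 * P 4%nat * P 4%nat); [ring|].
    rewrite (wp_coef_rec 6 : zr 18 * P 8%nat = _). cbn. unfold tl. rewrite wp_coef_1, wp_coef_2, wp_coef_3, wp_coef_5, wp_coef_7. ring. }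
  apply zr_eq_0 in E; [|lia].
  transitivity (zr 3 * P 8%nat - P 4%nat * P 4%nat + P 4%nat * P 4%nat); [ring|].
  rewrite E. ring.
Qed.

Notation Q := (shifted (series B) euler 2 P).

Lemma euler_P : euler P = Q + zr 2 * P.
Proof. unfold shifted. ring. Qed.

(** The second-order equation, coefficient by coefficient: the recurrence with the terms
    [12 P_0 P_k] put back into the square. *)
Lemma euler_Q : euler Q =
  zr 6 * P * P - cst e * sX * sX * sX * sX + zr 3 * Q.
Proof.
  assert (E : shifted _ euler 3 Q = zr 6 * (P * P) - cst e * sX * sX * sX * sX).
  { apply functional_extensionality. intros k.
    rewrite !coef_shifted, coef_sub, coef_zr, ?coef_mul_X6, ?coef_mul_X4, ?coef_mul_X2, coef_mul.
    destruct k as [|[|n]].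
    - simpl. rewrite wp_coef_0. ring.
    - simpl. unfold tl. rewrite wp_coef_1. ring.
    - rewrite smul_S_r. change (smul P (tl P) (S n))
        with (P O * tl P (S n) + smul (tl P) (tl P) n).
      unfold tl at 1. rewrite wp_coef_0.
      pose proof (wp_coef_rec n) as H.
      rewrite !Nat2Z.inj_succ. unfold Z.succ.
      repeat rewrite ?zr_mul, ?zr_sub, ?zr_add in H. repeat rewrite ?zr_add.
      assert (H' : (zr (Z.of_nat n) - zr 4) * (zr (Z.of_nat n) + zr 3) * P (S (S n)) =
        zr 6 * smul (tl P) (tl P) n - match n with 2%nat => e | _ => 0 end).
      (* At the resonance the recurrence says nothing, so the convolution must vanish by itself:
         each of its products contains one of the zero coefficients 1, 2, 3, 5. *)
      { rewrite H. destruct (Nat.eqb n 4) eqn:En; [|reflexivity].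
        apply Nat.eqb_eq in En. subst. cbn. unfold tl. rewrite wp_coef_1, wp_coef_2, wp_coef_3, wp_coef_5. ring. }
      destruct n as [|[|[|n]]].
      + transitivity ((zr (Z.of_nat 0) - zr 4) * (zr (Z.of_nat 0) + zr 3) * P 2%nat
                      + zr 12 * P 2%nat); [ring|]. rewrite H'. ring.
      + transitivity ((zr (Z.of_nat 1) - zr 4) * (zr (Z.of_nat 1) + zr 3) * P 3%nat
                      + zr 12 * P 3%nat); [ring|]. rewrite H'. ring.
      + transitivity ((zr (Z.of_nat 2) - zr 4) * (zr (Z.of_nat 2) + zr 3) * P 4%nat
                      + zr 12 * P 4%nat); [ring|]. rewrite H'. unfold cst, sconst. ring.
      + set (N := @zr B (Z.of_nat (S (S (S n))))) in *.
        transitivity ((N - zr 4) * (N + zr 3) * P (S (S (S (S (S n)))))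
                      + zr 12 * P (S (S (S (S (S n)))))); [ring|].
        rewrite H'. unfold cst, sconst. ring. }
  transitivity (shifted _ euler 3 Q + zr 3 * Q); [unfold shifted; ring|].
  rewrite E. ring.
Qed.

Lemma wp_fifth_order : satisfies_fifth_order e P.
Proof.
  unfold satisfies_fifth_order.
  apply (fifth_order (series B) euler sX (cst e) P Q).
  - apply euler_derivation.
  - apply euler_X.
  - apply euler_const.
  - apply euler_P.
  - apply euler_Q.
Qed.

Lemma Q_coef n : Q n = (zr (Z.of_nat n) - zr 2) * P n.
Proof. apply coef_shifted. Qed.

(** [D I = 6 I] leaves only the coefficient of degree 6. There [Q^2] gives -16 [P_6] and [-4 P^3]
    gives -12 [P_6], together -g3, which explains the 28 in [wp_step]. *)
Lemma wp_first_integral :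
  wp_integral (series B) sX (cst e) P Q = - (cst g3 * sX * sX * sX * sX * sX * sX).
Proof.
  pose proof (D_wp_integral (series B) euler sX (cst e) P Q (euler_derivation B)
    euler_X (euler_const e) euler_P euler_Q) as H.
  set (I := wp_integral (series B) sX (cst e) P Q) in *.
  apply functional_extensionality. intros n.
  rewrite coef_opp, ?coef_mul_X6, ?coef_mul_X4, ?coef_mul_X2.
  assert (E : zr (Z.of_nat n - 6) * I n = 0).
  { apply (f_equal (fun f => f n)) in H. rewrite coef_zr in H. unfold euler in H.
    rewrite zr_sub. transitivity (zr (Z.of_nat n) * I n - zr 6 * I n); [ring|].
    rewrite H. ring. }
  destruct (Nat.eq_dec n 6) as [->|Hn].
  - transitivity (- g3); [|reflexivity].
    unfold I, wp_integral.
    replace (Q * Q - zr 4 * P * P * P + zr 2 * cst e * sX * sX * sX * sX * P)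
      with (Q * Q - zr 4 * (P * (P * P)) + zr 2 * (cst e * P * sX * sX * sX * sX)) by ring.
    rewrite coef_add, coef_sub, !coef_zr, ?coef_mul_X6, ?coef_mul_X4, ?coef_mul_X2, coef_const, !coef_mul.
    rewrite <- wp_coef_6. cbn [smul]. unfold tl. rewrite !coef_mul. cbn [smul]. unfold tl.
    rewrite !Q_coef, wp_coef_0, wp_coef_1, wp_coef_2, wp_coef_3, wp_coef_5. simpl. ring.
  - apply zr_eq_0 in E; [|lia]. rewrite E.
    destruct n as [|[|[|[|[|[|[|n]]]]]]]; try lia; unfold cst, sconst; ring.
Qed.

(** Termwise primitive of -wp, times z. Index 1 is the constant of integration, chosen 0 because
    zeta is odd. *)
Definition zeta_series : series B :=
  fun n => match n with O => 1 | S O => 0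
           | _ => scalar (/ RtoC (IZR (Z.of_nat n - 1))) * - P n end.

Notation Zt := zeta_series.

Lemma zeta_coef n : (zr (Z.of_nat n) - zr 1) * Zt n = - P n.
Proof.
  destruct n as [|[|n]].
  - simpl. rewrite wp_coef_0. ring.
  - simpl. rewrite wp_coef_1. ring.
  - rewrite <- zr_sub. apply zr_div. lia.
Qed.

Lemma euler_zeta : euler Zt = Zt - P.
Proof.
  apply functional_extensionality. intros n. rewrite coef_sub. unfold euler.
  transitivity ((zr (Z.of_nat n) - zr 1) * Zt n + Zt n); [ring|].
  rewrite zeta_coef. ring.
Qed.

Lemma zeta_zero n : P (S (S n)) = 0 -> Zt (S (S n)) = 0.
Proof. intros H. unfold zeta_series. rewrite H. ring. Qed.

Variable s : series B.
Hypothesis s_0 : s O = 1.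
Hypothesis euler_s : euler s = Zt * s - s.

(** The heat equation determines only the coefficients from degree 4 on; these are the initial
    values. *)
Lemma sigma_coef_low : s 1%nat = 0 /\ s 2%nat = 0 /\ s 3%nat = 0.
Proof.
  assert (H : forall n, (zr (Z.of_nat n)) * s n = (Zt * s) n - s n).
  { intros n. change (euler s n = (Zt * s - s) n). rewrite euler_s. reflexivity. }
  assert (Z2 : Zt 2%nat = 0) by apply zeta_zero, wp_coef_2.
  assert (Z3 : Zt 3%nat = 0) by apply zeta_zero, wp_coef_3.
  assert (E1 : s 1%nat = 0).
  { apply (zr_eq_0 B 1); [lia|]. etransitivity; [exact (H 1%nat)|]. rewrite coef_mul.
    cbn [smul]. unfold tl. change (Zt 0%nat) with (@aone B).
    change (Zt 1%nat) with (@azero B). ring. }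
  assert (E2 : s 2%nat = 0).
  { apply (zr_eq_0 B 2); [lia|]. etransitivity; [exact (H 2%nat)|]. rewrite coef_mul.
    cbn [smul]. unfold tl. rewrite Z2, E1. change (Zt 0%nat) with (@aone B). ring. }
  assert (E3 : s 3%nat = 0).
  { apply (zr_eq_0 B 3); [lia|]. etransitivity; [exact (H 3%nat)|]. rewrite coef_mul.
    cbn [smul]. unfold tl. rewrite Z2, Z3, E1, E2.
    change (Zt 0%nat) with (@aone B). ring. }
  auto.
Qed.

Variable L : B -> B.
Hypothesis HL : derivation L.
Hypotheses (Le : L e = zr 6 * g3) (Lg3 : zr 3 * L g3 = zr 8 * e * e).

Lemma Le_series : lift L (cst e) = zr 6 * cst g3.
Proof.
  rewrite lift_const, Le by auto. apply functional_extensionality. intros n.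
  rewrite coef_zr. destruct n; simpl; ring.
Qed.

(** On the lowest coefficient n of [3 z^4 W], Lame's equation reads
    [(n-5)(n-4) - 12 = (n-1)(n-8) = 0]. The two exceptional degrees, [z^-3] and [z^4] in W, are
    computed directly. *)
Lemma wp_defect_0 : wp_defect (series B) sX (cst e) P Q (lift L) Zt = 0.
Proof.
  pose proof (lame (series B) euler sX (cst e) (cst g3) P Q (euler_derivation B)
    euler_X (euler_const e) euler_P euler_Q (lift L) Zt
    (lift_derivation B L HL) (fun x => euler_lift B L x HL) (lift_X L HL) Le_series
    euler_zeta wp_first_integral) as H.
  set (W := wp_defect (series B) sX (cst e) P Q (lift L) Zt) in *.
  assert (HW : forall n, W n = zr 3 * (lift L P * sX * sX) n - zr 12 * smul P P n
     - zr 6 * smul Zt Q n + zr 4 * (cst e * sX * sX * sX * sX) n).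
  { assert (E : W = zr 3 * (lift L P * sX * sX) - zr 12 * (P * P) -
      zr 6 * (Zt * Q) + zr 4 * (cst e * sX * sX * sX * sX)).
    { unfold W, wp_defect. ring. }
    intros n. rewrite E, coef_add, !coef_sub, !coef_zr. reflexivity. }
  apply lowest_zero. intros n IH.
  destruct (Nat.eq_dec n 1) as [->|N1]; [|destruct (Nat.eq_dec n 8) as [->|N8]].
  - rewrite HW, ?coef_mul_X6, ?coef_mul_X4, ?coef_mul_X2. cbn [smul]. unfold tl. rewrite !Q_coef, wp_coef_0, wp_coef_1.
    change (Zt 0%nat) with (@aone B). change (Zt 1%nat) with (@azero B). ring.
  (* The factor 84 = 3 * 28 makes the derivative of [P_6] available:
     [84 L P_6 = 3 L g3 = 8 e^2 = 800 P_4^2]. *)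
  - apply (zr_eq_0 B 84); [lia|].
    assert (ELq : zr 84 * L (P 6%nat) = zr 800 * P 4%nat * P 4%nat).
    { transitivity (zr 3 * L (zr 28 * P 6%nat)).
      - rewrite (d_mul L HL), d_zr by auto. ring.
      - rewrite wp_coef_6, Lg3, <- wp_coef_4. ring. }
    pose proof (zeta_coef 4) as Z4. pose proof (zeta_coef 8) as Z8.
    rewrite HW, ?coef_mul_X6, ?coef_mul_X4, ?coef_mul_X2. cbn [smul]. unfold tl.
    change (Zt 0%nat) with (@aone B). change (Zt 1%nat) with (@azero B).
    rewrite (zeta_zero 0 wp_coef_2), (zeta_zero 1 wp_coef_3), (zeta_zero 3 wp_coef_5), (zeta_zero 5 wp_coef_7).
    rewrite !Q_coef, wp_coef_0, wp_coef_1, wp_coef_2, wp_coef_3, wp_coef_5, wp_coef_7.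
    unfold lift, cst, sconst. simpl Z.of_nat in *. cbn [Z.of_nat] in *.
    (* Corrects by multiples of the relations for [L P_6], [Z_4], [Z_8] and [P_8]; what is left
       vanishes identically. *)
    match goal with |- ?l = _ => transitivity (l
      - zr 3 * (zr 84 * L (P 6%nat) - zr 800 * P 4%nat * P 4%nat)
      + zr 336 * P 4%nat * ((zr 4 - zr 1) * Zt 4%nat - (- P 4%nat))
      - zr 144 * ((zr 8 - zr 1) * Zt 8%nat - (- P 8%nat))
      + zr 1728 * (zr 3 * P 8%nat - P 4%nat * P 4%nat)) end.
    + rewrite ELq, wp_coef_8. change (Z.of_nat 4) with 4%Z in Z4. change (Z.of_nat 8) with 8%Z in Z8.
      rewrite Z4, Z8. ring.
    + change (Z.of_nat 8) with 8%Z. change (Z.of_nat 4) with 4%Z. ring.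
  - apply (f_equal (fun f => f n)) in H.
    rewrite !coef_shifted in H.
    replace (zr 12 * P * W) with (zr 12 * (P * W)) in H by ring.
    rewrite coef_zr, coef_mul, smul_low, wp_coef_0 in H by auto.
    apply (zr_eq_0 B ((Z.of_nat n - 1) * (Z.of_nat n - 8))); [nia|].
    repeat rewrite ?zr_mul, ?zr_sub. set (N := @zr B (Z.of_nat n)) in *.
    transitivity ((N - zr 5) * ((N - zr 4) * W n) - zr 12 * (1 * W n)); [ring|].
    rewrite H. ring.
Qed.

(** With [wp_defect] gone, [D Y = 3 Y] leaves one constant of integration, in degree 3. It vanishes
    since every contribution contains a zero coefficient of low index. *)
Lemma zeta_defect_0 : zeta_defect (series B) sX (cst e) P Q (lift L) Zt = 0.
Proof.
  pose proof (D_zeta_defect (series B) euler sX (cst e) P Q (euler_derivation B)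
    euler_X (euler_const e) euler_P euler_Q (lift L) Zt
    (lift_derivation B L HL) (fun x => euler_lift B L x HL)
    euler_zeta) as H.
  rewrite wp_defect_0 in H.
  set (Y := zeta_defect (series B) sX (cst e) P Q (lift L) Zt) in *.
  apply functional_extensionality. intros n.
  destruct (Nat.eq_dec n 3) as [->|N3].
  - unfold Y, zeta_defect.
    replace (zr 3 * sX * sX * lift L Zt + zr 6 * Zt * P + zr 3 * Q -
      cst e * sX * sX * sX * sX) with
      (zr 3 * (lift L Zt * sX * sX) + zr 6 * (Zt * P) + zr 3 * Q -
      cst e * sX * sX * sX * sX) by ring.
    rewrite coef_sub, !coef_add, !coef_zr, ?coef_mul_X6, ?coef_mul_X4, ?coef_mul_X2, coef_mul.
    cbn [smul]. unfold tl, lift. rewrite (zeta_zero 0 wp_coef_2), (zeta_zero 1 wp_coef_3).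
    change (Zt 1%nat) with (@azero B). rewrite (d_0 B L HL).
    rewrite Q_coef, wp_coef_1, wp_coef_2, wp_coef_3.
    change ((0 : series B) 3%nat) with (@azero B). ring.
  - apply (f_equal (fun f => f n)) in H. rewrite coef_sub, coef_zr in H.
    unfold euler in H. apply (zr_eq_0 B (Z.of_nat n - 3)); [lia|].
    rewrite zr_sub. transitivity (zr (Z.of_nat n) * Y n - zr 3 * Y n); [ring|].
    rewrite H. change ((0:series B) n) with (@azero B). ring.
Qed.

(** With [zeta_defect] gone, [D Y = Y + Z Y] and [Z_0 = 1] allow a lowest coefficient only in degree
    2, where [s_2 = 0] and [L 1 = 0] exclude it. *)
Lemma heat_defect_0 : heat_defect (series B) euler sX (cst e) (lift L) s = 0.
Proof.
  pose proof (D_heat_defect (series B) euler sX (cst e) P Q (euler_derivation B)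
    euler_X (euler_const e) euler_P (lift L) Zt s
    (lift_derivation B L HL) (fun x => euler_lift B L x HL)
    euler_zeta euler_s) as H.
  rewrite zeta_defect_0 in H.
  set (Y := heat_defect (series B) euler sX (cst e) (lift L) s) in *.
  apply lowest_zero. intros n IH.
  destruct (Nat.eq_dec n 2) as [->|N2].
  - unfold Y, heat_defect.
    replace (zr 12 * (euler (euler s) + euler s) - zr 12 * sX * sX * lift L s +
      zr 2 * cst e * sX * sX * sX * sX * s) with
      (zr 12 * (euler (euler s) + euler s) - zr 12 * (lift L s * sX * sX) +
      zr 2 * (cst e * s * sX * sX * sX * sX)) by ring.
    rewrite coef_add, coef_sub, !coef_zr, ?coef_mul_X6, ?coef_mul_X4, ?coef_mul_X2, !coef_add. unfold euler, lift.
    rewrite s_0. destruct sigma_coef_low as (_ & E2 & _). rewrite E2.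
    replace (L 1) with (@azero B); [ring|].
    replace (@aone B) with (@zr B 1) by ring. rewrite d_zr; auto.
  - apply (f_equal (fun f => f n)) in H.
    replace (Y + Zt * Y - zr 4 * 0 * s) with (Y + Zt * Y) in H by ring.
    rewrite coef_add, coef_mul, smul_low in H by auto.
    change (Zt 0%nat) with (@aone B) in H. unfold euler in H.
    apply (zr_eq_0 B (Z.of_nat n - 2)); [lia|].
    rewrite zr_sub. transitivity (zr (Z.of_nat n) * Y n - zr 2 * Y n); [ring|].
    rewrite H. ring.
Qed.

Lemma heat_recurrence n :
  zr (12 * ((Z.of_nat n + 4) * (Z.of_nat n + 5))) * s (S (S (S (S n)))) =
  zr 12 * L (s (S (S n))) - zr 2 * e * s n.
Proof.
  pose proof heat_defect_0 as H. unfold heat_defect in H.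
  apply (f_equal (fun f => f (S (S (S (S n)))))) in H.
  replace (zr 12 * (euler (euler s) + euler s) - zr 12 * sX * sX * lift L s +
      zr 2 * cst e * sX * sX * sX * sX * s) with
      (zr 12 * (euler (euler s) + euler s) - zr 12 * (lift L s * sX * sX) +
      zr 2 * (cst e * s * sX * sX * sX * sX)) in H by ring.
  rewrite coef_add, coef_sub, !coef_zr, ?coef_mul_X6, ?coef_mul_X4, ?coef_mul_X2, !coef_add, coef_const in H.
  unfold euler, lift in H.
  replace (Z.of_nat (S (S (S (S n))))) with (Z.of_nat n + 4)%Z in H by lia.
  repeat rewrite ?zr_mul, ?zr_add in *. set (N := @zr B (Z.of_nat n)) in *.
  match type of H with ?l = _ => transitivity (l + (zr 12 * L (s (S (S n))) - zr 2 * e * s n)) end.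
  - ring.
  - rewrite H. change ((0:series B) (S (S (S (S n))))) with (@azero B). ring.
Qed.

End Formal.

(* [z s] is the exponential of a primitive of [Z / z]. *)
Lemma ex_sigma_series (Z : series B) : Z O = 1 ->
  exists s : series B, s O = 1 /\ euler s = Z * s - s.
Proof.
  intros Z0.
  destruct (course_of_values 0 (fun (f : nat -> B) k => match k with O => 1
    | S n => scalar (/ RtoC (IZR (Z.of_nat k))) * smul (tl Z) f n end)) as [s Hs].
  { intros f g [|n] H; [reflexivity|].
    rewrite (smul_ext B (tl Z) (tl Z) f g); auto. intros j Hj; apply H; lia. }
  exists s. split; [apply Hs|].
  apply functional_extensionality. intros n. unfold euler. rewrite coef_sub, coef_mul.
  destruct n as [|n].
  - simpl. rewrite Z0. ring.
  - rewrite Hs at 1. rewrite zr_div by lia. simpl. rewrite Z0. ring.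
Qed.

Lemma sigma_series_unique (Z s s' : series B) : Z O = 1 -> s O = s' O ->
  euler s = Z * s - s -> euler s' = Z * s' - s' -> s = s'.
Proof.
  intros Z0 E0 H H'.
  assert (E : s - s' = 0).
  { apply lowest_zero. intros n IH. destruct n as [|n].
    - rewrite coef_sub, E0. ring.
    - assert (K : euler (s - s') = Z * (s - s') - (s - s')).
      { rewrite (d_sub _ euler s s' (euler_derivation B)), H, H'. ring. }
      apply (f_equal (fun f => f (S n))) in K.
      rewrite (coef_sub (Z * _)), coef_mul, smul_low, Z0 in K by auto.
      unfold euler in K. apply (zr_eq_0 B (Z.of_nat (S n))); [lia|]. rewrite K. ring. }
  transitivity (s - s' + s'); [ring|]. rewrite E. ring.
Qed.

End Coefficients.

(** * The coefficients *)

(** Two separate arguments, because the first two terms have weight one less than (m, n) and the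
    last has weight two less. *)
Definition coef_rhs (f1 f2 : Z -> Z -> C) (m n : Z) : C :=
  (RtoC (IZR (12 * (m + 1))) * f1 (m + 1)%Z (n - 1)%Z
   + 2 / 3 * RtoC (IZR (n + 1)) * f1 (m - 2)%Z (n + 1)%Z
   - 1 / 12 * f2 (m - 1)%Z n)
  / RtoC (IZR ((4 * m + 6 * n + 1) * (4 * m + 6 * n))).

(* The recurrence lowers the weight [2 m + 3 n]; the recursion is on this weight. *)
Lemma ex_sigma_coefficients : exists a, is_sigma_coefficients a.
Proof.
  destruct (course_of_values (fun _ _ : Z => RtoC 0)
    (fun f k m n =>
       if (Z.ltb m 0 || Z.ltb n 0)%bool then RtoC 0
       else match k with
            | O => if (Z.eqb m 0 && Z.eqb n 0)%bool then RtoC 1 else RtoC 0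
            (* At [j = 0] the truncated difference gives a meaningless value, but at weight 1, which
               no pair of natural numbers has. *)
            | S j => coef_rhs (f j) (f (j - 1)%nat) m n
            end)) as [f Hf].
  { intros f g [|k] H; [reflexivity|].
    rewrite (H k), (H (k - 1)%nat) by lia. reflexivity. }
  exists (fun m n => f (Z.to_nat (2 * m + 3 * n)) m n).
  split; [|split].
  - intros m n H. rewrite Hf.
    replace ((m <? 0) || (n <? 0))%Z%bool with true; [reflexivity|].
    symmetry. apply Bool.orb_true_iff. rewrite !Z.ltb_lt. auto.
  - rewrite Hf. reflexivity.
  - intros m n Hm Hn Hmn.
    assert (Hk : exists j, Z.to_nat (2 * m + 3 * n) = S j /\
      Z.to_nat (2 * (m + 1) + 3 * (n - 1)) = j /\
      Z.to_nat (2 * (m - 2) + 3 * (n + 1)) = j /\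
      Z.to_nat (2 * (m - 1) + 3 * n) = (j - 1)%nat).
    { assert ((0 < m \/ 0 < n)%Z).
      { destruct (Z.eq_dec m 0), (Z.eq_dec n 0); try lia. subst. congruence. }
      exists (Z.to_nat (2 * m + 3 * n - 1)). lia. }
    destruct Hk as (j & -> & -> & -> & ->).
    rewrite Hf. replace ((m <? 0) || (n <? 0))%Z%bool with false; [reflexivity|].
    symmetry. apply Bool.orb_false_iff. rewrite !Z.ltb_ge. auto.
Qed.

Lemma sigma_coefficients_unique a b :
  is_sigma_coefficients a -> is_sigma_coefficients b -> forall m n, b m n = a m n.
Proof.
  intros (A1 & A2 & A3) (B1 & B2 & B3) m n.
  remember (Z.to_nat (2 * m + 3 * n)) as k eqn:Hk. revert m n Hk.
  induction k as [k IH] using lt_wf_ind. intros m n Hk.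
  destruct (Z_lt_le_dec m 0) as [Hm|Hm]; [rewrite A1, B1; auto|].
  destruct (Z_lt_le_dec n 0) as [Hn|Hn]; [rewrite A1, B1; auto|].
  destruct (classic ((m, n) = (0, 0)%Z)) as [E|E].
  - injection E as -> ->. congruence.
  - assert ((0 < m \/ 0 < n)%Z).
    { destruct (Z.eq_dec m 0), (Z.eq_dec n 0); try lia. subst. congruence. }
    rewrite A3, B3 by auto.
    rewrite (IH (Z.to_nat (2 * (m + 1) + 3 * (n - 1)))) by lia.
    rewrite (IH (Z.to_nat (2 * (m - 2) + 3 * (n + 1)))) by lia.
    rewrite (IH (Z.to_nat (2 * (m - 1) + 3 * n))) by lia. reflexivity.
Qed.

Lemma Cmod_IZR n : (0 <= n)%Z -> Cmod (RtoC (IZR n)) = IZR n.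
Proof. intros H. rewrite Cmod_R. apply Rabs_pos_eq, IZR_le, H. Qed.

(** The denominator grows like [4 k^2]. The numerator factors [12(m+1)] and [2/3 (n+1)] are at most
    [6(k-1)] and [2/9 (k-1)] whenever the neighbouring coefficient is nonzero, since then n > 0,
    respectively m > 1. *)
Lemma sigma_coefficient_bound a : is_sigma_coefficients a ->
  forall k m n, (0 <= m)%Z -> (0 <= n)%Z -> (2 * m + 3 * n = Z.of_nat k)%Z ->
  (Cmod (a m n) <= 2 ^ k / INR (fact k))%R.
Proof.
  intros (A1 & A2 & A3) k.
  induction k as [k IH] using lt_wf_ind. intros m n Hm Hn Hk.
  destruct (classic ((m, n) = (0, 0)%Z)) as [E|E].
  { injection E as -> ->. assert (k = O) by lia. subst.
    rewrite A2, Cmod_1. simpl. lra. }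
  assert (Hmn : (0 < m \/ 0 < n)%Z).
  { destruct (Z.eq_dec m 0), (Z.eq_dec n 0); try lia. subst. congruence. }
  destruct k as [|[|k]]; [lia|lia|].
  rewrite A3 by auto.
  set (K := IZR (Z.of_nat (S (S k)))).
  assert (HK : (2 <= K)%R) by (apply IZR_le; lia).
  set (b := (2 ^ S (S k) / INR (fact (S (S k))))%R).
  assert (Hb : (0 < b)%R).
  { apply Rdiv_lt_0_compat; [apply pow_lt; lra|apply INR_fact_lt_0]. }
  assert (EK : INR (S (S k)) = K) by apply INR_IZR_INZ.
  assert (EK' : INR (S k) = (K - 1)%R).
  { rewrite (S_INR (S k)) in EK. lra. }
  assert (B1 : (2 ^ S k / INR (fact (S k)) = b * K / 2)%R).
  { unfold b. change (fact (S (S k))) with (S (S k) * fact (S k))%nat.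
    rewrite mult_INR, EK. change (2 ^ S (S k))%R with (2 * 2 ^ S k)%R.
    field. split; [|lra]. apply Rgt_not_eq, INR_fact_lt_0. }
  assert (B2 : (2 ^ k / INR (fact k) = b * K * (K - 1) / 4)%R).
  { replace (b * K * (K - 1) / 4)%R with ((b * K / 2) * ((K - 1) / 2))%R by field.
    rewrite <- B1. change (fact (S k)) with (S k * fact k)%nat.
    rewrite mult_INR, EK'. change (2 ^ S k)%R with (2 * 2 ^ k)%R.
    field. split; [|lra]. apply Rgt_not_eq, INR_fact_lt_0. }
  assert (Hden : IZR ((4 * m + 6 * n + 1) * (4 * m + 6 * n)) = ((2 * K + 1) * (2 * K))%R).
  { replace (4 * m + 6 * n)%Z with (2 * Z.of_nat (S (S k)))%Z by lia.
    rewrite mult_IZR, plus_IZR, mult_IZR. fold K. ring. }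
  assert (D0 : (0 < (2 * K + 1) * (2 * K))%R) by nra.
  rewrite Hden, Cmod_div.
  2:{ intros E0. apply RtoC_inj in E0. lra. }
  rewrite Cmod_R, Rabs_pos_eq by lra.
  apply Rle_div_l; [exact D0|].
  assert (T1 : (Cmod (RtoC (IZR (12 * (m + 1))) * a (m + 1)%Z (n - 1)%Z)
                <= 6 * (K - 1) * (b * K / 2))%R).
  { rewrite Cmod_mult, Cmod_IZR by lia.
    destruct (Z.eq_dec n 0) as [->|N].
    - rewrite A1, Cmod_0 by lia.
      assert (0 <= (K - 1) * (b * K / 2))%R; [|lra].
      apply Rmult_le_pos; [lra|]. apply Rmult_le_pos; [|lra]. apply Rmult_le_pos; lra.
    - apply Rmult_le_compat; [apply IZR_le; lia|apply Cmod_ge_0| |].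
      + replace (6 * (K - 1))%R with (IZR (6 * (Z.of_nat (S (S k)) - 1)))
          by (rewrite mult_IZR, minus_IZR; reflexivity).
        apply IZR_le. lia.
      + rewrite <- B1. apply IH; lia. }
  assert (T2 : (Cmod (2 / 3 * RtoC (IZR (n + 1)) * a (m - 2)%Z (n + 1)%Z)
                <= 2 / 9 * (K - 1) * (b * K / 2))%R).
  { rewrite !Cmod_mult, Cmod_IZR by lia.
    replace (Cmod (2 / 3)) with (2 / 3)%R
      by (rewrite <- RtoC_div, Cmod_R, Rabs_pos_eq by lra; reflexivity).
    destruct (Z_lt_le_dec (m - 2) 0) as [N|N].
    - rewrite A1, Cmod_0 by lia.
      assert (0 <= (K - 1) * (b * K / 2))%R; [|lra].
      apply Rmult_le_pos; [lra|]. apply Rmult_le_pos; [|lra]. apply Rmult_le_pos; lra.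
    - apply Rmult_le_compat; [|apply Cmod_ge_0| |].
      + apply Rmult_le_pos; [lra|]. apply IZR_le; lia.
      + assert (3 * IZR (n + 1) <= K - 1)%R; [|lra].
        replace (K - 1)%R with (IZR (Z.of_nat (S (S k)) - 1))
          by (rewrite minus_IZR; reflexivity).
        rewrite <- mult_IZR. apply IZR_le. lia.
      + rewrite <- B1. apply IH; lia. }
  assert (T3 : (Cmod (1 / 12 * a (m - 1)%Z n) <= 1 / 12 * (b * K * (K - 1) / 4))%R).
  { rewrite !Cmod_mult.
    replace (Cmod (1 / 12)) with (1 / 12)%R
      by (rewrite <- RtoC_div, Cmod_R, Rabs_pos_eq by lra; reflexivity).
    apply Rmult_le_compat_l; [lra|].
    destruct (Z.eq_dec m 0) as [->|N].
    - rewrite A1, Cmod_0 by lia.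
      assert (0 <= b * K * (K - 1))%R; [|lra].
      apply Rmult_le_pos; [|lra]. apply Rmult_le_pos; lra.
    - rewrite <- B2. apply IH; lia. }
  unfold Cminus. eapply Rle_trans; [apply Cmod_triangle|]. rewrite Cmod_opp.
  eapply Rle_trans; [apply Rplus_le_compat_r, Cmod_triangle|].
  assert (HbK : (0 <= b * K)%R) by (apply Rmult_le_pos; lra).
  (* In units of [b K (K-1)] the three terms are at most 3, 1/9 and 1/48, together less than 4,
     against [4K + 2] from the denominator. *)
  assert (Hq : (0 <= b * K * (4 * K + 2 - (28 / 9 + 1 / 48) * (K - 1)))%R).
  { apply Rmult_le_pos; lra. }
  nra.
Qed.

Lemma pow_fact_bounded (x : R) : exists M, forall n, (Rabs (x ^ n / INR (fact n)) <= M)%R.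
Proof.
  destruct (maj_by_pos (fun n => x ^ n / INR (fact n))%R) as (M & _ & HM).
  - exists 0%R. apply cv_speed_pow_fact.
  - exists M. exact HM.
Qed.

(** The weight 2m + 3n is at least m + n, and [(2r)^k / k!] is bounded. *)
Lemma sigma_coefficient_decay a (r : R) : is_sigma_coefficients a -> (1 <= r)%R ->
  exists M, forall m n : nat,
    (Cmod (a (Z.of_nat m) (Z.of_nat n)) * r ^ (m + n) <= M)%R.
Proof.
  intros Ha Hr. destruct (pow_fact_bounded (2 * r)) as [M HM]. exists M. intros m n.
  set (k := (2 * m + 3 * n)%nat).
  apply Rle_trans with (2 ^ k / INR (fact k) * r ^ k)%R.
  - apply Rmult_le_compat; [apply Cmod_ge_0|apply pow_le; lra| |].
    + apply sigma_coefficient_bound; auto; unfold k; lia.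
    + apply Rle_pow; auto. unfold k; lia.
  - replace (2 ^ k / INR (fact k) * r ^ k)%R with ((2 * r) ^ k / INR (fact k))%R.
    + eapply Rle_trans; [apply Rle_abs|apply HM].
    + rewrite Rpow_mult_distr. field. apply Rgt_not_eq, INR_fact_lt_0.
Qed.

(** * Finitely supported sums in an algebra *)

Section FiniteSums.
Variable B : calg.
Add Ring B_ring2 : (calg_ring B) (morphism (zr_morph B), constants [zr_cst]).
Local Open Scope calg_scope.

Definition asum {T : Type} (f : T -> B) (l : list T) : B := fold_right aadd 0 (map f l).

(** Sums without topology over a possibly infinite index set: over all integer pairs, shifts of the
    indices are bijections, and no boundary terms have to be tracked. *)
Definition is_fsum {T : Type} (f : T -> B) (S : B) : Prop :=
  exists l, NoDup l /\ (forall x, ~ In x l -> f x = 0) /\ S = asum f l.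

Lemma asum_perm {T : Type} (f : T -> B) l1 l2 : Permutation l1 l2 -> asum f l1 = asum f l2.
Proof. unfold asum. induction 1; simpl; try congruence; ring. Qed.

Lemma asum_app {T : Type} (f : T -> B) l1 l2 : asum f (l1 ++ l2) = asum f l1 + asum f l2.
Proof. unfold asum. induction l1 as [|x l1 IH]; simpl; [ring|]. rewrite IH. ring. Qed.

Lemma asum_zero {T : Type} (f : T -> B) l : (forall x, In x l -> f x = 0) -> asum f l = 0.
Proof.
  unfold asum. induction l as [|x l IH]; simpl; intros H; [reflexivity|].
  rewrite IH, (H x); auto. ring.
Qed.

Lemma asum_ext {T : Type} (f g : T -> B) l :
  (forall x, In x l -> f x = g x) -> asum f l = asum g l.
Proof.
  unfold asum. induction l as [|x l IH]; simpl; intros H; [reflexivity|].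
  rewrite IH, (H x); auto.
Qed.

Lemma is_fsum_incl {T : Type} (f : T -> B) l l' : NoDup l -> NoDup l' -> incl l l' ->
  (forall x, ~ In x l -> f x = 0) -> asum f l' = asum f l.
Proof.
  intros H1 H2 H3 H4. destruct (incl_split l l' H1 H2 H3) as (l1 & N & P).
  rewrite (asum_perm _ _ _ P), asum_app, (asum_zero f l1); [ring|].
  intros x Hx. apply H4. intros Hx'. apply NoDup_app_remove_l in N as N'.
  clear - N Hx Hx'. induction l as [|y l IH]; [contradiction|].
  simpl in N. inversion N; subst. destruct Hx' as [->|Hx']; auto.
  apply H1. apply in_or_app; auto.
Qed.

Lemma is_fsum_on {T : Type} (f : T -> B) S l0 : is_fsum f S ->
  exists l, NoDup l /\ incl l0 l /\ (forall x, ~ In x l -> f x = 0) /\ S = asum f l.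
Proof.
  intros (l & H1 & H2 & ->).
  destruct (lists_union (fun _ => True) l0 l (Forall_True _) (Forall_True _))
    as (l' & N & _ & I1 & I2).
  exists l'. split; [|split; [|split]]; auto.
  symmetry. apply is_fsum_incl; auto.
Qed.

Lemma is_fsum_unique {T : Type} (f : T -> B) S S' : is_fsum f S -> is_fsum f S' -> S = S'.
Proof.
  intros (l & H1 & H2 & ->) H'. destruct (is_fsum_on f S' l H') as (l' & H3 & H4 & H5 & ->).
  symmetry. apply is_fsum_incl; auto.
Qed.

Lemma is_fsum_ext {T : Type} (f g : T -> B) S :
  (forall x, f x = g x) -> is_fsum f S -> is_fsum g S.
Proof.
  intros H (l & H1 & H2 & ->). exists l. split; [|split]; auto.
  - intros x Hx. rewrite <- H; auto.
  - apply asum_ext; auto.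
Qed.

Lemma is_fsum_add {T : Type} (f g : T -> B) S S' :
  is_fsum f S -> is_fsum g S' -> is_fsum (fun x => f x + g x) (S + S').
Proof.
  intros (l & H1 & H2 & ->) H'. destruct (is_fsum_on g S' l H') as (l' & H3 & H4 & H5 & ->).
  exists l'. split; [|split]; auto.
  - intros x Hx. rewrite H2, H5; auto. ring.
  - rewrite <- (is_fsum_incl f l l'); auto. clear. unfold asum.
    induction l' as [|x l IH]; simpl; [ring|]. rewrite <- IH. ring.
Qed.

Lemma is_fsum_bij {T U : Type} (h : T -> U) (k : U -> T) (f : U -> B) S :
  (forall x, k (h x) = x) -> (forall y, h (k y) = y) ->
  is_fsum f S -> is_fsum (fun x => f (h x)) S.
Proof.
  intros Hh Hk (l & H1 & H2 & ->). exists (map k l). split; [|split].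
  - apply (NoDup_map_inj (fun _ => True)); auto; [|apply Forall_True].
    intros x y _ _ E. rewrite <- (Hk x), <- (Hk y). congruence.
  - intros x Hx. apply H2. intros Hx'. apply Hx. rewrite <- (Hh x). apply in_map; auto.
  - unfold asum. rewrite map_map. f_equal. apply map_ext. intros y. rewrite Hk; auto.
Qed.

Lemma is_fsum_0 {T : Type} (f : T -> B) : (forall x, f x = 0) -> is_fsum f 0.
Proof.
  intros H. exists nil. split; [constructor|split; auto].
Qed.

End FiniteSums.

Arguments asum {B T}. Arguments is_fsum {B T}.

Lemma is_fsum_map {B B' : calg} {T : Type} (phi : B -> B') (f : T -> B) S :
  phi azero = azero -> (forall x y, phi (x + y)%A = (phi x + phi y)%A) ->
  is_fsum f S -> is_fsum (fun x => phi (f x)) (phi S).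
Proof.
  intros P0 PA (l & H1 & H2 & ->). exists l. split; [|split]; auto.
  - intros x Hx. rewrite H2; auto.
  - clear H1 H2. unfold asum. induction l as [|x l IH]; simpl; [auto|].
    rewrite PA, IH. reflexivity.
Qed.

(** * The coefficients [a] and the heat recurrence *)

Section SigmaTerms.
Variable B : calg.
Add Ring B_ring3 : (calg_ring B) (morphism (zr_morph B), constants [zr_cst]).
Local Open Scope calg_scope.

Fixpoint apow (x : B) (n : nat) : B := match n with O => 1 | S m => x * apow x m end.

Variable a : Z -> Z -> C.
Hypothesis Ha : is_sigma_coefficients a.
Variables (L : B -> B) (e g3 : B).
Hypothesis HL : derivation L.
Hypotheses (Le : L e = zr 6 * g3) (Lg3 : zr 3 * L g3 = zr 8 * e * e).

(** This is [g2^m g3^n], as g2 = 2 e. Negative exponents are read as 0; wherever they occur the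
    accompanying coefficient vanishes. *)
Definition monom (m n : Z) : B := apow (zr 2 * e) (Z.to_nat m) * apow g3 (Z.to_nat n).

Definition term (m n : Z) : B := scalar (a m n) * monom m n.

Lemma term_neg m n : (m < 0 \/ n < 0)%Z -> term m n = 0.
Proof. intros H. unfold term. rewrite (proj1 Ha) by auto. rewrite scalar_0. ring. Qed.

Lemma scalar_a_neg m n : (m < 0 \/ n < 0)%Z -> @scalar B (a m n) = 0.
Proof. intros H. rewrite (proj1 Ha) by auto. apply scalar_0. Qed.

Lemma d_apow x n : L (apow x n) = zr (Z.of_nat n) * apow x (n - 1) * L x.
Proof.
  induction n as [|n IH].
  - simpl. replace 1 with (@zr B 1) by ring. rewrite d_zr by auto. ring.
  - simpl apow. rewrite (d_mul L HL), IH, Nat2Z.inj_succ. unfold Z.succ.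
    rewrite zr_add. replace (n - 0)%nat with n by lia. destruct n as [|n].
    + simpl. ring.
    + replace (S n - 1)%nat with n by lia. simpl apow. ring.
Qed.

Lemma monom_S_l m n : (0 <= m)%Z -> monom (m + 1) n = zr 2 * e * monom m n.
Proof.
  intros H. unfold monom. replace (Z.to_nat (m + 1)) with (S (Z.to_nat m)) by lia.
  simpl. ring.
Qed.

Lemma monom_S_r m n : (0 <= n)%Z -> monom m (n + 1) = g3 * monom m n.
Proof.
  intros H. unfold monom. replace (Z.to_nat (n + 1)) with (S (Z.to_nat n)) by lia.
  simpl. ring.
Qed.

(** [L g2 = 12 g3] and [L g3 = 2/3 g2^2], multiplied by 12 so that the constants are integers. *)
Lemma d_term m n : zr 12 * L (term m n) =
  scalar (a m n) * (zr (144 * m) * monom (m - 1) (n + 1) +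
                    zr (8 * n) * monom (m + 2) (n - 1)).
Proof.
  destruct (Z_lt_le_dec m 0) as [Hm|Hm].
  { rewrite term_neg, scalar_a_neg, d_0 by auto. ring. }
  destruct (Z_lt_le_dec n 0) as [Hn|Hn].
  { rewrite term_neg, scalar_a_neg, d_0 by auto. ring. }
  unfold term. rewrite (d_mul L HL), (d_scalar L HL).
  assert (E : zr 12 * L (monom m n) = zr (144 * m) * monom (m - 1) (n + 1) +
                    zr (8 * n) * monom (m + 2) (n - 1)).
  { rewrite monom_S_r by auto.
    replace (m + 2)%Z with (m + 1 + 1)%Z by ring. rewrite !monom_S_l by lia.
    unfold monom. rewrite (d_mul L HL), !d_apow, (d_mul L HL), d_zr, Le, !Z2Nat.id by auto.
    replace (Z.to_nat (m - 1)) with (Z.to_nat m - 1)%nat by lia.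
    replace (Z.to_nat (n - 1)) with (Z.to_nat n - 1)%nat by lia.
    rewrite !zr_mul.
    set (x := apow _ (Z.to_nat m)). set (x' := apow _ (Z.to_nat m - 1)).
    set (y := apow _ (Z.to_nat n)). set (y' := apow _ (Z.to_nat n - 1)).
    transitivity (zr 144 * zr m * x' * g3 * y +
       zr 4 * zr n * y' * x * (zr 3 * L g3)); [ring|]. rewrite Lg3. ring. }
  transitivity (scalar (a m n) * (zr 12 * L (monom m n))); [ring|]. rewrite E. reflexivity.
Qed.

(** The defining recurrence times a monomial, with denominators cleared and extended to all integer
    indices: at (0, 0) and outside the quadrant both sides vanish. *)
Lemma term_recurrence m n :
  zr (12 * ((4 * m + 6 * n) * (4 * m + 6 * n + 1))) * term m n =
  scalar (a (m + 1)%Z (n - 1)%Z) * zr (144 * (m + 1)) * monom m n +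
  scalar (a (m - 2)%Z (n + 1)%Z) * zr (8 * (n + 1)) * monom m n -
  zr 2 * e * term (m - 1) n.
Proof.
  destruct Ha as (A1 & A2 & A3).
  destruct (Z_lt_le_dec m 0) as [Hm|Hm].
  { rewrite !term_neg, (scalar_a_neg (m - 2)) by lia.
    (* On the line m = -1 the neighbour [a 0 (n-1)] may be nonzero, but its factor m + 1 is 0. *)
    destruct (Z.eq_dec m (-1)) as [->|N].
    - change (144 * (-1 + 1))%Z with 0%Z. ring.
    - rewrite scalar_a_neg by lia. ring. }
  destruct (Z_lt_le_dec n 0) as [Hn|Hn].
  { rewrite !term_neg, (scalar_a_neg (m + 1)) by lia.
    destruct (Z.eq_dec n (-1)) as [->|N].
    - change (8 * (-1 + 1))%Z with 0%Z. ring.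
    - rewrite scalar_a_neg by lia. ring. }
  assert (Hterm : zr 2 * e * term (m - 1) n = scalar (a (m - 1)%Z n) * monom m n).
  { destruct (Z.eq_dec m 0) as [->|N].
    - rewrite term_neg, scalar_a_neg by lia. ring.
    - unfold term. replace (monom m n) with (monom (m - 1 + 1) n) by (f_equal; ring).
      rewrite monom_S_l by lia. ring. }
  rewrite Hterm. unfold term.
  transitivity (scalar (RtoC (IZR (12 * ((4 * m + 6 * n) * (4 * m + 6 * n + 1)))) * a m n)%C
    * monom m n).
  { rewrite scalar_mul. unfold zr. ring. }
  transitivity (scalar (a (m + 1)%Z (n - 1)%Z * RtoC (IZR (144 * (m + 1))) +
     a (m - 2)%Z (n + 1)%Z * RtoC (IZR (8 * (n + 1))) + - RtoC 1 * a (m - 1)%Z n)%C * monom m n).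
  2:{ rewrite !scalar_add, !scalar_mul, scalar_opp, scalar_1. unfold zr. ring. }
  f_equal. f_equal.
  destruct (classic ((m, n) = (0, 0)%Z)) as [E|E].
  - injection E as -> ->. rewrite (A1 (0 + 1)%Z), (A1 (0 - 2)%Z), (A1 (0 - 1)%Z) by lia. simpl. ring.
  - rewrite (A3 m n) by auto.
    assert (Hmn : (0 < m \/ 0 < n)%Z).
    { destruct (Z.eq_dec m 0), (Z.eq_dec n 0); try lia. subst. congruence. }
    set (w := (4 * m + 6 * n)%Z).
    assert (Hw : RtoC (IZR w) <> RtoC 0).
    { intros E0. apply RtoC_inj, eq_IZR in E0. lia. }
    assert (Hw1 : RtoC (IZR (w + 1)) <> RtoC 0).
    { intros E0. apply RtoC_inj, eq_IZR in E0. lia. }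
    replace (144 * (m + 1))%Z with (12 * (12 * (m + 1)))%Z by ring.
    rewrite !(mult_IZR 12), !(mult_IZR 8), !(mult_IZR w), !(mult_IZR (w + 1)), !RtoC_mult.
    assert (H12 : RtoC 12 <> RtoC 0) by (intros E0; apply RtoC_inj in E0; lra).
    assert (H3 : RtoC 3 <> RtoC 0) by (intros E0; apply RtoC_inj in E0; lra).
    replace (RtoC 8) with (RtoC 12 * (RtoC 2 / RtoC 3))%C.
    2:{ rewrite <- RtoC_div, <- RtoC_mult by lra. f_equal. field. }
    field. auto.
Qed.

(** In sigma / z the monomial [g2^m g3^n] comes with [z^(4m+6n)]; this keeps the terms of one
    degree. *)
Definition graded (k : Z) (f : Z -> Z -> B) (x : Z * Z) : B :=
  if Z.eqb (4 * fst x + 6 * snd x) k then f (fst x) (snd x) else 0.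

Lemma ex_graded_sum (k : nat) (f : Z -> Z -> B) :
  (forall m n, (m < 0 \/ n < 0)%Z -> f m n = 0) ->
  exists S, is_fsum (graded (Z.of_nat k) f) S.
Proof.
  intros Hf. set (zs := map Z.of_nat (seq 0 (S k))).
  assert (Nz : NoDup zs).
  { apply (NoDup_map_inj (fun _ => True)); auto.
    - intros x y _ _ E. lia.
    - apply Forall_True.
    - apply seq_NoDup. }
  exists (asum (graded (Z.of_nat k) f) (list_prod zs zs)), (list_prod zs zs).
  split; [apply NoDup_list_prod; auto|split; auto].
  intros [m n] H. unfold graded; cbn [fst snd].
  destruct (Z.eqb_spec (4 * m + 6 * n) (Z.of_nat k)) as [E|E]; [|reflexivity].
  destruct (Z_lt_le_dec m 0) as [Hm|Hm]; [apply Hf; auto|].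
  destruct (Z_lt_le_dec n 0) as [Hn|Hn]; [apply Hf; auto|].
  exfalso. apply H. apply in_prod_iff. split.
  - apply in_map_iff. exists (Z.to_nat m). split; [lia|]. apply in_seq. lia.
  - apply in_map_iff. exists (Z.to_nat n). split; [lia|]. apply in_seq. lia.
Qed.

(** The graded sum of degree k + 4 exists and satisfies the recurrence given for [s]; its leading
    factor [12 (k+4)(k+5)] is invertible. *)
Lemma graded_sum_unique (s : nat -> B) :
  s 0%nat = 1 -> s 1%nat = 0 -> s 2%nat = 0 -> s 3%nat = 0 ->
  (forall n, zr (12 * ((Z.of_nat n + 4) * (Z.of_nat n + 5))) * s (S (S (S (S n)))) =
     zr 12 * L (s (S (S n))) - zr 2 * e * s n) ->
  forall k, is_fsum (graded (Z.of_nat k) term) (s k).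
Proof.
  intros S0 S1 S2 S3 Hrec k. induction k as [k IH] using lt_wf_ind.
  assert (Hz : forall k : Z, (0 < k < 4)%Z -> is_fsum (graded k term) 0).
  { intros j Hj. apply is_fsum_0. intros [m n]. unfold graded; cbn [fst snd].
    destruct (Z.eqb_spec (4 * m + 6 * n) j) as [E|E]; [|reflexivity].
    apply term_neg. lia. }
  destruct k as [|[|[|[|k]]]].
  - rewrite S0. exists ((0, 0)%Z :: nil). split; [|split].
    + repeat constructor; auto.
    + intros [m n] H. unfold graded; cbn [fst snd].
      change (Z.of_nat 0) with 0%Z.
      destruct (Z.eqb_spec (4 * m + 6 * n) 0) as [E|E]; [|reflexivity].
      destruct (Z.eq_dec m 0) as [->|N]; [|apply term_neg; lia].
      exfalso. apply H. left. f_equal. lia.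
    + unfold asum, graded, term, monom. simpl. rewrite (proj1 (proj2 Ha)), scalar_1. ring.
  - rewrite S1. apply Hz. lia.
  - rewrite S2. apply Hz. lia.
  - rewrite S3. apply Hz. lia.
  - set (K := Z.of_nat (S (S (S (S k))))) in *.
    destruct (ex_graded_sum (S (S (S (S k)))) term term_neg) as [T HT]. fold K in HT.
    assert (H2 := IH (S (S k)) ltac:(lia)). assert (H4 := IH k ltac:(lia)). clear IH.
    assert (E : zr (12 * ((Z.of_nat k + 4) * (Z.of_nat k + 5))) * T =
                zr 12 * L (s (S (S k))) - zr 2 * e * s k).
    { apply (is_fsum_map (B' := B) (fun x => zr (12 * ((Z.of_nat k + 4) * (Z.of_nat k + 5))) * x))
        in HT; [|ring|intros; ring].
      apply (is_fsum_map (B' := B) (fun x => zr 12 * L x)) in H2;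
        [|rewrite (d_0 B L HL); ring|intros; rewrite (d_add L HL); ring].
      apply (is_fsum_map (B' := B) (fun x => - (zr 2 * e * x))) in H4;
        [|ring|intros; ring].
      (* The shifts from (m, n) to the three neighbours in the recurrence, with their inverses. The
         first two lower the degree by 2, the last by 4. *)
      set (h1 := fun x : Z * Z => ((fst x + 1)%Z, (snd x - 1)%Z)).
      set (k1 := fun x : Z * Z => ((fst x - 1)%Z, (snd x + 1)%Z)).
      set (h2 := fun x : Z * Z => ((fst x - 2)%Z, (snd x + 1)%Z)).
      set (k2 := fun x : Z * Z => ((fst x + 2)%Z, (snd x - 1)%Z)).
      set (h3 := fun x : Z * Z => ((fst x - 1)%Z, snd x)).
      set (k3 := fun x : Z * Z => ((fst x + 1)%Z, snd x)).
      set (F1 := fun m n => scalar (a m n) * zr (144 * m) * monom (m - 1) (n + 1)).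
      set (F2 := fun m n => scalar (a m n) * zr (8 * n) * monom (m + 2) (n - 1)).
      set (K2 := Z.of_nat (S (S k))) in *.
      destruct (ex_graded_sum (S (S k)) F1) as [T1 HT1].
      { intros m n H. unfold F1. rewrite scalar_a_neg by auto. ring. }
      destruct (ex_graded_sum (S (S k)) F2) as [T2 HT2].
      { intros m n H. unfold F2. rewrite scalar_a_neg by auto. ring. }
      fold K2 in HT1, HT2.
      assert (E2 : zr 12 * L (s (S (S k))) = T1 + T2).
      { eapply is_fsum_unique; [exact H2|].
        eapply is_fsum_ext; [|apply (is_fsum_add B _ _ _ _ HT1 HT2)].
        intros [m n]. unfold graded, F1, F2; cbn [fst snd]. destruct (Z.eqb _ _).
        - rewrite d_term. ring.
        - rewrite (d_0 B L HL). ring. }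
      apply (is_fsum_bij B h1 k1) in HT1.
      2,3: intros [m n]; unfold h1, k1; simpl; f_equal; ring.
      apply (is_fsum_bij B h2 k2) in HT2.
      2,3: intros [m n]; unfold h2, k2; simpl; f_equal; ring.
      apply (is_fsum_bij B h3 k3) in H4.
      2,3: intros [m n]; unfold h3, k3; simpl; f_equal; ring.
      rewrite E2. transitivity (T1 + T2 + - (zr 2 * e * s k)); [|ring].
      eapply is_fsum_unique; [exact HT|].
      eapply is_fsum_ext; [|apply (is_fsum_add B _ _ _ _ (is_fsum_add B _ _ _ _ HT1 HT2) H4)].
      intros [m n]. unfold graded, h1, h2, h3; cbn [fst snd].
      replace (4 * (m + 1) + 6 * (n - 1) =? K2)%Z with (4 * m + 6 * n =? K)%Z
        by (apply Bool.eq_iff_eq_true; rewrite !Z.eqb_eq; lia).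
      replace (4 * (m - 2) + 6 * (n + 1) =? K2)%Z with (4 * m + 6 * n =? K)%Z
        by (apply Bool.eq_iff_eq_true; rewrite !Z.eqb_eq; lia).
      replace (4 * (m - 1) + 6 * n =? Z.of_nat k)%Z with (4 * m + 6 * n =? K)%Z
        by (apply Bool.eq_iff_eq_true; rewrite !Z.eqb_eq; lia).
      destruct (Z.eqb_spec (4 * m + 6 * n) K) as [EK|EK]; [|ring].
      replace (12 * ((Z.of_nat k + 4) * (Z.of_nat k + 5)))%Z
        with (12 * ((4 * m + 6 * n) * (4 * m + 6 * n + 1)))%Z
        by (rewrite EK; unfold K; lia).
      rewrite term_recurrence. unfold F1, F2.
      replace (m + 1 - 1)%Z with m by ring. replace (n - 1 + 1)%Z with n by ring.
      replace (m - 2 + 2)%Z with m by ring. replace (n + 1 - 1)%Z with n by ring. ring. }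
    replace (s (S (S (S (S k))))) with T; auto.
    assert (E0 : zr (12 * ((Z.of_nat k + 4) * (Z.of_nat k + 5))) *
                 (T - s (S (S (S (S k))))) = 0).
    { pose proof (Hrec k) as Hk. rewrite <- E in Hk.
      match goal with |- ?z * (_ - ?x) = _ => transitivity (z * T - z * x); [ring|] end.
      rewrite Hk. ring. }
    apply zr_eq_0 in E0; [|nia].
    transitivity (T - s (S (S (S (S k)))) + s (S (S (S (S k))))); [ring|].
    rewrite E0. ring.
Qed.

End SigmaTerms.

(** * From series along a flow to numbers *)

Section Specialization.
Add Ring CC_ring : (calg_ring CC) (morphism (zr_morph CC), constants [zr_cst]).
Add Ring SCC_ring : (calg_ring (series CC)) (morphism (zr_morph (series CC)), constants [zr_cst]).
Local Open Scope calg_scope.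

(* An integral curve, as formal power series in the time, of [12 g3 d/dg2 + 2/3 g2^2 d/dg3]
   (with [e = g2 / 2]): along it this derivation is [d/dt], so no series in [g2], [g3] are needed. *)
Lemma ex_flow (e0 g0 : CC) : exists e g : series CC,
  e O = e0 /\ g O = g0 /\ sderiv e = zr 6 * g /\ zr 3 * sderiv g = zr 8 * e * e.
Proof.
  destruct (course_of_values (e0, g0) (fun (f : nat -> CC * CC) k => match k with
    | O => (e0, g0)
    | S n => (scalar (/ RtoC (IZR (Z.of_nat k))) * (zr 6 * snd (f n)),
              scalar (/ RtoC (IZR 3)) * (scalar (/ RtoC (IZR (Z.of_nat k))) *
               (zr 8 * smul (fun j => fst (f j)) (fun j => fst (f j)) n)))
    end)) as [f Hf].
  { intros f g [|n] H; [reflexivity|]. rewrite (H n) by lia.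
    rewrite (smul_ext CC _ (fun j => fst (g j)) _ (fun j => fst (g j))); auto;
      intros j Hj; rewrite H; auto; lia. }
  set (e := (fun k => fst (f k)) : series CC). set (g := (fun k => snd (f k)) : series CC).
  exists e, g. unfold e at 1, g at 1.
  split; [rewrite Hf; reflexivity|]. split; [rewrite Hf; reflexivity|]. split.
  - apply functional_extensionality. intros n. rewrite coef_zr.
    unfold sderiv, tl, euler, e. rewrite Hf. cbn [fst]. apply zr_div. lia.
  - apply functional_extensionality. intros n.
    replace (zr 8 * e * e) with (zr 8 * (e * e)) by ring.
    rewrite !coef_zr, coef_mul. unfold sderiv, tl, euler. unfold g. rewrite (Hf (S n)).
    cbn [snd]. fold e. set (x := zr 8 * smul e e n).
    match goal with |- zr 3 * (?z * (?u * (?v * x))) = _ =>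
      transitivity (zr 3 * (u * (z * (v * x)))); [ring|] end.
    rewrite (zr_div CC 3) by lia. apply zr_div. lia.
Qed.

(** Evaluation of the coefficients at time 0; it respects products, hence carries solutions over the
    flow to solutions over C. *)
Definition at_0 (f : series (series CC)) : series CC := fun k => f k O.

Lemma at_0_smul (f g : series (series CC)) n :
  (smul f g n : series CC) O = smul (at_0 f) (at_0 g) n.
Proof.
  revert f. induction n as [|n IH]; intros f; [reflexivity|].
  change ((smul f g (S n) : series CC) O) with (f O O * g (S n) O + (smul (tl f : series (series CC)) g n : series CC) O).
  rewrite IH. reflexivity.
Qed.

Lemma at_0_zeta P : at_0 (zeta_series (series CC) P) = zeta_series CC (at_0 P).
Proof. apply functional_extensionality. intros [|[|n]]; reflexivity. Qed.

Lemma at_0_wp e g3 P : (forall k, P k = wp_step (series CC) e g3 P k) ->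
  forall k, at_0 P k = wp_step CC (e O) (g3 O) (at_0 P) k.
Proof.
  intros HP k. unfold at_0 at 1. rewrite HP.
  assert (E : forall c (x : series CC) n,
    (scalar c * (zr 6 * smul (tl P) (tl P) n - x)) O =
    scalar c * (zr 6 * smul (tl (at_0 P)) (tl (at_0 P)) n - x O)).
  { intros c x n. change ((scalar c * (zr 6 * smul (tl P) (tl P) n - x)) O)
      with (scalar c * (zr 6 * ((smul (tl P) (tl P) n : series CC) O) - x O)).
    rewrite at_0_smul. reflexivity. }
  destruct k as [|[|[|[|[|[|[|k]]]]]]]; try reflexivity;
    unfold wp_step; (etransitivity; [apply E|reflexivity]).
Qed.

(** The heat recurrence is available only over series in the time. It is solved there and the result
    is evaluated at time 0. What is assumed of [P] is what a lattice supplies, and it suffices to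
    identify [P] with the evaluated formal series. *)
Lemma formal_sigma a (e g3 : CC) (P c : series CC) : is_sigma_coefficients a ->
  P 0%nat = 1 -> P 1%nat = 0 -> P 2%nat = 0 -> P 3%nat = 0 -> zr 10 * P 4%nat = e ->
  P 5%nat = 0 -> zr 28 * P 6%nat = g3 -> satisfies_fifth_order CC e P ->
  c 0%nat = 1 -> euler c = zeta_series CC P * c - c ->
  forall k, is_fsum (graded CC (Z.of_nat k) (term CC a e g3)) (c k).
Proof.
  intros Ha H0 H1 H2 H3 H4 H5 H6 HR C0 HC k.
  destruct (ex_flow e g3) as (et & gt & E0 & G0 & Le & Lg).
  destruct (ex_wp_series (series CC) et gt) as [Pt HPt].
  set (Zt := zeta_series (series CC) Pt).
  destruct (ex_sigma_series (series CC) Zt eq_refl) as (s & S0 & HS).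
  destruct (sigma_coef_low (series CC) et gt Pt HPt s HS) as (S1 & S2 & S3).
  pose proof (sderiv_derivation CC) as HL.
  pose proof (heat_recurrence (series CC) et gt Pt HPt s S0 HS sderiv HL Le Lg) as Hrec.
  pose proof (graded_sum_unique (series CC) a Ha sderiv et gt HL Le Lg s S0 S1 S2 S3 Hrec k)
    as Hk.
  apply (is_fsum_map (B' := CC) (fun x : series CC => x O)) in Hk; [|reflexivity|reflexivity].
  assert (HP0 := at_0_wp et gt Pt HPt). rewrite E0, G0 in HP0.
  (* Both satisfy the fifth-order equation for the same [e], so agreement below degree 7 is
     enough. *)
  assert (EP : at_0 Pt = P).
  { apply (fifth_order_unique CC e); auto.
    - apply (wp_fifth_order CC e g3); auto.
    - intros j Hj. destruct j as [|[|[|[|[|[|[|j]]]]]]]; try lia.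
      + rewrite H0. apply (wp_coef_0 CC e g3); auto.
      + rewrite H1. apply (wp_coef_1 CC e g3); auto.
      + rewrite H2. apply (wp_coef_2 CC e g3); auto.
      + rewrite H3. apply (wp_coef_3 CC e g3); auto.
      + assert (E : zr 10 * (at_0 Pt 4%nat - P 4%nat) = 0).
        { pose proof (wp_coef_4 CC e g3 (at_0 Pt) HP0) as E4.
          transitivity (zr 10 * at_0 Pt 4%nat - zr 10 * P 4%nat); [ring|].
          rewrite E4, H4. ring. }
        apply zr_eq_0 in E; [|lia].
        transitivity (at_0 Pt 4%nat - P 4%nat + P 4%nat); [ring|]. rewrite E. ring.
      + rewrite H5. apply (wp_coef_5 CC e g3); auto.
      + assert (E : zr 28 * (at_0 Pt 6%nat - P 6%nat) = 0).
        { pose proof (wp_coef_6 CC e g3 (at_0 Pt) HP0) as E6.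
          transitivity (zr 28 * at_0 Pt 6%nat - zr 28 * P 6%nat); [ring|].
          rewrite E6, H6. ring. }
        apply zr_eq_0 in E; [|lia].
        transitivity (at_0 Pt 6%nat - P 6%nat + P 6%nat); [ring|]. rewrite E. ring. }
  assert (Es : at_0 s = c).
  { apply (sigma_series_unique CC (zeta_series CC P)); auto.
    - unfold at_0. rewrite S0, C0. reflexivity.
    - rewrite <- EP, <- at_0_zeta. fold Zt.
      apply functional_extensionality. intros n.
      apply (f_equal (fun f => f n O)) in HS. unfold euler, at_0 in *.
      rewrite coef_sub, coef_mul, coef_sub in HS.
      change ((Zt * s) n O) with ((smul Zt s n : series CC) O) in HS.
      rewrite at_0_smul in HS. exact HS. }
  rewrite <- Es. unfold at_0.
  eapply is_fsum_ext; [|exact Hk]. intros [m n]. unfold graded; cbn [fst snd].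
  destruct (Z.eqb _ _); [|reflexivity]. unfold term, monom.
  change ((scalar (a m n) * (apow (series CC) (zr 2 * et) (Z.to_nat m) *
     apow (series CC) gt (Z.to_nat n))) O)
    with ((a m n : CC) * (apow (series CC) (zr 2 * et) (Z.to_nat m) O *
     apow (series CC) gt (Z.to_nat n) O)).
  assert (EA : forall (x : series CC) j, apow (series CC) x j O = apow CC (x O) j).
  { intros x j. induction j as [|j IH]; [reflexivity|].
    change (apow (series CC) x (S j) O) with (x O * apow (series CC) x j O).
    rewrite IH. reflexivity. }
  rewrite !EA, G0. change ((zr 2 * et) O) with (zr 2 * et O). rewrite E0. reflexivity.
Qed.

End Specialization.

(** * Lattices *)

Lemma nat_list_bound (l : list nat) : exists N, forall x, In x l -> (x < N)%nat.
Proof.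
  induction l as [|x l [N HN]]; [exists O; intros x []|].
  exists (S (Nat.max x N)). intros y [->|Hy]; [lia|]. specialize (HN y Hy). lia.
Qed.

Lemma summable_nat (f : nat -> R) (M : R) : (forall n, 0 <= f n)%R ->
  (forall n, rsum f (seq 0 n) <= M)%R -> summable (fun _ => True) f M.
Proof.
  intros H0 HM l Hn _.
  destruct (nat_list_bound l) as [N HN]. eapply Rle_trans; [|apply (HM N)].
  apply rsum_incl; auto using seq_NoDup. intros x Hx. apply in_seq. split; [lia|].
  simpl. auto.
Qed.

Lemma summable_union {T : Type} (A B D : T -> Prop) (f : T -> R) (M N : R) :
  (forall x, D x -> A x \/ B x) -> summable A f M -> summable B f N ->
  (forall x, 0 <= f x)%R -> summable D f (M + N).
Proof.
  intros HD HA HB H0 l Hn Hl. rewrite Forall_forall in Hl.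
  assert (E : rsum f l = (rsum f (filter (fun x => decb (A x)) l)
                          + rsum f (filter (fun x => negb (decb (A x))) l))%R).
  { clear. unfold rsum. induction l as [|x l IH]; simpl; [ring|].
    destruct (decb (A x)); simpl; rewrite IH; ring. }
  rewrite E. apply Rplus_le_compat.
  - apply HA; [apply NoDup_filter; auto|]. apply Forall_forall. intros x Hx.
    apply filter_In in Hx. apply decb_elim, Hx.
  - apply HB; [apply NoDup_filter; auto|]. apply Forall_forall. intros x Hx.
    apply filter_In in Hx. destruct Hx as [Hx1 Hx2].
    destruct (HD x (Hl x Hx1)) as [Ha|]; auto.
    apply decb_intro in Ha. rewrite Ha in Hx2. discriminate.
Qed.

(** [u^(-3/2)], summable in one variable; a product of two such factors dominates the inverse cube
    on a planar lattice. *)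
Definition three_halves (u : R) : R := (/ (u * sqrt u))%R.

Lemma three_halves_pos u : (0 < u)%R -> (0 < three_halves u)%R.
Proof.
  intros H. apply Rinv_0_lt_compat, Rmult_lt_0_compat; auto. apply sqrt_lt_R0; auto.
Qed.

(* Telescoping against [6 / sqrt]. *)
Lemma three_halves_step u : (1 <= u)%R ->
  (three_halves u <= 6 * (/ sqrt u - / sqrt (u + 1)))%R.
Proof.
  intros Hu. unfold three_halves.
  assert (E1 : (sqrt u * sqrt u = u)%R) by (apply sqrt_sqrt; lra).
  assert (E2 : (sqrt (u + 1) * sqrt (u + 1) = u + 1)%R) by (apply sqrt_sqrt; lra).
  assert (Hx : (1 <= sqrt u)%R) by (rewrite <- sqrt_1; apply sqrt_le_1; lra).
  assert (Hxy : (sqrt u <= sqrt (u + 1))%R) by (apply sqrt_le_1; lra).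
  set (x := sqrt u) in *. set (y := sqrt (u + 1)) in *.
  assert (Hy2 : (y <= 3 / 2 * x)%R) by nra.
  replace (6 * (/ x - / y))%R with (6 * (/ (x * y * (x + y))))%R.
  2:{ replace (/ x - / y)%R with ((y - x) / (x * y))%R by (field; lra).
      assert (1 = (y - x) * (x + y))%R by nra.
      replace (/ (x * y * (x + y)))%R with (((y - x) * (x + y)) / (x * y * (x + y)))%R
        by (rewrite <- H; field; nra).
      field. nra. }
  rewrite <- E1.
  assert (H3 : (x * y * (x + y) <= 6 * (x * x * x))%R).
  { apply Rle_trans with (x * (3 / 2 * x) * (x + 3 / 2 * x))%R; [|nra].
    apply Rmult_le_compat; nra. }
  apply Rmult_le_reg_r with (x * y * (x + y))%R; [nra|].
  replace (6 * / (x * y * (x + y)) * (x * y * (x + y)))%R with 6%R by (field; nra).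
  apply Rmult_le_reg_l with (x * x * x)%R; [nra|].
  replace (x * x * x * (/ (x * x * x) * (x * y * (x + y))))%R with (x * y * (x + y))%R
    by (field; nra).
  lra.
Qed.

Lemma seq_S_end n : seq 0 (S n) = seq 0 n ++ (n :: nil).
Proof. rewrite seq_S. reflexivity. Qed.

Lemma three_halves_summable : exists M,
  summable (fun _ : Z => True) (fun m => three_halves (1 + IZR (Z.abs m))) M.
Proof.
  assert (Hnat : summable (fun _ : nat => True) (fun n => three_halves (1 + INR n)) 6).
  { apply summable_nat.
    - intros n. apply Rlt_le, three_halves_pos. pose proof (pos_INR n). lra.
    - intros n. apply Rle_trans with (6 * (1 - / sqrt (1 + INR n)))%R.
      + induction n as [|n IH].
        * unfold rsum. simpl. rewrite Rplus_0_r, sqrt_1. lra.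
        * rewrite seq_S_end, rsum_app. unfold rsum at 2. simpl map. simpl fold_right.
          rewrite Rplus_0_r, S_INR.
          pose proof (three_halves_step (1 + INR n)) as H.
          pose proof (pos_INR n). specialize (H ltac:(lra)).
          rewrite Rplus_assoc in H. lra.
      + assert (0 < / sqrt (1 + INR n))%R; [|lra].
        apply Rinv_0_lt_compat, sqrt_lt_R0. pose proof (pos_INR n). lra. }
  exists (6 + 6)%R.
  assert (E : forall m, three_halves (1 + IZR (Z.abs m)) = three_halves (1 + INR (Z.abs_nat m))).
  { intros m. rewrite INR_IZR_INZ, Zabs2Nat.id_abs. reflexivity. }
  apply (summable_union (fun m => (0 <= m)%Z) (fun m => (m <= 0)%Z)).
  - intros m _. lia.
  - apply summable_le with (fun m => three_halves (1 + INR (Z.abs_nat m))).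
    { intros m _. rewrite E. lra. }
    apply (summable_inj (fun m => (0 <= m)%Z) (fun _ => True) Z.abs_nat
             (fun n => three_halves (1 + INR n)) 6); auto. intros; lia.
  - apply summable_le with (fun m => three_halves (1 + INR (Z.abs_nat m))).
    { intros m _. rewrite E. lra. }
    apply (summable_inj (fun m => (m <= 0)%Z) (fun _ => True) Z.abs_nat
             (fun n => three_halves (1 + INR n)) 6); auto. intros; lia.
  - intros m. apply Rlt_le, three_halves_pos. assert (0 <= IZR (Z.abs m))%R; [|lra].
    apply IZR_le; lia.
Qed.

Definition lpoint (w1 w2 : C) (m n : Z) : C := RtoC (IZR m) * w1 + RtoC (IZR n) * w2.

Definition is_basis (w1 w2 : C) (L : C -> Prop) : Prop :=
  (forall s t : R, RtoC s * w1 + RtoC t * w2 = 0 -> s = 0%R /\ t = 0%R) /\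
  forall z, L z <-> exists m n, z = lpoint w1 w2 m n.

Lemma basis_swap w1 w2 L : is_basis w1 w2 L -> is_basis w2 w1 L.
Proof.
  intros [H1 H2]. split.
  - intros s t E. destruct (H1 t s); auto. rewrite Cplus_comm. exact E.
  - intros z. rewrite H2. unfold lpoint. split; intros (m & n & ->); exists n, m; ring.
Qed.

Lemma im_le_Cmod (c : C) : (Rabs (Im c) <= Cmod c)%R.
Proof. eapply Rle_trans; [|apply Rmax_Cmod]. apply Rmax_r. Qed.

Section Lattice.
Variables (w1 w2 : C) (L : C -> Prop).
Hypothesis HB : is_basis w1 w2 L.

Lemma lattice_0 : L 0.
Proof. apply (proj2 HB). exists 0%Z, 0%Z. unfold lpoint. ring. Qed.

Lemma lattice_plus x y : L x -> L y -> L (x + y).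
Proof.
  intros Hx Hy. apply (proj2 HB) in Hx. apply (proj2 HB) in Hy. apply (proj2 HB).
  destruct Hx as (m & n & ->), Hy as (m' & n' & ->). exists (m + m')%Z, (n + n')%Z.
  unfold lpoint. rewrite !plus_IZR, !RtoC_plus. ring.
Qed.

Lemma lattice_opp x : L x -> L (- x).
Proof.
  intros Hx. apply (proj2 HB) in Hx. apply (proj2 HB).
  destruct Hx as (m & n & ->). exists (- m)%Z, (- n)%Z.
  unfold lpoint. rewrite !opp_IZR, !RtoC_opp. ring.
Qed.

Lemma lattice_minus x y : L x -> L y -> L (x - y).
Proof. intros Hx Hy. apply lattice_plus; auto. apply lattice_opp; auto. Qed.

(** If the determinant vanished, [(Re w2, - Re w1)] and [(Im w2, - Im w1)] would be real relations,
    so both generators would be 0, and then [(1, 0)] is a relation too. *)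
Lemma basis_det : (Re w1 * Im w2 - Im w1 * Re w2 <> 0)%R.
Proof.
  destruct HB as [H _]. intros E.
  assert (K : forall s t, (s * Re w1 + t * Re w2 = 0)%R -> (s * Im w1 + t * Im w2 = 0)%R ->
              s = 0%R /\ t = 0%R).
  { intros s t E1 E2. apply H. apply injective_projections; simpl.
    - unfold Re in E1. lra.
    - unfold Im in E2. lra. }
  destruct (K (Re w2) (- Re w1)%R) as [R2 R1]; [ring|lra|].
  destruct (K (Im w2) (- Im w1)%R) as [I2 I1]; [lra|ring|].
  destruct (K 1%R 0%R) as [F _]; [lra|lra|lra].
Qed.

(** Cramer's rule expresses m times the determinant through the point and [w2]. *)
Lemma lattice_lower_left : exists k, (0 < k)%R /\
  forall m n, (k * IZR (Z.abs m) <= Cmod (lpoint w1 w2 m n))%R.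
Proof.
  pose proof basis_det as HD. set (d := (Re w1 * Im w2 - Im w1 * Re w2)%R) in *.
  pose proof (Rabs_pos_lt _ HD) as Hd. pose proof (Cmod_ge_0 w2) as H2.
  (* The summand 1 makes the denominator visibly positive. *)
  exists (Rabs d / (2 * Cmod w2 + 1))%R. split; [apply Rdiv_lt_0_compat; lra|].
  intros m n. set (x := lpoint w1 w2 m n).
  assert (E : (IZR m * d = Re x * Im w2 - Im x * Re w2)%R).
  { unfold x, lpoint, d. destruct w1 as [a b], w2 as [p q]. simpl. ring. }
  assert (K : (IZR (Z.abs m) * Rabs d <= 2 * Cmod x * Cmod w2)%R).
  { rewrite abs_IZR, <- Rabs_mult, E. unfold Rminus.
    eapply Rle_trans; [apply Rabs_triang|]. rewrite Rabs_Ropp, !Rabs_mult.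
    pose proof (re_le_Cmod x). pose proof (im_le_Cmod x).
    pose proof (re_le_Cmod w2). pose proof (im_le_Cmod w2).
    assert (Rabs (Re x) * Rabs (Im w2) <= Cmod x * Cmod w2)%R
      by (apply Rmult_le_compat; auto using Rabs_pos).
    assert (Rabs (Im x) * Rabs (Re w2) <= Cmod x * Cmod w2)%R
      by (apply Rmult_le_compat; auto using Rabs_pos).
    lra. }
  pose proof (Cmod_ge_0 x) as Hx.
  apply Rmult_le_reg_r with (2 * Cmod w2 + 1)%R; [lra|].
  replace (Rabs d / (2 * Cmod w2 + 1) * IZR (Z.abs m) * (2 * Cmod w2 + 1))%R
    with (IZR (Z.abs m) * Rabs d)%R by (field; lra).
  nra.
Qed.

End Lattice.

Section LatticeSums.
Variables (w1 w2 : C) (L : C -> Prop).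
Hypothesis HB : is_basis w1 w2 L.

Lemma lattice_lower : exists k, (0 < k)%R /\ forall m n,
  (k * IZR (Z.abs m) <= Cmod (lpoint w1 w2 m n))%R /\
  (k * IZR (Z.abs n) <= Cmod (lpoint w1 w2 m n))%R.
Proof.
  destruct (lattice_lower_left w1 w2 L HB) as (k1 & K1 & H1).
  destruct (lattice_lower_left w2 w1 L (basis_swap _ _ _ HB)) as (k2 & K2 & H2).
  exists (Rmin k1 k2). split; [apply Rmin_glb_lt; auto|]. intros m n.
  assert (0 <= IZR (Z.abs m))%R by (apply IZR_le; lia).
  assert (0 <= IZR (Z.abs n))%R by (apply IZR_le; lia).
  pose proof (Rmin_l k1 k2). pose proof (Rmin_r k1 k2).
  split.
  - eapply Rle_trans; [|apply H1]. apply Rmult_le_compat_r; auto.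
  - replace (lpoint w1 w2 m n) with (lpoint w2 w1 n m) by (unfold lpoint; ring).
    eapply Rle_trans; [|apply H2]. apply Rmult_le_compat_r; auto.
Qed.

Lemma lpoint_inj m n m' n' :
  lpoint w1 w2 m n = lpoint w1 w2 m' n' -> m = m' /\ n = n'.
Proof.
  intros E. destruct (proj1 HB (IZR (m - m')) (IZR (n - n'))) as [E1 E2].
  - rewrite !minus_IZR, !RtoC_minus.
    replace ((RtoC (IZR m) - RtoC (IZR m')) * w1 + (RtoC (IZR n) - RtoC (IZR n')) * w2)
      with (lpoint w1 w2 m n - lpoint w1 w2 m' n') by (unfold lpoint; ring).
    rewrite E. ring.
  - apply eq_IZR in E1. apply eq_IZR in E2. lia.
Qed.

Lemma min_norm : exists rho, (0 < rho)%R /\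
  forall x, nonzero_points L x -> (rho <= Cmod x)%R.
Proof.
  destruct lattice_lower as (k & Hk & H). exists k. split; auto.
  intros x [Hx Hx0]. apply (proj2 HB) in Hx. destruct Hx as (m & n & ->).
  destruct (H m n) as [Hm Hn].
  destruct (Z.eq_dec m 0) as [->|Nm].
  - destruct (Z.eq_dec n 0) as [->|Nn].
    + exfalso. apply Hx0. unfold lpoint. ring.
    + assert (1 <= IZR (Z.abs n))%R by (apply IZR_le; lia). nra.
  - assert (1 <= IZR (Z.abs m))%R by (apply IZR_le; lia). nra.
Qed.

(** With u = 1 + |m| and v = 1 + |n|, the quantity 1 + |x| is at least [c max(u, v)], hence at least
    [c sqrt(u v)]; its inverse cube is thus bounded by a product of summable factors. *)
Lemma lattice_summable : exists M, (0 <= M)%R /\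
  summable L (fun x => / (1 + Cmod x) ^ 3)%R M.
Proof.
  destruct lattice_lower as (k & Hk & H). destruct three_halves_summable as [M HM].
  set (c := Rmin 1 k).
  assert (Hc : (0 < c)%R) by (apply Rmin_glb_lt; lra).
  assert (Hc1 : (c <= 1)%R) by apply Rmin_l. assert (Hck : (c <= k)%R) by apply Rmin_r.
  destruct (choice (fun (x : C) (p : Z * Z) => L x -> x = lpoint w1 w2 (fst p) (snd p)))
    as [idx Hidx].
  { intros x. destruct (classic (L x)) as [Hx|Hx].
    - destruct (proj1 (proj2 HB x) Hx) as (m & n & E). exists (m, n). auto.
    - exists (0, 0)%Z. tauto. }
  set (g := fun p : Z * Z => (three_halves (1 + IZR (Z.abs (fst p))) *
                             three_halves (1 + IZR (Z.abs (snd p))))%R).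
  assert (H0 : forall m, (0 <= three_halves (1 + IZR (Z.abs m)))%R).
  { intros m. apply Rlt_le, three_halves_pos. assert (0 <= IZR (Z.abs m))%R; [|lra].
    apply IZR_le; lia. }
  assert (Hs : summable L (fun x => / c ^ 3 * g (idx x))%R (/ c ^ 3 * (M * M))).
  { apply (summable_scal L (fun x => g (idx x))).
    - apply Rlt_le, Rinv_0_lt_compat, pow_lt, Hc.
    - apply (summable_inj L (cross (fun _ => True) (fun _ => True)) idx g).
      + intros x _. split; exact I.
      + intros x y Hx Hy E. rewrite (Hidx x Hx), (Hidx y Hy), E. reflexivity.
      + apply (summable_prod _ _ (fun m => three_halves (1 + IZR (Z.abs m)))
                 (fun m => three_halves (1 + IZR (Z.abs m)))); auto. }
  exists (/ c ^ 3 * (M * M))%R. split.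
  { apply (Hs nil); constructor. }
  eapply summable_le; [|exact Hs]. intros x Hx. simpl. unfold g.
  destruct (H (fst (idx x)) (snd (idx x))) as [Hm Hn].
  rewrite <- (Hidx x Hx) in Hm, Hn.
  assert (Am : (0 <= IZR (Z.abs (fst (idx x))))%R) by (apply IZR_le; lia).
  assert (An : (0 <= IZR (Z.abs (snd (idx x))))%R) by (apply IZR_le; lia).
  set (u := (1 + IZR (Z.abs (fst (idx x))))%R) in *.
  set (v := (1 + IZR (Z.abs (snd (idx x))))%R) in *.
  set (t := (1 + Cmod x)%R).
  assert (Hu : (c * u <= t)%R).
  { unfold t. replace (IZR (Z.abs (fst (idx x)))) with (u - 1)%R in Hm by (unfold u; ring).
    assert (c * (u - 1) <= k * (u - 1))%R by (apply Rmult_le_compat_r; unfold u; lra). lra. }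
  assert (Hv : (c * v <= t)%R).
  { unfold t. replace (IZR (Z.abs (snd (idx x)))) with (v - 1)%R in Hn by (unfold v; ring).
    assert (c * (v - 1) <= k * (v - 1))%R by (apply Rmult_le_compat_r; unfold v; lra). lra. }
  assert (Hu1 : (1 <= u)%R) by (unfold u; lra). assert (Hv1 : (1 <= v)%R) by (unfold v; lra).
  clearbody u v t. unfold three_halves.
  assert (Pu : (sqrt u * sqrt u = u)%R) by (apply sqrt_sqrt; lra).
  assert (Pv : (sqrt v * sqrt v = v)%R) by (apply sqrt_sqrt; lra).
  assert (Hp : (1 <= sqrt u)%R) by (rewrite <- sqrt_1; apply sqrt_le_1; lra).
  assert (Hq : (1 <= sqrt v)%R) by (rewrite <- sqrt_1; apply sqrt_le_1; lra).
  set (p := sqrt u) in *. set (q := sqrt v) in *. rewrite <- Pu, <- Pv in *.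
  assert (Ht : (0 < t)%R) by nra.
  assert (Hpq : (c * (p * q) <= t)%R).
  { destruct (Rle_dec p q).
    - eapply Rle_trans; [|exact Hv]. apply Rmult_le_compat_l; nra.
    - eapply Rle_trans; [|exact Hu]. apply Rmult_le_compat_l; nra. }
  assert (Hfin : (c ^ 3 * (p * p * p * (q * q * q)) <= t ^ 3)%R).
  { replace (c ^ 3 * (p * p * p * (q * q * q)))%R with ((c * (p * q)) ^ 3)%R by ring.
    apply pow_incr. split; auto. apply Rmult_le_pos; nra. }
  assert (Hpos : (0 < c ^ 3 * (p * p * p * (q * q * q)))%R).
  { apply Rmult_lt_0_compat; [apply pow_lt, Hc|]. repeat apply Rmult_lt_0_compat; lra. }
    replace (/ (c * (c * (c * 1))) * (/ (p * p * p) * / (q * q * q)))%R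
    with (/ (c ^ 3 * (p * p * p * (q * q * q))))%R by (field; repeat split; lra).
  change (t * (t * (t * 1)))%R with (t ^ 3)%R.
  apply Rinv_le_contravar; auto.
Qed.

Definition zrange (N : nat) : list Z :=
  map (fun i => (Z.of_nat i - Z.of_nat N)%Z) (seq 0 (2 * N + 1)).

Lemma in_zrange N m : In m (zrange N) <-> (Z.abs m <= Z.of_nat N)%Z.
Proof.
  unfold zrange. rewrite in_map_iff. split.
  - intros (i & <- & Hi). apply in_seq in Hi. lia.
  - intros H. exists (Z.to_nat (m + Z.of_nat N)). split; [lia|]. apply in_seq. lia.
Qed.

Lemma NoDup_zrange N : NoDup (zrange N).
Proof.
  apply (NoDup_map_inj (fun _ => True)).
  - intros x y _ _ E. lia.
  - apply Forall_True.
  - apply seq_NoDup.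
Qed.

Definition box (N : nat) : list C :=
  map (fun p => lpoint w1 w2 (fst p) (snd p)) (list_prod (zrange N) (zrange N)).

Lemma NoDup_box N : NoDup (box N).
Proof.
  apply (NoDup_map_inj (fun _ => True)).
  - intros [m n] [m' n'] _ _ E. apply lpoint_inj in E. simpl in E. destruct E; congruence.
  - apply Forall_True.
  - apply NoDup_list_prod; apply NoDup_zrange.
Qed.

Lemma box_lattice N : Forall L (box N).
Proof.
  apply Forall_forall. intros x Hx. apply in_map_iff in Hx. destruct Hx as ([m n] & <- & _).
  apply (proj2 HB). eauto.
Qed.

Lemma box_absorbs x : L x -> exists N, forall N', (N <= N')%nat -> In x (box N').
Proof.
  intros Hx. apply (proj2 HB) in Hx. destruct Hx as (m & n & ->).
  exists (Z.to_nat (Z.abs m + Z.abs n)). intros N' HN'.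
  apply in_map_iff. exists (m, n). split; auto. apply in_prod_iff.
  rewrite !in_zrange. lia.
Qed.

Lemma box_absorbs_list l : Forall L l -> exists N, forall N', (N <= N')%nat -> incl l (box N').
Proof.
  induction 1 as [|x l Hx Hl [N HN]].
  - exists O. intros N' _ x [].
  - destruct (box_absorbs x Hx) as [N1 HN1]. exists (Nat.max N N1).
    intros N' HN' y [<-|Hy]; [apply HN1; lia|apply (HN N'); auto; lia].
Qed.

Lemma ball_box (r : R) : exists N, forall x, L x -> (Cmod x <= r)%R -> In x (box N).
Proof.
  destruct lattice_lower as (k & Hk & H).
  destruct (nfloor_ex (Rmax 0 (r / k))) as [N HN]; [apply Rmax_l|].
  exists (S N). intros x Hx Hr. apply (proj2 HB) in Hx. destruct Hx as (m & n & ->).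
  destruct (H m n) as [Hm Hn].
  assert (K : forall j, (k * IZR (Z.abs j) <= r)%R -> (Z.abs j <= Z.of_nat (S N))%Z).
  { intros j Hj. apply le_IZR. rewrite <- INR_IZR_INZ, S_INR.
    assert (IZR (Z.abs j) <= r / k)%R by (apply Rle_div_r; lra).
    pose proof (Rmax_r 0 (r / k)). lra. }
  apply in_map_iff. exists (m, n). split; auto. apply in_prod_iff. rewrite !in_zrange.
  split; apply K; lra.
Qed.

(** Finitely many points satisfy |x| <= 2|z| + 1 and give a positive minimum; for the others |z - x|
    >= |x| - |z| >= (1 + |x|)/2. *)
Lemma lattice_gap z : ~ L z -> exists c, (0 < c)%R /\
  forall x, L x -> (c * (1 + Cmod x) <= Cmod (z - x))%R.
Proof.
  intros Hz. destruct (ball_box (2 * Cmod z + 1)) as [N HN].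
  assert (Hl : exists c, (0 < c)%R /\
    forall x, In x (box N) -> (c * (1 + Cmod x) <= Cmod (z - x))%R).
  { pose proof (box_lattice N) as HL. clear HN. revert HL. generalize (box N).
    induction 1 as [|x l Hx Hl (c & Hc & IH)].
    - exists 1%R. split; [lra|]. intros x [].
    - pose proof (Cmod_ge_0 x) as Hx0.
      assert (Hp : (0 < Cmod (z - x))%R).
      { apply Cmod_gt_0. intros E. apply Hz. replace z with (z - x + x) by ring.
        rewrite E. replace (0 + x) with x by ring. exact Hx. }
      exists (Rmin c (Cmod (z - x) / (1 + Cmod x))).
      split; [apply Rmin_glb_lt; auto; apply Rdiv_lt_0_compat; lra|].
      intros y [<-|Hy].
      + apply Rle_trans with (Cmod (z - x) / (1 + Cmod x) * (1 + Cmod x))%R.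
        * apply Rmult_le_compat_r; [lra|apply Rmin_r].
        * right. field. lra.
      + eapply Rle_trans; [|apply (IH y Hy)].
        apply Rmult_le_compat_r; [pose proof (Cmod_ge_0 y); lra|apply Rmin_l]. }
  destruct Hl as (c & Hc & Hl). exists (Rmin c (1 / 2)).
  split; [apply Rmin_glb_lt; lra|]. intros x Hx. pose proof (Cmod_ge_0 x) as Hx0.
  destruct (Rle_dec (Cmod x) (2 * Cmod z + 1)) as [Hr|Hr].
  - eapply Rle_trans; [|apply Hl, HN; auto]. apply Rmult_le_compat_r; [lra|apply Rmin_l].
  - apply Rle_trans with (1 / 2 * (1 + Cmod x))%R.
    + apply Rmult_le_compat_r; [lra|apply Rmin_r].
    + assert (Cmod x <= Cmod z + Cmod (z - x))%R; [|lra].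
      replace x with (z + - (z - x)) at 1 by ring.
      eapply Rle_trans; [apply Cmod_triangle|]. rewrite Cmod_opp. lra.
Qed.

End LatticeSums.

(** * Eisenstein's relation *)

Lemma Cmod_inv_le (x : C) (d : R) : (0 < d)%R -> (d <= Cmod x)%R -> (Cmod (/ x) <= / d)%R.
Proof.
  intros Hd H. assert (x <> 0) by (apply Cmod_gt_0; lra).
  rewrite Cmod_inv by auto. apply Rinv_le_contravar; auto.
Qed.

(** Once a sum exists, its value can be read along one exhausting sequence of finite sets, here the
    boxes. *)
Lemma is_sum_along {T : Type} (A : T -> Prop) (f : T -> C) (s : C) (bs : nat -> list T) :
  (forall N, NoDup (bs N)) -> (forall N, Forall A (bs N)) ->
  (forall l, Forall A l -> exists N, forall N', (N <= N')%nat -> incl l (bs N')) ->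
  (forall eps : R, (0 < eps)%R -> exists N, forall N', (N <= N')%nat ->
     (Cmod (lsum f (bs N')) <= eps)%R) ->
  is_sum A f s -> s = 0.
Proof.
  intros H1 H2 H3 H4 Hs. apply Cmod_eq_0. apply Rle_antisym; [|apply Cmod_ge_0].
  apply le_epsilon. intros eps He. rewrite Rplus_0_l.
  rewrite is_sum_net in Hs. destruct (Hs (eps / 2)%R ltac:(lra)) as (l0 & L1 & L2 & L3).
  destruct (H3 l0 L2) as [N HN]. destruct (H4 (eps / 2)%R ltac:(lra)) as [N1 HN1].
  set (K := Nat.max N N1).
  specialize (L3 (bs K) (H1 K) (H2 K) (HN K ltac:(lia))). specialize (HN1 K ltac:(lia)).
  replace s with (lsum f (bs K) + - (lsum f (bs K) - s)) by ring.
  eapply Rle_trans; [apply Cmod_triangle|]. rewrite Cmod_opp. lra.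
Qed.

Lemma lsum_telescope (h : nat -> C) n :
  lsum (fun i => h (S i) - h i) (seq 0 n) = h n - h O.
Proof.
  induction n as [|n IH]; [unfold lsum; simpl; ring|].
  rewrite seq_S_end, lsum_app, IH. unfold lsum. simpl. ring.
Qed.

Lemma lsum_list_prod {T U : Type} (f : T * U -> C) (l : list T) (m : list U) :
  lsum f (list_prod l m) = lsum (fun y => lsum (fun x => f (x, y)) l) m.
Proof.
  induction l as [|x l IH]; simpl.
  - unfold lsum at 1. simpl. symmetry. apply lsum_zero. reflexivity.
  - rewrite lsum_app, IH, lsum_map, <- lsum_plus. apply lsum_ext. reflexivity.
Qed.

Section Eisenstein.
Variables (w1 w2 : C) (L : C -> Prop).
Hypothesis HB : is_basis w1 w2 L.

Lemma off_lattice_summable z k : ~ L z -> (3 <= k)%nat ->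
  exists M, summable L (fun x => Cmod ((/ (z - x)) ^ k)) M.
Proof.
  intros Hz Hk. destruct (lattice_gap _ _ _ HB z Hz) as (c & Hc & H).
  destruct (lattice_summable _ _ _ HB) as (M & _ & HM).
  exists ((/ c) ^ k * M)%R.
  eapply summable_le; [|apply summable_scal; [|exact HM]].
  - intros x Hx. specialize (H x Hx). pose proof (Cmod_ge_0 x).
    rewrite Cmod_pow. apply Rle_trans with ((/ (c * (1 + Cmod x))) ^ k)%R.
    + apply pow_incr. split; [apply Cmod_ge_0|]. apply Cmod_inv_le; auto. nra.
    + rewrite Rinv_mult, Rpow_mult_distr. apply Rmult_le_compat_l.
      * apply pow_le, Rlt_le, Rinv_0_lt_compat, Hc.
      * rewrite pow_inv. apply Rinv_le_contravar; [apply pow_lt; lra|].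
        apply Rle_pow; [lra|auto].
  - apply pow_le, Rlt_le, Rinv_0_lt_compat, Hc.
Qed.

(** Difference of the terms of [E_2(z)] and [E_2(z + r)]: of order -3 in x, although each series
    alone is not absolutely convergent. *)
Definition inv_sq_diff (z r x : C) : C := (/ (z - x)) ^ 2 - (/ (z + r - x)) ^ 2.

Lemma off_lattice_shift z r : ~ L z -> L r -> ~ L (z + r).
Proof.
  intros Hz Hr H. apply Hz. replace z with (z + r - r) by ring.
  eapply lattice_minus; eauto.
Qed.

Lemma off_lattice_neq z x : ~ L z -> L x -> z - x <> 0.
Proof.
  intros Hz Hx E. apply Hz. replace z with (z - x + x) by ring. rewrite E.
  replace (0 + x) with x by ring. auto.
Qed.

(** With p and q the two inverses, [p - q = r p q], so the difference of squares is
    [r p q (p + q)]. *)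
Lemma inv_sq_diff_summable z r : ~ L z -> L r ->
  exists M, summable L (fun x => Cmod (inv_sq_diff z r x)) M.
Proof.
  intros Hz Hr. pose proof (off_lattice_shift z r Hz Hr) as Hzr.
  destruct (lattice_gap _ _ _ HB z Hz) as (c1 & C1 & H1).
  destruct (lattice_gap _ _ _ HB (z + r) Hzr) as (c2 & C2 & H2).
  destruct (lattice_summable _ _ _ HB) as (M & _ & HM).
  set (c := Rmin c1 c2). assert (Hc : (0 < c)%R) by (apply Rmin_glb_lt; auto).
  exists (Cmod r * 2 * (/ c) ^ 3 * M)%R.
  assert (Hc0 : (0 <= (/ c) ^ 3)%R) by (apply pow_le, Rlt_le, Rinv_0_lt_compat, Hc).
  pose proof (Cmod_ge_0 r) as Hr0.
  eapply summable_le; [|apply summable_scal; [|exact HM]].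
  - intros x Hx. specialize (H1 x Hx). specialize (H2 x Hx).
    pose proof (Cmod_ge_0 x) as Hx0.
    set (d := (c * (1 + Cmod x))%R). assert (Hd : (0 < d)%R) by (unfold d; nra).
    assert (D1 : (d <= Cmod (z - x))%R).
    { eapply Rle_trans; [|exact H1]. apply Rmult_le_compat_r; [lra|apply Rmin_l]. }
    assert (D2 : (d <= Cmod (z + r - x))%R).
    { eapply Rle_trans; [|exact H2]. apply Rmult_le_compat_r; [lra|apply Rmin_r]. }
    pose proof (Cmod_inv_le _ d Hd D1) as I1. pose proof (Cmod_inv_le _ d Hd D2) as I2.
    assert (N1 : z - x <> 0) by (apply Cmod_gt_0; lra).
    assert (N2 : z + r - x <> 0) by (apply Cmod_gt_0; lra).
    unfold inv_sq_diff.
    replace ((/ (z - x)) ^ 2 - (/ (z + r - x)) ^ 2) with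
      (r * (/ (z - x) * / (z + r - x) * (/ (z - x) + / (z + r - x))))
      by (field; auto).
    pose proof (Cmod_ge_0 (/ (z - x))) as P1. pose proof (Cmod_ge_0 (/ (z + r - x))) as P2.
    set (p := / (z - x)) in *. set (q := / (z + r - x)) in *.
    rewrite !Cmod_mult. pose proof (Cmod_triangle p q) as Ht.
    assert (Hd0 : (0 < / d)%R) by (apply Rinv_0_lt_compat; auto).
    apply Rle_trans with (Cmod r * (/ d * / d * (/ d + / d)))%R.
    + apply Rmult_le_compat_l; auto.
      apply Rmult_le_compat; [apply Rmult_le_pos; auto|apply Cmod_ge_0| |lra].
      apply Rmult_le_compat; auto.
    + right. unfold d. field. split; lra.
  - apply Rmult_le_pos; lra.
Qed.

(* Over a box the sum telescopes to two opposite sides, of size [O(N)] with terms [O(N^-2)]. *)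
Lemma inv_sq_diff_sum_basis z : ~ L z -> is_sum L (inv_sq_diff z w1) 0.
Proof.
  intros Hz.
  assert (Hw : L w1).
  { apply (proj2 HB). exists 1%Z, 0%Z. unfold lpoint. simpl. ring. }
  destruct (inv_sq_diff_summable z w1 Hz Hw) as [M HM].
  destruct (ex_is_sum _ _ _ HM) as (s & Hs & _).
  assert (E : s = 0); [|subst; auto].
  apply (is_sum_along L (inv_sq_diff z w1) s (box w1 w2)); auto.
  - apply (NoDup_box w1 w2 L HB).
  - apply (box_lattice w1 w2 L HB).
  - apply (box_absorbs_list w1 w2 L HB).
  - intros eps He. destruct (lattice_gap _ _ _ HB z Hz) as (c & Hc & H).
    destruct (lattice_lower _ _ _ HB) as (k & Hk & Hlow).
    set (h := fun m n : Z => (/ (z - lpoint w1 w2 m n)) ^ 2).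
    assert (Hh : forall N m n, (1 <= N)%nat -> (Z.of_nat N <= Z.abs m)%Z ->
      (Cmod (h m n) <= / ((c * k) ^ 2 * INR N ^ 2))%R).
    { intros N m n HN Hm. unfold h. rewrite Cmod_pow.
      assert (HN0 : (1 <= INR N)%R) by (apply (le_INR 1); auto).
      rewrite <- Rpow_mult_distr, <- pow_inv. apply pow_incr. split; [apply Cmod_ge_0|].
      apply Cmod_inv_le; [apply Rmult_lt_0_compat; [nra|lra]|].
      eapply Rle_trans; [|apply H; apply (proj2 HB); eauto].
      destruct (Hlow m n) as [Hl _].
      assert (INR N <= IZR (Z.abs m))%R by (rewrite INR_IZR_INZ; apply IZR_le; auto).
      rewrite Rmult_assoc. apply Rmult_le_compat_l; [lra|].
      assert (k * INR N <= k * IZR (Z.abs m))%R by (apply Rmult_le_compat_l; lra). lra. }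
    assert (Hbox : forall N, (1 <= N)%nat ->
      (Cmod (lsum (inv_sq_diff z w1) (box w1 w2 N)) <= 6 / (c * k) ^ 2 * / INR N)%R).
    { intros N HN. assert (HN0 : (1 <= INR N)%R) by (apply (le_INR 1); auto).
      unfold box. rewrite lsum_map, lsum_list_prod.
      (* Translation of z by [w1] moves the index m to m - 1, so each row telescopes to its end
         terms m = N and m = -N - 1. *)
      rewrite (lsum_ext _ (fun n => h (Z.of_nat N) n - h (- Z.of_nat N - 1)%Z n)).
      2:{ intros n _. unfold zrange. rewrite lsum_map.
          rewrite (lsum_ext _ (fun i => h (Z.of_nat (S i) - Z.of_nat N - 1)%Z n -
                                        h (Z.of_nat i - Z.of_nat N - 1)%Z n)).
          - rewrite (lsum_telescope (fun i => h (Z.of_nat i - Z.of_nat N - 1)%Z n)).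
            replace (Z.of_nat (2 * N + 1) - Z.of_nat N - 1)%Z with (Z.of_nat N) by lia.
            replace (Z.of_nat 0 - Z.of_nat N - 1)%Z with (- Z.of_nat N - 1)%Z by lia.
            reflexivity.
          - intros i _. unfold inv_sq_diff, h. cbn [fst snd].
            replace (Z.of_nat (S i) - Z.of_nat N - 1)%Z with (Z.of_nat i - Z.of_nat N)%Z by lia.
            replace (z + w1 - lpoint w1 w2 (Z.of_nat i - Z.of_nat N) n)
              with (z - lpoint w1 w2 (Z.of_nat i - Z.of_nat N - 1) n); [reflexivity|].
            unfold lpoint. rewrite (minus_IZR _ 1), RtoC_minus. ring. }
      eapply Rle_trans; [apply lsum_le|].
      (* There are 2N + 1 rows with two end terms each, and 4N + 2 <= 6N. *)
      apply Rle_trans with (rsum (fun _ : Z => 2 * / ((c * k) ^ 2 * INR N ^ 2))%R (zrange N)).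
      - apply rsum_le. intros n _. unfold Cminus.
        eapply Rle_trans; [apply Cmod_triangle|]. rewrite Cmod_opp.
        assert (H1 := Hh N (Z.of_nat N) n HN ltac:(lia)).
        assert (H2 := Hh N (- Z.of_nat N - 1)%Z n HN ltac:(lia)). lra.
      - assert (Ec : forall (x : R) (l : list Z), rsum (fun _ => x) l = (INR (length l) * x)%R).
        { intros x l. unfold rsum. induction l as [|y l IH].
          - simpl. ring.
          - simpl map. simpl fold_right. rewrite IH.
            change (length (y :: l)) with (S (length l)). rewrite S_INR. ring. }
        rewrite Ec. unfold zrange. rewrite length_map, length_seq, plus_INR, mult_INR.
        simpl (INR 1). simpl (INR 2).
        assert (Hq : (0 < (c * k) ^ 2)%R) by (apply pow_lt; nra).
        apply Rmult_le_reg_r with ((c * k) ^ 2 * INR N ^ 2)%R.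
        { apply Rmult_lt_0_compat; auto. apply pow_lt; lra. }
        replace (((1 + 1) * INR N + 1) * (2 * / ((c * k) ^ 2 * INR N ^ 2)) *
           ((c * k) ^ 2 * INR N ^ 2))%R with (4 * INR N + 2)%R
          by (field; repeat split; lra).
        replace (6 / (c * k) ^ 2 * / INR N * ((c * k) ^ 2 * INR N ^ 2))%R with (6 * INR N)%R
          by (field; repeat split; lra).
        lra. }
    set (K := (6 / (c * k) ^ 2)%R) in *.
    assert (HK : (0 < K)%R) by (apply Rdiv_lt_0_compat; [lra|apply pow_lt; nra]).
    destruct (nfloor_ex (K / eps)) as [N HN]; [apply Rlt_le, Rdiv_lt_0_compat; auto|].
    exists (S N). intros N' HN'. eapply Rle_trans; [apply Hbox; lia|].
    assert (HI : (K / eps < INR N')%R).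
    { eapply Rlt_le_trans; [apply HN|]. rewrite <- S_INR. apply le_INR; auto. }
    assert (HI0 : (0 < INR N')%R).
    { apply Rlt_trans with (K / eps)%R; auto. apply Rdiv_lt_0_compat; auto. }
    apply Rmult_le_reg_r with (INR N'); auto.
    rewrite Rmult_assoc, Rinv_l, Rmult_1_r by lra.
    apply Rlt_div_l in HI; auto. lra.
Qed.

End Eisenstein.

Section Eisenstein2.
Variables (w1 w2 : C) (L : C -> Prop).
Hypothesis HB : is_basis w1 w2 L.

(** The lattice vectors r with vanishing sums for all z form a group, because the difference for r +
    s splits into those for r at z and for s at z + r. The group contains both generators, by
    symmetry of the basis. *)
Lemma inv_sq_diff_sum r : L r -> forall z, ~ L z -> is_sum L (inv_sq_diff z r) 0.
Proof.
  set (P := fun r => L r /\ forall z, ~ L z -> is_sum L (inv_sq_diff z r) 0).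
  assert (P0 : P 0).
  { split; [eapply lattice_0; eauto|]. intros z _. apply is_sum_0. intros x _.
    unfold inv_sq_diff. replace (z + 0 - x) with (z - x) by ring. ring. }
  assert (Pplus : forall r s, P r -> P s -> P (r + s)).
  { intros r' s [Lr Hr] [Ls Hs]. split; [eapply lattice_plus; eauto|]. intros z Hz.
    replace (RtoC 0) with (0 + 0) by ring.
    eapply is_sum_ext; [|apply is_sum_plus; [apply (Hr z Hz)|apply (Hs (z + r'))]].
    - intros x _. unfold inv_sq_diff. replace (z + r' + s - x) with (z + (r' + s) - x) by ring.
      ring.
    - eapply off_lattice_shift; eauto. }
  assert (Popp : forall r, P r -> P (- r)).
  { intros r' [Lr Hr]. split; [eapply lattice_opp; eauto|]. intros z Hz.
    assert (Hz' : ~ L (z + - r')).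
    { eapply off_lattice_shift; eauto. eapply lattice_opp; eauto. }
    specialize (Hr _ Hz'). apply is_sum_opp in Hr.
    replace (- 0) with (RtoC 0) in Hr by ring.
    eapply is_sum_ext; [|exact Hr]. intros x _. unfold inv_sq_diff.
    replace (z + - r' + r' - x) with (z - x) by ring. ring. }
  assert (Pw1 : P w1).
  { split; [apply (proj2 HB); exists 1%Z, 0%Z; unfold lpoint; ring|].
    intros z Hz. eapply inv_sq_diff_sum_basis; eauto. }
  assert (Pw2 : P w2).
  { split; [apply (proj2 HB); exists 0%Z, 1%Z; unfold lpoint; ring|].
    intros z Hz. eapply inv_sq_diff_sum_basis; [apply basis_swap; eauto|auto]. }
  assert (Pnat : forall w n, P w -> P (RtoC (INR n) * w)).
  { intros w n Hw. induction n as [|n IH].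
    - simpl INR. replace (RtoC 0 * w) with (RtoC 0) by ring. auto.
    - rewrite S_INR, RtoC_plus.
      replace ((RtoC (INR n) + RtoC 1) * w) with (RtoC (INR n) * w + w) by ring. auto. }
  assert (PZ : forall w n, P w -> P (RtoC (IZR n) * w)).
  { intros w n Hw. destruct (Z_lt_le_dec n 0) as [Hn|Hn].
    - replace (RtoC (IZR n) * w) with (- (RtoC (INR (Z.to_nat (- n))) * w)); auto.
      rewrite INR_IZR_INZ, Z2Nat.id, opp_IZR, RtoC_opp by lia. ring.
    - replace (IZR n) with (INR (Z.to_nat n)); auto. rewrite INR_IZR_INZ, Z2Nat.id; auto. }
  intros Hr. apply (proj2 HB) in Hr. destruct Hr as (m & n & ->).
  apply (Pplus _ _ (PZ w1 m Pw1) (PZ w2 n Pw2)).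
Qed.

(** Inverse with value 0 at 0, so that sums over nonzero points run over the whole group and can be
    translated and reflected. *)
Definition iv (x : C) : C := if eq_dec_classical x 0 then 0 else / x.

Lemma iv_0 : iv 0 = 0.
Proof.
  unfold iv. destruct (eq_dec_classical (RtoC 0) 0) as [|n]; [auto|]. destruct (n eq_refl).
Qed.

Lemma iv_neq (x : C) : x <> 0 -> iv x = / x.
Proof. intros H. unfold iv. destruct (eq_dec_classical x 0); [contradiction|auto]. Qed.

Lemma iv_opp (x : C) : iv (- x) = - iv x.
Proof.
  destruct (eq_dec_classical x 0) as [->|H].
  - replace (- 0) with (RtoC 0) by ring. rewrite iv_0. ring.
  - rewrite !iv_neq; auto; [field; auto|].
    intros E. apply H. replace x with (- - x) by ring. rewrite E. ring.
Qed.

Lemma sum_nonzero (f : C -> C) s : f 0 = 0 ->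
  is_sum (nonzero_points L) f s <-> is_sum L f s.
Proof.
  intros H. apply is_sum_extend.
  - intros x [Hx _]; auto.
  - intros x Hx Hn. destruct (eq_dec_classical x 0) as [->|N]; auto.
    exfalso. apply Hn. split; auto.
Qed.

Lemma iv_summable k : (3 <= k)%nat -> exists M, summable L (fun x => Cmod (iv x ^ k)) M.
Proof.
  intros Hk. destruct (min_norm _ _ _ HB) as (rho & Hrho & H).
  destruct (lattice_summable _ _ _ HB) as (M & _ & HM).
  (* The quotient |x| / (1 + |x|) increases with |x|, so [c (1 + |x|) <= |x|] as soon as |x| >=
     [rho]. *)
  set (c := (rho / (1 + rho))%R).
  assert (Hc : (0 < c)%R) by (apply Rdiv_lt_0_compat; lra).
  exists ((/ c) ^ k * M)%R.
  eapply summable_le; [|apply summable_scal; [|exact HM]].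
  - intros x Hx. pose proof (Cmod_ge_0 x) as Hx0. rewrite Cmod_pow.
    destruct (eq_dec_classical x 0) as [->|N].
    { rewrite iv_0, Cmod_0, pow_i by lia. apply Rmult_le_pos.
      - apply pow_le, Rlt_le, Rinv_0_lt_compat, Hc.
      - apply Rlt_le, Rinv_0_lt_compat, pow_lt. lra. }
    rewrite iv_neq by auto. specialize (H x (conj Hx N)).
    apply Rle_trans with ((/ (c * (1 + Cmod x))) ^ k)%R.
    + apply pow_incr. split; [apply Cmod_ge_0|]. apply Cmod_inv_le; [nra|].
      unfold c. apply Rmult_le_reg_r with (1 + rho)%R; [lra|].
      replace (rho / (1 + rho) * (1 + Cmod x) * (1 + rho))%R with (rho * (1 + Cmod x))%R
        by (field; lra). nra.
    + rewrite Rinv_mult, Rpow_mult_distr. apply Rmult_le_compat_l.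
      * apply pow_le, Rlt_le, Rinv_0_lt_compat, Hc.
      * rewrite pow_inv. apply Rinv_le_contravar; [apply pow_lt; lra|].
        apply Rle_pow; [lra|auto].
  - apply pow_le, Rlt_le, Rinv_0_lt_compat, Hc.
Qed.

Lemma is_sum_odd (f : C -> C) s : (forall x, f (- x) = - f x) -> is_sum L f s -> s = 0.
Proof.
  intros Hf Hs.
  assert (Hs' : is_sum L (fun x => f (- x)) s).
  { apply (is_sum_bij L L Copp Copp f); auto.
    - intros x Hx. split; [eapply lattice_opp; eauto|ring].
    - intros x Hx. split; [eapply lattice_opp; eauto|ring]. }
  assert (E : s = - s).
  { apply (is_sum_unique L (fun x => f (- x))); auto.
    eapply is_sum_ext; [|apply is_sum_opp; exact Hs]. intros x _. rewrite Hf; auto. }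
  assert (E2 : 2 * s = 0).
  { replace (2 * s) with (s + s) by ring. rewrite E at 1. ring. }
  replace s with (/ 2 * (2 * s)).
  - rewrite E2. ring.
  - field.
Qed.

(* Eisenstein: expand [E3 E4] as a double sum and split [1 / (p^3 q^4)], [q = p + r], into
   partial fractions. After symmetrizing under [(p, r) -> (q, -r)] only [r^-5 (p^-2 - q^-2)] is
   left of the terms of low order, and its sum over [p] vanishes. *)
Lemma eisenstein_relation z e4 E3 E4 E7 : ~ L z ->
  is_sum (nonzero_points L) (fun x => / x ^ 4) e4 ->
  is_sum L (fun x => (/ (z - x)) ^ 3) E3 ->
  is_sum L (fun x => (/ (z - x)) ^ 4) E4 ->
  is_sum L (fun x => (/ (z - x)) ^ 7) E7 ->
  E7 = E3 * (E4 + 2 * e4).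
Proof.
  intros Hz He4 H3 H4 H7.
  destruct (off_lattice_summable _ _ _ HB z 3 Hz ltac:(lia)) as [M3 S3].
  destruct (off_lattice_summable _ _ _ HB z 4 Hz ltac:(lia)) as [M4 S4].
  destruct (off_lattice_summable _ _ _ HB z 7 Hz ltac:(lia)) as [M7 S7].
  destruct (iv_summable 3 ltac:(lia)) as [N3 T3].
  destruct (iv_summable 4 ltac:(lia)) as [N4 T4].
  assert (Hi4 : is_sum L (fun r => iv r ^ 4) e4).
  { apply sum_nonzero; [rewrite iv_0; ring|]. eapply is_sum_ext; [|exact He4].
    intros x [_ Hx]. simpl. rewrite iv_neq by auto. field. auto. }
  destruct (ex_is_sum _ _ _ T3) as (s3 & Hi3 & _).
  assert (Es3 : s3 = 0).
  { apply (is_sum_odd (fun r => iv r ^ 3)); auto. intros x. rewrite iv_opp. ring. }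
  subst s3.
  set (LL := cross L L).
  (* Indicator of r = 0: it writes the diagonal part [E7] of the double sum as a sum over the same
     pairs. *)
  set (d0 := fun r : C => if eq_dec_classical r 0 then RtoC 1 else 0).
  assert (Hd0 : is_sum L d0 1).
  { apply is_sum_net. intros eps He. exists (RtoC 0 :: nil).
    split; [repeat constructor; auto|]. split.
    { constructor; [eapply lattice_0; eauto|constructor]. }
    intros l Hn Hf Hi. destruct (incl_split (RtoC 0 :: nil) l) as (l1 & N1 & P1); auto.
    { repeat constructor; auto. }
    rewrite (lsum_perm _ _ _ P1), lsum_app, (lsum_zero d0 l1).
    - unfold lsum, d0. simpl.
      destruct (eq_dec_classical (RtoC 0) 0) as [|n]; [|destruct (n eq_refl)].
      replace (1 + 0 + 0 - 1) with (RtoC 0) by ring. rewrite Cmod_0. auto.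
    - intros x Hx. unfold d0. destruct (eq_dec_classical x 0) as [->|]; auto.
      simpl in N1. inversion N1; subst. contradiction. }
  assert (Sd0 : summable L (fun r => Cmod (d0 r)) 1).
  { intros l Hn _. clear - Hn.
    assert (Hz : forall l, ~ In (RtoC 0) l -> rsum (fun r => Cmod (d0 r)) l = 0%R).
    { clear. intros l. unfold rsum. induction l as [|x l IH]; simpl; intros H; auto.
      rewrite IH by auto. unfold d0. destruct (eq_dec_classical x 0) as [->|].
      - exfalso; auto.
      - rewrite Cmod_0. ring. }
    induction Hn as [|x l Hx Hn IH].
    - unfold rsum; simpl; lra.
    - change (rsum (fun r => Cmod (d0 r)) (x :: l))
        with (Cmod (d0 x) + rsum (fun r => Cmod (d0 r)) l)%R.
      unfold d0 at 1. destruct (eq_dec_classical x 0) as [->|].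
      + rewrite Hz by auto. rewrite Cmod_1. lra.
      + rewrite Cmod_0. lra. }
  set (p := fun x : C * C => / (z - fst x)).
  set (q := fun x : C * C => / (z - (fst x - snd x))).
  set (i := fun x : C * C => iv (snd x)).
  assert (Lm : forall x y, L x -> L y -> L (x - y)) by (intros; eapply lattice_minus; eauto).
  assert (Lp : forall x y, L x -> L y -> L (x + y)) by (intros; eapply lattice_plus; eauto).
  assert (Lo : forall x, L x -> L (- x)) by (intros; eapply lattice_opp; eauto).
  (* The pair of poles (x, y) is reindexed by (x, r) with y = x - r. *)
  assert (X0 : is_sum LL (fun x => p x ^ 3 * q x ^ 4) (E3 * E4)).
  { apply (is_sum_bij LL LL (fun x => (fst x, fst x - snd x)) (fun x => (fst x, fst x - snd x))
      (fun x => (/ (z - fst x)) ^ 3 * (/ (z - snd x)) ^ 4)).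
    - intros [x y] [Hx Hy]; simpl in *. split; [split; simpl; auto|f_equal; ring].
    - intros [x y] [Hx Hy]; simpl in *. split; [split; simpl; auto|f_equal; ring].
    - apply (is_sum_prod L L (fun x => (/ (z - x)) ^ 3) (fun x => (/ (z - x)) ^ 4) M3 M4);
        auto. }
  assert (shift : forall f s, is_sum LL f s ->
            is_sum LL (fun x => f (fst x - snd x, snd x)) s).
  { intros f s. apply (is_sum_bij LL LL (fun x => (fst x - snd x, snd x))
      (fun x => (fst x + snd x, snd x))).
    - intros [x y] [Hx Hy]; simpl in *. split; [split; simpl; auto|f_equal; ring].
    - intros [x y] [Hx Hy]; simpl in *. split; [split; simpl; auto|f_equal; ring]. }
  assert (X1 : is_sum LL (fun x => p x ^ 7 * d0 (snd x)) (E7 * 1)).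
  { apply (is_sum_prod L L (fun x => (/ (z - x)) ^ 7) d0 M7 1); auto. }
  assert (X2 : is_sum LL (fun x => p x ^ 3 * i x ^ 4) (E3 * e4)).
  { apply (is_sum_prod L L (fun x => (/ (z - x)) ^ 3) (fun r => iv r ^ 4) M3 N4); auto. }
  assert (X3 : is_sum LL (fun x => q x ^ 4 * i x ^ 3) (E4 * 0)).
  { apply (shift (fun x => p x ^ 4 * i x ^ 3)).
    apply (is_sum_prod L L (fun x => (/ (z - x)) ^ 4) (fun r => iv r ^ 3) M4 N3); auto. }
  assert (X4 : is_sum LL (fun x => q x ^ 3 * i x ^ 4) (E3 * e4)).
  { apply (shift (fun x => p x ^ 3 * i x ^ 4)); auto. }
  (* The partial fractions of [p^3 q^4] in which p or q has exponent 1 or 2; these cannot be summed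
     separately. The other terms, [p^3 i^4 - q^4 i^3 - 3 q^3 i^4], can, and account for [u]. *)
  set (U := fun x => - (4) * (i x ^ 5 * p x ^ 2) - 6 * (i x ^ 5 * q x ^ 2)
                     + 10 * (i x ^ 6 * (p x - q x))).
  set (u := E3 * E4 - E7 * 1 - E3 * e4 + E4 * 0 + 3 * (E3 * e4)).
  assert (HU : is_sum LL U u).
  { unfold u. eapply is_sum_ext;
      [|apply is_sum_plus; [apply is_sum_plus; [apply is_sum_minus;
        [apply is_sum_minus; [exact X0|exact X1]|exact X2]|exact X3]
        |apply is_sum_scal; exact X4]].
    intros [x r] [Hx Hr]. simpl in Hx, Hr. unfold U, p, q, i, d0. cbn [fst snd].
    assert (Np : z - x <> 0) by (eapply off_lattice_neq; eauto).
    destruct (eq_dec_classical r 0) as [->|Nr].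
    - rewrite iv_0. replace (x - 0) with x by ring. field. auto.
    - rewrite iv_neq by auto.
      assert (Nq : z - (x - r) <> 0) by (eapply off_lattice_neq; eauto).
      field. auto. }
  (* This involution exchanges p and q and changes the sign of i, so that the terms with [i^6]
     cancel against their images. *)
  assert (HU' : is_sum LL (fun x => U (fst x - snd x, - snd x)) u).
  { apply (is_sum_bij LL LL (fun x => (fst x - snd x, - snd x))
      (fun x => (fst x - snd x, - snd x))); auto.
    - intros [x y] [Hx Hy]; simpl in *. split; [split; simpl; auto|f_equal; ring].
    - intros [x y] [Hx Hy]; simpl in *. split; [split; simpl; auto|f_equal; ring]. }
  assert (Hu : is_sum LL (fun x => 2 * i x ^ 5 * (p x ^ 2 - q x ^ 2)) (u + u)).
  { eapply is_sum_ext; [|apply is_sum_plus; [exact HU|exact HU']].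
    intros [x r] _. unfold U, p, q, i. cbn [fst snd].
    replace (x - r - - r) with x by ring. rewrite iv_opp. ring. }
  assert (Hrow : is_sum L (fun _ => 0) (u + u)).
  { eapply (is_sum_rows L L); [|exact Hu]. intros r Hr. cbn [fst snd].
    replace (RtoC 0) with (2 * iv r ^ 5 * 0) by ring.
    eapply is_sum_ext; [|apply is_sum_scal; apply (inv_sq_diff_sum r Hr z Hz)].
    intros x _. unfold inv_sq_diff, p, q, i. cbn [fst snd].
    replace (z + r - x) with (z - (x - r)) by ring. reflexivity. }
  assert (Eu : u + u = 0).
  { apply (is_sum_unique L (fun _ => 0)); auto. apply is_sum_0. auto. }
  assert (Eu' : u = 0).
  { replace u with (/ 2 * (u + u)).
    - rewrite Eu. ring.
    - field. }
  unfold u in Eu'. 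
  replace E7 with (E3 * (E4 + 2 * e4) -
     (E3 * E4 - E7 * 1 - E3 * e4 + E4 * 0 + 3 * (E3 * e4))) by ring.
  rewrite Eu'. ring.
Qed.

End Eisenstein2.

(** * Values of power series *)

(** The weighted l1 norm of the disc of radius r: it is submultiplicative and controls unconditional
    convergence for |z| <= r. *)
Definition absb (f : nat -> C) (r M : R) : Prop :=
  forall n, (rsum (fun k => Cmod (f k) * r ^ k)%R (seq 0 n) <= M)%R.

Definition val (f : nat -> C) (z v : C) : Prop :=
  is_sum (fun _ : nat => True) (fun k => f k * z ^ k) v.

Lemma absb_summable f r M : (0 <= r)%R -> absb f r M ->
  summable (fun _ : nat => True) (fun k => Cmod (f k) * r ^ k)%R M.
Proof.
  intros Hr H. apply summable_nat; auto.
  intros n. apply Rmult_le_pos; [apply Cmod_ge_0|apply pow_le; auto].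
Qed.

Lemma absb_pos f r M : absb f r M -> (0 <= M)%R.
Proof. intros H. apply (H O). Qed.

Lemma absb_val_summable f r M z : (Cmod z <= r)%R -> absb f r M ->
  summable (fun _ : nat => True) (fun k => Cmod (f k * z ^ k)) M.
Proof.
  intros Hz H. pose proof (Cmod_ge_0 z).
  eapply summable_le; [|apply absb_summable; [|exact H]]; [|lra].
  intros k _. rewrite Cmod_mult, Cmod_pow.
  apply Rmult_le_compat_l; [apply Cmod_ge_0|]. apply pow_incr; lra.
Qed.

Lemma ex_val f r M z : (Cmod z <= r)%R -> absb f r M -> exists v, val f z v.
Proof.
  intros Hz H. destruct (ex_is_sum _ _ _ (absb_val_summable f r M z Hz H)) as (v & Hv & _).
  exists v. exact Hv.
Qed.

Lemma val_unique f z u v : val f z u -> val f z v -> u = v.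
Proof. apply is_sum_unique. Qed.

Lemma absb_coef f r M k : (0 <= r)%R -> absb f r M -> (Cmod (f k) * r ^ k <= M)%R.
Proof.
  intros Hr H. apply absb_summable in H; auto. specialize (H (k :: nil)).
  unfold rsum in H. simpl in H. rewrite Rplus_0_r in H. apply H.
  - repeat constructor; auto.
  - apply Forall_True.
Qed.

Fixpoint antidiag (k : nat) : list (nat * nat) :=
  match k with
  | O => (O, O) :: nil
  | S m => (O, S m) :: map (fun p => (S (fst p), snd p)) (antidiag m)
  end.

Lemma in_antidiag k p : In p (antidiag k) <-> (fst p + snd p = k)%nat.
Proof.
  revert p. induction k as [|k IH]; intros [i j]; simpl.
  - split; [intros [E|[]]; injection E as <- <-; reflexivity|].
    intros E. left. f_equal; lia.
  - rewrite in_map_iff. split.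
    + intros [E|([i' j'] & E & H)].
      * injection E as <- <-. reflexivity.
      * apply IH in H. simpl in *. injection E as <- <-. lia.
    + intros E. destruct i as [|i]; [left; f_equal; lia|].
      right. exists (i, j). split; auto. apply IH. simpl. lia.
Qed.

Lemma NoDup_antidiag k : NoDup (antidiag k).
Proof.
  induction k as [|k IH]; simpl.
  - repeat constructor; auto.
  - constructor.
    + rewrite in_map_iff. intros (p & E & _). discriminate.
    + apply (NoDup_map_inj (fun _ => True)); auto; [|apply Forall_True].
      intros [i j] [i' j'] _ _ E. simpl in E. congruence.
Qed.

Lemma smul_antidiag (f g : series CC) k :
  smul f g k = lsum (fun p => f (fst p) * g (snd p)) (antidiag k).
Proof.
  revert f. induction k as [|k IH]; intros f.
  - change (smul f g 0%nat) with (f O * g O : C). unfold lsum. simpl. ring.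
  - change (smul f g (S k)) with (f O * g (S k) + smul (tl f) g k : C).
    rewrite (IH (tl f)).
    change (antidiag (S k)) with ((O, S k) :: map (fun p => (S (fst p), snd p)) (antidiag k)).
    change (lsum (fun p => f (fst p) * g (snd p))
      ((O, S k) :: map (fun p => (S (fst p), snd p)) (antidiag k)))
      with (f O * g (S k) + lsum (fun p => f (fst p) * g (snd p))
         (map (fun p => (S (fst p), snd p)) (antidiag k))).
    rewrite lsum_map. reflexivity.
Qed.

Lemma is_sum_finite {T : Type} (A : T -> Prop) (f : T -> C) l :
  NoDup l -> (forall x, A x <-> In x l) -> is_sum A f (lsum f l).
Proof.
  intros Hn HA. apply is_sum_net. intros eps He. exists l. split; [|split]; auto.
  - apply Forall_forall. intros x Hx. apply HA, Hx.
  - intros l' Hn' Hf Hi.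
    assert (P : Permutation l l').
    { apply NoDup_Permutation; auto. intros x. split; [apply Hi|].
      rewrite Forall_forall in Hf. intros Hx. apply HA, Hf, Hx. }
    rewrite (lsum_perm _ _ _ P). replace (lsum f l' - lsum f l') with (RtoC 0) by ring.
    rewrite Cmod_0. auto.
Qed.

(** The double series of products, collected along antidiagonals. *)
Lemma val_mul (f g : series CC) r M N z u v : (Cmod z <= r)%R ->
  absb f r M -> absb g r N -> val f z u -> val g z v -> val (f * g)%A z (u * v).
Proof.
  intros Hz Hf Hg Hu Hv.
  pose proof (absb_val_summable f r M z Hz Hf) as SF.
  pose proof (absb_val_summable g r N z Hz Hg) as SG.
  pose proof (is_sum_prod _ _ _ _ M N u v SF SG Hu Hv) as H.
  eapply (is_sum_fibers _ _ (fun p => (fst p + snd p)%nat)); [| |exact H].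
  - auto.
  - intros k _. rewrite coef_mul, smul_antidiag.
    rewrite Cmult_comm, <- lsum_scal.
    rewrite (lsum_ext _ (fun p => f (fst p) * z ^ fst p * (g (snd p) * z ^ snd p))).
    + apply is_sum_finite; [apply NoDup_antidiag|].
      intros p. rewrite in_antidiag. unfold cross. tauto.
    + intros p Hp. apply in_antidiag in Hp. rewrite <- Hp, Cpow_add_r. ring.
Qed.

Lemma absb_mul (f g : series CC) r M N : (0 <= r)%R ->
  absb f r M -> absb g r N -> absb (f * g)%A r (M * N).
Proof.
  intros Hr Hf Hg n.
  pose proof (summable_prod _ _ (fun k => Cmod (f k) * r ^ k)%R (fun k => Cmod (g k) * r ^ k)%R
    M N ltac:(intros; apply Rmult_le_pos; [apply Cmod_ge_0|apply pow_le; auto])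
    ltac:(intros; apply Rmult_le_pos; [apply Cmod_ge_0|apply pow_le; auto])
    (absb_summable f r M Hr Hf) (absb_summable g r N Hr Hg)) as H.
  set (h := fun p : nat * nat => (Cmod (f (fst p)) * r ^ fst p *
                                  (Cmod (g (snd p)) * r ^ snd p))%R) in *.
  set (l := flat_map antidiag (seq 0 n)).
  apply Rle_trans with (rsum h l).
  - unfold l. induction n as [|n IH]; [unfold rsum; simpl; lra|].
    rewrite seq_S_end, flat_map_app, !rsum_app. apply Rplus_le_compat; auto.
    simpl flat_map. rewrite app_nil_r. unfold rsum at 1. simpl map. simpl fold_right.
    rewrite Rplus_0_r.
    change ((f * g)%A n) with (smul f g n). rewrite smul_antidiag.
    apply Rle_trans with (rsum (fun p => Cmod (f (fst p) * g (snd p))) (antidiag n) * r ^ n)%R.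
    { apply Rmult_le_compat_r; [apply pow_le; auto|]. apply lsum_le. }
    rewrite Rmult_comm, <- rsum_scal. apply rsum_le. intros p Hp.
    apply in_antidiag in Hp. unfold h. rewrite <- Hp, Cmod_mult, pow_add. right. ring.
  - apply H; [|apply Forall_forall; intros p _; split; auto].
    unfold l. clear. induction n as [|n IH]; [constructor|].
    rewrite seq_S_end, flat_map_app. simpl flat_map at 2. rewrite app_nil_r.
    apply NoDup_app; auto using NoDup_antidiag.
    intros p Hp Hp'. apply in_antidiag in Hp'. apply in_flat_map in Hp.
    destruct Hp as (k & Hk & Hp). apply in_antidiag in Hp. apply in_seq in Hk. lia.
Qed.

Lemma val_add (f g : series CC) z u v : val f z u -> val g z v -> val (f + g)%A z (u + v).
Proof.
  intros Hu Hv. eapply is_sum_ext; [|apply (is_sum_plus _ _ _ _ _ Hu Hv)].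
  intros k _. simpl. ring.
Qed.

Lemma val_sub (f g : series CC) z u v : val f z u -> val g z v -> val (f - g)%A z (u - v).
Proof.
  intros Hu Hv. eapply is_sum_ext; [|apply (is_sum_minus _ _ _ _ _ Hu Hv)].
  intros k _. simpl. ring.
Qed.

Lemma val_zero_beyond (f : nat -> C) z n : (forall k, (n <= k)%nat -> f k = 0) ->
  val f z (lsum (fun k => f k * z ^ k) (seq 0 n)).
Proof.
  intros H. apply (is_sum_extend (fun k => In k (seq 0 n))); auto.
  - intros k _ Hk. rewrite H; [ring|]. rewrite in_seq in Hk. lia.
  - apply is_sum_finite; [apply seq_NoDup|tauto].
Qed.

Lemma val_X z : val (@sX CC) z z.
Proof.
  pose proof (val_zero_beyond (@sX CC) z 2) as H.
  replace z with (lsum (fun k => (@sX CC) k * z ^ k) (seq 0 2)) at 2.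
  - apply H. intros [|[|k]] Hk; try lia. reflexivity.
  - unfold lsum. simpl. change (sX 0%nat) with (RtoC 0). change (sX 1%nat) with (RtoC 1). ring.
Qed.

Lemma val_cst (c z : C) : val (@cst CC c) z c.
Proof.
  pose proof (val_zero_beyond (@cst CC c) z 1) as H.
  replace c with (lsum (fun k => (@cst CC c) k * z ^ k) (seq 0 1)) at 2.
  - apply H. intros [|k] Hk; try lia. reflexivity.
  - unfold lsum. simpl. change (@cst CC c 0%nat) with c. ring.
Qed.

Lemma absb_zero_beyond (f : nat -> C) r n : (0 <= r)%R ->
  (forall k, (n <= k)%nat -> f k = 0) ->
  absb f r (rsum (fun k => Cmod (f k) * r ^ k)%R (seq 0 n)).
Proof.
  intros Hr H m.
  assert (E : forall j, rsum (fun k => Cmod (f k) * r ^ k)%R (seq 0 (n + j)) =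
                        rsum (fun k => Cmod (f k) * r ^ k)%R (seq 0 n)).
  { induction j as [|j IH]; [rewrite Nat.add_0_r; auto|].
    rewrite Nat.add_succ_r, seq_S_end, rsum_app, IH. unfold rsum at 2. simpl.
    rewrite H by lia. rewrite Cmod_0. ring. }
  rewrite <- (E m). apply rsum_incl; try apply seq_NoDup.
  - intros k Hk. apply in_seq in Hk. apply in_seq. lia.
  - intros k _. apply Rmult_le_pos; [apply Cmod_ge_0|apply pow_le; auto].
Qed.

Lemma absb_X r : (0 <= r)%R -> exists M, absb (@sX CC) r M.
Proof.
  intros Hr. eexists. apply (absb_zero_beyond _ r 2); auto.
  intros [|[|k]] Hk; try lia; reflexivity.
Qed.

Lemma absb_cst (c : C) r : (0 <= r)%R -> exists M, absb (@cst CC c) r M.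
Proof.
  intros Hr. eexists. apply (absb_zero_beyond _ r 1); auto.
  intros [|k] Hk; try lia; reflexivity.
Qed.

Lemma absb_plus (f g : nat -> C) r M N : (0 <= r)%R -> absb f r M -> absb g r N ->
  absb (fun k => f k + g k) r (M + N).
Proof.
  intros Hr Hf Hg n. specialize (Hf n). specialize (Hg n).
  eapply Rle_trans; [|apply Rplus_le_compat; [exact Hf|exact Hg]].
  generalize (seq 0 n). clear - Hr. intros l.
  induction l as [|k l IH]; unfold rsum in *; simpl; [lra|].
  pose proof (Cmod_triangle (f k) (g k)). pose proof (pow_le r k Hr). nra.
Qed.

Lemma is_sum_point (k : nat) (c : C) :
  is_sum (fun _ : nat => True) (fun j => if Nat.eq_dec j k then c else 0) c.
Proof.
  apply (is_sum_extend (fun j => In j (k :: nil))); auto.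
  - intros j _ Hj. destruct (Nat.eq_dec j k) as [->|]; auto. exfalso. apply Hj. left; auto.
  - assert (E : lsum (fun j => if Nat.eq_dec j k then c else 0) (k :: nil) = c).
    { unfold lsum. simpl. destruct (Nat.eq_dec k k); [ring|tauto]. }
    pose proof (is_sum_finite (fun j => In j (k :: nil))
      (fun j => if Nat.eq_dec j k then c else 0) (k :: nil)) as H.
    rewrite E in H. apply H; [repeat constructor; auto|tauto].
Qed.

(* The lowest nonzero coefficient would dominate near the origin. *)
Lemma series_identity (q : nat -> C) r M : (0 < r)%R -> absb q r M ->
  (forall z : C, z <> 0 -> (Cmod z <= r)%R -> val q z 0) -> forall k, q k = 0.
Proof.
  intros Hr HM H k. induction k as [k IH] using lt_wf_ind.
  pose proof (absb_pos _ _ _ HM) as HM0.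
  assert (Hb : forall t : R, (0 < t <= r)%R -> (Cmod (q k) <= t * (M / r ^ S k))%R).
  { intros t Ht. set (z := RtoC t).
    assert (Hz : z <> 0) by (intros E; apply RtoC_inj in E; lra).
    assert (Hcz : Cmod z = t) by (unfold z; rewrite Cmod_R; apply Rabs_pos_eq; lra).
    specialize (H z Hz ltac:(lra)).
    assert (Hk : is_sum (fun j => j <> k) (fun j => q j * z ^ j) (- (q k * z ^ k))).
    { assert (E : is_sum (fun _ : nat => True)
         (fun j => q j * z ^ j - (if Nat.eq_dec j k then q k * z ^ k else 0)) (- (q k * z ^ k))).
      { replace (- (q k * z ^ k)) with (0 - (q k * z ^ k)) by ring.
        apply is_sum_minus; [exact H|].
        apply is_sum_point. }
      apply (is_sum_extend (fun j => j <> k)) in E; auto.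
      - eapply is_sum_ext; [|exact E]. intros j Hj. simpl.
        destruct (Nat.eq_dec j k); [tauto|]. ring.
      - intros j _ Hj. destruct (Nat.eq_dec j k) as [->|]; [ring|tauto]. }
    assert (Hs : summable (fun j => j <> k) (fun j => Cmod (q j * z ^ j))
                   ((t / r) ^ S k * M)).
    { eapply summable_le; [|apply summable_scal; [|
        apply (summable_inj _ (fun _ => True) (fun j => j)
          (fun j => (Cmod (q j) * r ^ j)%R) M); [| |apply absb_summable; [lra|exact HM]]]];
        auto.
      - intros j Hj. simpl. rewrite Cmod_mult, Cmod_pow, Hcz.
        destruct (Nat.lt_ge_cases j k) as [Hjk|Hjk].
        { rewrite IH by auto. rewrite Cmod_0, !Rmult_0_l, Rmult_0_r. lra. }
        replace (t ^ j)%R with ((t / r) ^ j * r ^ j)%R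
          by (rewrite <- Rpow_mult_distr; f_equal; field; lra).
        replace (Cmod (q j) * ((t / r) ^ j * r ^ j))%R
          with ((t / r) ^ j * (Cmod (q j) * r ^ j))%R by ring.
        apply Rmult_le_compat_r.
        + apply Rmult_le_pos; [apply Cmod_ge_0|apply pow_le; lra].
        + assert (Htr : (0 <= t / r <= 1)%R).
          { split; [apply Rlt_le, Rdiv_lt_0_compat; lra|]. apply Rle_div_l; lra. }
          change (t / r * (t / r) ^ k)%R with ((t / r) ^ S k)%R.
          set (d := (j - S k)%nat). replace j with (S k + d)%nat by lia. rewrite pow_add.
          assert (((t / r) ^ d <= 1)%R) by (rewrite <- (pow1 d); apply pow_incr; lra).
          assert (0 <= (t / r) ^ S k)%R by (apply pow_le; lra). nra.
      - apply pow_le, Rlt_le, Rdiv_lt_0_compat; lra. }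
    pose proof (is_sum_le _ _ _ _ Hs Hk) as Hle.
    rewrite Cmod_opp, Cmod_mult, Cmod_pow, Hcz in Hle.
    assert (Htk : (0 < t ^ k)%R) by (apply pow_lt; lra).
    apply Rmult_le_reg_r with (t ^ k)%R; auto.
    eapply Rle_trans; [exact Hle|]. right. unfold Rdiv. rewrite Rpow_mult_distr, pow_inv.
    simpl. ring. }
  apply Cmod_eq_0. apply Rle_antisym; [|apply Cmod_ge_0].
  apply le_epsilon. intros eps He. rewrite Rplus_0_l.
  set (K := (M / r ^ S k)%R) in *.
  assert (HK : (0 <= K)%R).
  { apply Rmult_le_pos; auto. apply Rlt_le, Rinv_0_lt_compat, pow_lt; auto. }
  set (t := Rmin r (eps / (K + 1))).
  assert (Ht : (0 < t)%R) by (apply Rmin_glb_lt; auto; apply Rdiv_lt_0_compat; lra).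
  eapply Rle_trans; [apply (Hb t); split; auto; apply Rmin_l|].
  apply Rle_trans with (eps / (K + 1) * K)%R.
  - apply Rmult_le_compat_r; auto. apply Rmin_r.
  - apply Rmult_le_reg_r with (K + 1)%R; [lra|].
    replace (eps / (K + 1) * K * (K + 1))%R with (eps * K)%R by (field; lra). nra.
Qed.

(** * Powers of the geometric series *)

Section Geometric.
Variable B : calg.
Add Ring B_ring4 : (calg_ring B) (morphism (zr_morph B), constants [zr_cst]).
Add Ring SB_ring4 : (calg_ring (series B)) (morphism (zr_morph (series B)), constants [zr_cst]).
Local Open Scope calg_scope.

(** X / (1 - X). At X = z/x its k-th power is [(z / (x - z))^k], up to sign the term [(z - x)^-k] of
    [E_k] times [z^k]. *)
Definition geom : series B := fun n => match n with O => 0 | S _ => 1 end.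

Lemma geom_X : geom = sX * (1 + geom).
Proof.
  apply functional_extensionality. intros n. rewrite smul_X.
  destruct n as [|[|n]]; [reflexivity| |].
  - change (@aone B = 1 + 0). ring.
  - change (@aone B = 0 + 1). ring.
Qed.

(** The derivative of X / (1 - X), found without division: 1 + [geom] is inverse to 1 - X. *)
Lemma euler_geom : euler geom = geom + geom * geom.
Proof.
  pose proof (euler_derivation B) as HD.
  assert (E : euler geom = sX * (1 + geom) + sX * euler geom).
  { transitivity (euler (sX * (1 + geom))); [rewrite <- geom_X; reflexivity|].
    rewrite (d_mul _ HD), (d_add _ HD), euler_X.
    rewrite (euler_const B 1 : euler 1 = 0). ring. }
  assert (I : (1 - sX) * (1 + geom) = 1).
  { transitivity (1 + geom - sX * (1 + geom)); [ring|]. rewrite <- geom_X. ring. }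
  transitivity ((1 - sX) * (1 + geom) * euler geom); [rewrite I; ring|].
  transitivity ((1 + geom) * (euler geom - sX * euler geom)); [ring|].
  rewrite E at 1. transitivity (sX * (1 + geom) * (1 + geom)); [ring|].
  rewrite <- geom_X. ring.
Qed.

Definition geom_pow (k : nat) : series B := apow (series B) geom k.

(** The series form of the rule that differentiating [(z - x)^-k] gives -k times the next power.
    Read on coefficients it replaces binomial formulas. *)
Lemma geom_pow_shifted k : (1 <= k)%nat ->
  shifted _ euler (Z.of_nat k) (geom_pow k) = zr (Z.of_nat k) * geom_pow (S k).
Proof.
  intros Hk. unfold shifted, geom_pow.
  rewrite (d_apow (series B) euler (euler_derivation B)), euler_geom.
  destruct k as [|k]; [lia|]. replace (S k - 1)%nat with k by lia. cbn [apow]. ring.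
Qed.

Lemma geom_pow_coef k j : (1 <= k)%nat ->
  zr (Z.of_nat k) * geom_pow (S k) j = (zr (Z.of_nat j) - zr (Z.of_nat k)) * geom_pow k j.
Proof.
  intros Hk. rewrite <- coef_zr, <- geom_pow_shifted by auto. apply coef_shifted.
Qed.

Lemma geom_pow_low k j : (3 <= k)%nat -> (j < 3)%nat -> geom_pow k j = 0.
Proof.
  intros Hk Hj. induction k as [|k IH]; [lia|].
  apply (zr_eq_0 B (Z.of_nat k)); [lia|]. rewrite geom_pow_coef by lia.
  destruct (Nat.eq_dec k 2) as [->|N].
  - destruct j as [|[|[|j]]]; try lia.
    + unfold geom_pow. simpl. change (geom 0%nat) with (@azero B). ring.
    + unfold geom_pow. simpl. unfold tl. change (geom 0%nat) with (@azero B). simpl. ring.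
    + simpl. ring.
  - rewrite IH by lia. ring.
Qed.

End Geometric.

Arguments geom {B}. Arguments geom_pow {B}.

Lemma pow_half_sum n : (rsum (fun k => (/ 2) ^ S k)%R (seq 0 n) <= 1 - (/ 2) ^ n)%R.
Proof.
  induction n as [|n IH]; [unfold rsum; simpl; lra|].
  rewrite seq_S_end, rsum_app. unfold rsum at 2. simpl in *. lra.
Qed.

Lemma absb_geom : absb (@geom CC) (/ 2) 1.
Proof.
  intros n. destruct n as [|n]; [unfold rsum; simpl; lra|].
  change (seq 0 (S n)) with (0%nat :: seq 1 n). rewrite <- seq_shift.
  change (rsum (fun k => Cmod (@geom CC k) * (/ 2) ^ k)%R (0%nat :: map S (seq 0 n)))
    with (Cmod (@geom CC O) * (/ 2) ^ 0 + rsum (fun k => Cmod (@geom CC k) * (/ 2) ^ k)%R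
            (map S (seq 0 n)))%R.
  rewrite rsum_map. change (@geom CC O) with (RtoC 0). rewrite Cmod_0.
  apply Rle_trans with (0 + rsum (fun k => (/ 2) ^ S k) (seq 0 n))%R.
  - rewrite Rmult_0_l. apply Rplus_le_compat_l. apply rsum_le. intros k _.
    change (@geom CC (S k)) with (RtoC 1). rewrite Cmod_1. lra.
  - pose proof (pow_half_sum n). assert (0 < (/ 2) ^ n)%R by (apply pow_lt; lra). lra.
Qed.

Lemma small_neq_1 (w : C) : (Cmod w <= / 2)%R -> 1 - w <> 0.
Proof.
  intros H E. assert (E' : w = 1) by (replace w with (1 - (1 - w)) by ring; rewrite E; ring).
  rewrite E', Cmod_1 in H. lra.
Qed.

(** The identity [geom_X] gives [v = w (1 + v)] for the value v, which determines it. *)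
Lemma val_geom (w : C) : (Cmod w <= / 2)%R -> val (@geom CC) w (w / (1 - w)).
Proof.
  intros Hw. destruct (ex_val (@geom CC) _ _ w Hw absb_geom) as [v Hv].
  pose proof (small_neq_1 w Hw) as N.
  destruct (absb_X (/ 2) ltac:(lra)) as [MX HX].
  destruct (absb_cst (RtoC 1) (/ 2) ltac:(lra)) as [M1 H1].
  assert (H : val (sX * (cst (A := CC) (RtoC 1) + geom))%A w (w * (1 + v))).
  { eapply val_mul; [exact Hw|exact HX| |apply val_X|apply val_add; [apply val_cst|exact Hv]].
    apply (absb_plus (cst (A := CC) (RtoC 1)) (@geom CC)); [lra|exact H1|exact absb_geom]. }
  change (cst (A := CC) (RtoC 1)) with (@aone (series CC)) in H.
  rewrite <- geom_X in H. pose proof (val_unique _ _ _ _ Hv H) as E.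
  replace (w / (1 - w)) with v; auto.
  replace v with ((v - v * w) / (1 - w)) at 1 by (field; auto).
  rewrite E at 1. field. auto.
Qed.

Lemma absb_geom_pow k : exists M, absb (@geom_pow CC k) (/ 2) M.
Proof.
  induction k as [|k [M HM]].
  - apply (absb_cst (RtoC 1)). lra.
  - exists (1 * M)%R. apply (absb_mul (@geom CC) (geom_pow k)); auto using absb_geom. lra.
Qed.

Lemma val_geom_pow k (w : C) : (Cmod w <= / 2)%R -> val (@geom_pow CC k) w ((w / (1 - w)) ^ k).
Proof.
  intros Hw. induction k as [|k IH].
  - apply (val_cst (RtoC 1)).
  - destruct (absb_geom_pow k) as [M HM]. simpl.
    apply (val_mul (@geom CC) (geom_pow k) (/ 2) 1 M); auto using absb_geom, val_geom.
Qed.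

(** * Expansions of the lattice sums at the origin *)

Section LatticeSeries.
Variables (w1 w2 : C) (L : C -> Prop).
Hypothesis HB : is_basis w1 w2 L.
Variable rho : R.
Hypothesis Hrho : (0 < rho)%R.
Hypothesis Hmin : forall x, nonzero_points L x -> (rho <= Cmod x)%R.

(** One bound for all k, because [(rho / |x|)^k] decreases in k. *)
Lemma inv_pow_summable : exists M, (0 <= M)%R /\ forall k, (3 <= k)%nat ->
  summable (nonzero_points L) (fun x => Cmod ((/ x) ^ k) * rho ^ k)%R M.
Proof.
  destruct (iv_summable _ _ _ HB 3 ltac:(lia)) as [M HM].
  assert (HM' : summable (nonzero_points L) (fun x => Cmod ((/ x) ^ 3)) M).
  { intros l Hn Hl. eapply Rle_trans; [|apply (HM l Hn)].
    - apply rsum_le. intros x Hx. rewrite Forall_forall in Hl.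
      rewrite iv_neq by apply Hl, Hx. lra.
    - eapply Forall_impl; [|exact Hl]. intros x [Hx _]; auto. }
  assert (HM0 : (0 <= M)%R) by (apply (HM nil); constructor).
  assert (Hr3 : (0 <= rho ^ 3)%R) by (apply pow_le; lra).
  exists (rho ^ 3 * M)%R. split; [apply Rmult_le_pos; auto|]. intros k Hk.
  eapply summable_le; [|apply summable_scal; [exact Hr3|exact HM']].
  intros x Hx. pose proof (Hmin x Hx) as Hm. destruct Hx as [_ Hx0].
  rewrite !Cmod_pow, Cmod_inv by auto.
  replace k with (3 + (k - 3))%nat by lia. rewrite !pow_add.
  assert (H1 : ((/ Cmod x) ^ (k - 3) * rho ^ (k - 3) <= 1)%R).
  { rewrite <- Rpow_mult_distr, <- (pow1 (k - 3)). apply pow_incr.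
    assert (0 < / Cmod x)%R by (apply Rinv_0_lt_compat; lra).
    split; [nra|]. apply Rmult_le_reg_l with (Cmod x); [lra|].
    rewrite <- Rmult_assoc, Rinv_r by lra. lra. }
  assert (H2 : (0 <= (/ Cmod x) ^ 3)%R).
  { apply pow_le, Rlt_le, Rinv_0_lt_compat. lra. }
  replace ((/ Cmod x) ^ 3 * (/ Cmod x) ^ (k - 3) * (rho ^ 3 * rho ^ (k - 3)))%R
    with (rho ^ 3 * (/ Cmod x) ^ 3 * ((/ Cmod x) ^ (k - 3) * rho ^ (k - 3)))%R by ring.
  rewrite <- (Rmult_1_r (rho ^ 3 * (/ Cmod x) ^ 3)) at 2.
  apply Rmult_le_compat_l; auto. apply Rmult_le_pos; auto.
Qed.

(** Below 3 there is no absolute convergence; the value 0 is what the exponential factors of the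
    Weierstrass product produce there. *)
Definition lattice_sums (G : nat -> C) : Prop :=
  G 0%nat = 0 /\ G 1%nat = 0 /\ G 2%nat = 0 /\
  forall k, (3 <= k)%nat -> is_sum (nonzero_points L) (fun x => (/ x) ^ k) (G k).

Lemma ex_lattice_sums : exists G, lattice_sums G.
Proof.
  destruct inv_pow_summable as (M & _ & HM).
  destruct (choice (fun (k : nat) (g : C) =>
    if le_lt_dec 3 k then is_sum (nonzero_points L) (fun x => (/ x) ^ k) g else g = 0))
    as [G HG].
  { intros k. destruct (le_lt_dec 3 k) as [Hk|Hk]; [|exists 0; auto].
    destruct (ex_is_sum (nonzero_points L) (fun x => (/ x) ^ k) (/ rho ^ k * M))
      as (s & Hs & _); [|exists s; auto].
    eapply summable_le; [|apply summable_scal; [|exact (HM k Hk)]].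
    - intros x _. right. field. apply pow_nonzero. lra.
    - apply Rlt_le, Rinv_0_lt_compat, pow_lt; auto. }
  exists G. repeat split.
  - exact (HG 0%nat).
  - exact (HG 1%nat).
  - exact (HG 2%nat).
  - intros k Hk. specialize (HG k). destruct (le_lt_dec 3 k); [auto|lia].
Qed.

Variable G : nat -> C.
Hypothesis HG : lattice_sums G.

Lemma lattice_sum_bound : exists M, (0 <= M)%R /\ forall k, (Cmod (G k) * rho ^ k <= M)%R.
Proof.
  destruct inv_pow_summable as (M & HM0 & HM). exists M. split; auto. intros k.
  destruct HG as (G0 & G1 & G2 & GS).
  destruct (le_lt_dec 3 k) as [Hk|Hk].
  - assert (Hr : (0 < rho ^ k)%R) by (apply pow_lt; auto).
    assert (Hs : is_sum (nonzero_points L) (fun x => RtoC (rho ^ k) * (/ x) ^ k)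
                   (RtoC (rho ^ k) * G k)) by (apply is_sum_scal, GS, Hk).
    apply (is_sum_le _ _ _ M) in Hs.
    + rewrite Cmod_mult, Cmod_R, Rabs_pos_eq in Hs by lra. lra.
    + eapply summable_le; [|exact (HM k Hk)]. intros x _.
      rewrite Cmod_mult, Cmod_R, Rabs_pos_eq by lra. lra.
  - destruct k as [|[|[|k]]]; try lia; rewrite ?G0, ?G1, ?G2, Cmod_0; lra.
Qed.

(** [G k] is at most a constant times [rho^-k], so multiplication by it scales the radius by
    [rho]. *)
Lemma absb_times_sums f M : absb f (/ 2) M -> exists M', absb (fun k => f k * G k) (rho / 2) M'.
Proof.
  intros Hf. destruct lattice_sum_bound as (N & HN0 & HN). exists (N * M)%R.
  intros n. specialize (Hf n).
  apply Rle_trans with (N * rsum (fun k => Cmod (f k) * (/ 2) ^ k) (seq 0 n))%R.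
  - rewrite <- rsum_scal. apply rsum_le. intros k _.
    rewrite Cmod_mult. unfold Rdiv. rewrite Rpow_mult_distr.
    assert (0 <= Cmod (f k) * (/ 2) ^ k)%R.
    { apply Rmult_le_pos; [apply Cmod_ge_0|apply pow_le; lra]. }
    specialize (HN k).
    replace (Cmod (f k) * Cmod (G k) * (rho ^ k * (/ 2) ^ k))%R
      with (Cmod (G k) * rho ^ k * (Cmod (f k) * (/ 2) ^ k))%R by ring.
    apply Rmult_le_compat_r; auto.
  - apply Rmult_le_compat_l; auto.
Qed.

(** Fubini for the terms [f_k (z/x)^k]. The vanishing of f below degree 3 provides the majorant
    [|x|^-3] in x. *)
Lemma val_lattice (f : nat -> C) (v : C -> C) M (z : C) :
  absb f (/ 2) M -> (forall j, (j < 3)%nat -> f j = 0) -> (Cmod z <= rho / 2)%R ->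
  (forall x, nonzero_points L x -> val f (z / x) (v x)) ->
  exists s, val (fun k => f k * G k) z s /\ is_sum (nonzero_points L) v s.
Proof.
  intros Hf Hlow Hz Hv. destruct inv_pow_summable as (N & _ & HN).
  specialize (HN 3%nat ltac:(lia)). destruct HG as (G0 & G1 & G2 & GS).
  set (F := fun p : nat * C => f (fst p) * z ^ fst p * (/ snd p) ^ fst p).
  destruct (ex_is_sum (cross (fun _ => True) (nonzero_points L)) F (M * N)) as (s & Hs & _).
  { eapply summable_le; [|apply (summable_prod (fun _ : nat => True) (nonzero_points L)
      (fun k => Cmod (f k) * (/ 2) ^ k)%R (fun x => Cmod ((/ x) ^ 3) * rho ^ 3)%R M N)];
      auto.
    - intros [k x] [_ Hx]. cbn [fst snd] in *. unfold F. cbn [fst snd].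
      pose proof (Hmin x Hx) as Hm. destruct Hx as [_ Hx0].
      destruct (le_lt_dec 3 k) as [Hk|Hk].
      2:{ rewrite Hlow by auto. rewrite !Cmult_0_l, Cmod_0, !Rmult_0_l. lra. }
      rewrite !Cmod_mult, !Cmod_pow, Cmod_inv, Rmult_assoc, Rmult_assoc by auto.
      apply Rmult_le_compat_l; [apply Cmod_ge_0|].
      pose proof (Cmod_ge_0 z) as Hz0.
      apply Rle_trans with ((rho / 2) ^ k * (/ Cmod x) ^ k)%R.
      { apply Rmult_le_compat_r; [apply pow_le, Rlt_le, Rinv_0_lt_compat; lra|].
        apply pow_incr; lra. }
      unfold Rdiv. rewrite Rpow_mult_distr.
      assert (H1 : ((/ Cmod x) ^ k * rho ^ k <= (/ Cmod x) ^ 3 * rho ^ 3)%R).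
      { rewrite <- !Rpow_mult_distr.
        assert (0 < / Cmod x)%R by (apply Rinv_0_lt_compat; lra).
        assert (Hq : (0 <= / Cmod x * rho <= 1)%R).
        { split; [nra|]. apply Rmult_le_reg_l with (Cmod x); [lra|].
          rewrite <- Rmult_assoc, Rinv_r by lra. lra. }
        set (q := (/ Cmod x * rho)%R) in *.
        replace k with (3 + (k - 3))%nat by lia. rewrite pow_add.
        assert (q ^ (k - 3) <= 1)%R by (rewrite <- (pow1 (k - 3)); apply pow_incr; lra).
        assert (0 <= q ^ 3)%R by (apply pow_le; lra). nra. }
      assert (0 <= (/ 2) ^ k)%R by (apply pow_le; lra).
      replace (rho ^ k * (/ 2) ^ k * (/ Cmod x) ^ k)%R
        with ((/ 2) ^ k * ((/ Cmod x) ^ k * rho ^ k))%R by ring.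
      apply Rmult_le_compat_l; auto.
    - intros k. apply Rmult_le_pos; [apply Cmod_ge_0|apply pow_le; lra].
    - intros x. apply Rmult_le_pos; [apply Cmod_ge_0|apply pow_le; lra].
    - apply absb_summable; auto. lra. }
  exists s. split.
  - assert (Hs' : is_sum (cross (nonzero_points L) (fun _ : nat => True))
                    (fun p => F (snd p, fst p)) s).
    { apply (is_sum_bij _ (cross (fun _ => True) (nonzero_points L))
        (fun p => (snd p, fst p)) (fun p => (snd p, fst p)) F); auto;
      intros [x y] [H1 H2]; (split; [split; auto|auto]). }
    eapply is_sum_rows; [|exact Hs']. intros k _. unfold F. cbn [fst snd].
    destruct (le_lt_dec 3 k) as [Hk|Hk].
    + replace (f k * G k * z ^ k) with (f k * z ^ k * G k) by ring.
      apply is_sum_scal, GS, Hk.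
    + rewrite Hlow by auto. replace (0 * G k * z ^ k) with (RtoC 0) by ring.
      apply is_sum_0. intros; ring.
  - eapply is_sum_rows; [|exact Hs]. intros x Hx. unfold F. cbn [fst snd].
    eapply is_sum_ext; [|apply (Hv x Hx)]. intros k _. simpl.
    unfold Cdiv. rewrite Cpow_mult_l. ring.
Qed.

(** For k >= 3, the sum of [(z / (x - z))^k] over nonzero x, expanded in z: up to the sign [(-1)^k]
    it is [z^k E_k] without the term of the origin. *)
Definition eisenstein_part (k : nat) : series CC := fun j => @geom_pow CC k j * G j.

Lemma absb_eisenstein_part k : exists M, absb (eisenstein_part k) (rho / 2) M.
Proof. destruct (absb_geom_pow k) as [M HM]. eapply absb_times_sums; eauto. Qed.

Lemma sum_add_origin (f : C -> C) s :
  is_sum (nonzero_points L) f s -> is_sum L f (f 0 + s).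
Proof.
  intros H.
  assert (H1 : is_sum L (fun x => if eq_dec_classical x 0 then 0 else f x) s).
  { apply (is_sum_extend (nonzero_points L)).
    - intros x [Hx _]; auto.
    - intros x Hx Hn. destruct (eq_dec_classical x 0); auto. exfalso. apply Hn. split; auto.
    - eapply is_sum_ext; [|exact H]. intros x [_ Hx]. simpl.
      destruct (eq_dec_classical x 0); [contradiction|auto]. }
  assert (H2 : is_sum L (fun x => if eq_dec_classical x 0 then f 0 else 0) (f 0)).
  { apply (is_sum_extend (fun x => In x (RtoC 0 :: nil))).
    - intros x [<-|[]]. eapply lattice_0; eauto.
    - intros x _ Hx. destruct (eq_dec_classical x 0) as [->|]; auto.
      exfalso. apply Hx. left; auto.
    - pose proof (is_sum_finite (fun x => In x (RtoC 0 :: nil))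
        (fun x => if eq_dec_classical x 0 then f 0 else 0) (RtoC 0 :: nil)) as H2.
      replace (lsum _ (RtoC 0 :: nil)) with (f 0) in H2.
      + apply H2; [repeat constructor; auto|tauto].
      + unfold lsum. simpl. destruct (eq_dec_classical (RtoC 0) 0) as [|n];
          [ring|destruct (n eq_refl)]. }
  eapply is_sum_ext; [|apply (is_sum_plus _ _ _ _ _ H2 H1)].
  intros x _. simpl. destruct (eq_dec_classical x 0) as [->|]; ring.
Qed.

Lemma eisenstein_val (z : C) k : z <> 0 -> (Cmod z <= rho / 2)%R -> (3 <= k)%nat ->
  exists s, val (eisenstein_part k) z s /\
    is_sum L (fun x => (/ (z - x)) ^ k) ((1 + (- (1)) ^ k * s) / z ^ k).
Proof.
  intros Hz0 Hz Hk. destruct (absb_geom_pow k) as [M HM].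
  assert (Hw : forall x, nonzero_points L x -> (Cmod (z / x) <= / 2)%R).
  { intros x Hx. pose proof (Hmin x Hx) as Hm. destruct Hx as [_ Hx0].
    rewrite Cmod_div by auto. apply Rle_div_l; [lra|]. lra. }
  destruct (val_lattice (@geom_pow CC k) (fun x => (z / x / (1 - z / x)) ^ k) M z HM)
    as (s & Hs1 & Hs2); auto.
  { intros j Hj. exact (geom_pow_low CC k j Hk Hj). }
  { intros x Hx. apply val_geom_pow. apply Hw, Hx. }
  exists s. split; [exact Hs1|].
  assert (Hzk : z ^ k <> 0) by (apply Cpow_nz; auto).
  assert (Hs3 : is_sum (nonzero_points L) (fun x => (/ (z - x)) ^ k) ((- (1)) ^ k * s / z ^ k)).
  { replace ((- (1)) ^ k * s / z ^ k) with ((- (1)) ^ k / z ^ k * s) by (field; auto).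
    eapply is_sum_ext; [|apply is_sum_scal; exact Hs2]. intros x Hx.
    pose proof (small_neq_1 _ (Hw x Hx)) as Hn. destruct Hx as [_ Hx0]. simpl.
    assert (Hzx : z - x <> 0).
    { intros E. apply Hn. replace z with x; [field; auto|].
      replace z with (z - x + x) by ring. rewrite E. ring. }
    replace (/ (z - x)) with (- (1) * / z * (z / x / (1 - z / x))).
    - rewrite !Cpow_mult_l, Cpow_inv by auto. unfold Cdiv. reflexivity.
    - field. repeat split; auto. intros E. apply Hzx.
      replace (z - x) with (- (x - z)) by ring. rewrite E. ring. }
  apply sum_add_origin in Hs3. replace (z - 0) with z in Hs3 by ring.
  replace ((1 + (- (1)) ^ k * s) / z ^ k) with ((/ z) ^ k + (- (1)) ^ k * s / z ^ k); auto.
  rewrite Cpow_inv by auto. field. auto.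
Qed.

(** [z^2 wp]: the k-th coefficient is (k-1) [G k], and [G 2 = 0] is the subtraction of [x^-2] in
    wp. *)
Definition wp_series : series CC := (aone + eisenstein_part 2)%A.

Lemma odd_lattice_sum k : (3 <= k)%nat -> Nat.odd k = true -> G k = 0.
Proof.
  intros Hk Hodd. destruct HG as (_ & _ & _ & GS). specialize (GS k Hk).
  assert (H : is_sum L (fun x => iv x ^ k) (G k)).
  { apply sum_nonzero.
    - rewrite iv_0. destruct k; [lia|]. simpl. ring.
    - eapply is_sum_ext; [|exact GS]. intros x [_ Hx]. simpl. rewrite iv_neq; auto. }
  eapply (is_sum_odd w1 w2 L HB); [|exact H]. intros x. simpl. rewrite iv_opp.
  apply Nat.odd_spec in Hodd. destruct Hodd as [m ->].
  replace (- iv x) with (- (1) * iv x) by ring. rewrite Cpow_mult_l.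
  replace ((- (1)) ^ (2 * m + 1)) with (- (1)).
  - ring.
  - rewrite Cpow_add_r, Cpow_mult_r.
    replace ((- (1)) ^ 2) with (RtoC 1) by (simpl; ring).
    replace (1 ^ m) with (RtoC 1); [simpl; ring|].
    clear. induction m as [|m IH]; simpl; [auto|]. rewrite <- IH. ring.
Qed.

Section Relation.
Add Ring CC_ring3 : (calg_ring CC) (morphism (zr_morph CC), constants [zr_cst]).
Add Ring SCC_ring3 : (calg_ring (series CC)) (morphism (zr_morph (series CC)), constants [zr_cst]).
Local Open Scope calg_scope.

(** Eisenstein's relation times [z^7] holds between the values for 0 < |z| <= [rho / 2], hence
    between the coefficients. *)
Lemma eisenstein_series_relation :
  1 - eisenstein_part 7 = (1 - eisenstein_part 3) * (1 + eisenstein_part 4 + cst (A := CC) (RtoC 2 * G 4%nat)%C * (sX * sX * sX * sX)).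
Proof.
  destruct (absb_eisenstein_part 3) as [M3 B3]. destruct (absb_eisenstein_part 4) as [M4 B4].
  destruct (absb_eisenstein_part 7) as [M7 B7].
  assert (Hr : (0 <= rho / 2)%R) by lra.
  destruct (absb_X (rho / 2) Hr) as [MX BX].
  destruct (absb_cst (RtoC 1) (rho / 2) Hr) as [M1 B1].
  destruct (absb_cst (RtoC 2 * G 4%nat)%C (rho / 2) Hr) as [MG BG].
  set (XX := (sX * sX * sX * sX : series CC)).
  assert (BXX : exists M, absb XX (rho / 2) M).
  { eexists. unfold XX. repeat (apply absb_mul; [exact Hr| |exact BX]). exact BX. }
  destruct BXX as [MXX BXX].
  assert (Bsub : forall (f g : series CC) M N, absb f (rho / 2) M -> absb g (rho / 2) N ->
     absb (f - g) (rho / 2) (M + N)).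
  { intros f g M N Hf Hg. apply (absb_plus f (fun k => Copp (g k))); auto.
    intros n. eapply Rle_trans; [|apply (Hg n)]. apply rsum_le. intros k _.
    rewrite Cmod_opp. lra. }
  set (B := 1 + eisenstein_part 4 + cst (A := CC) (RtoC 2 * G 4%nat)%C * XX).
  assert (BB : absb B (rho / 2) (M1 + M4 + MG * MXX)).
  { apply (absb_plus (1 + eisenstein_part 4) (cst (A := CC) (RtoC 2 * G 4%nat)%C * XX)); auto.
    - apply (absb_plus (1 : series CC) (eisenstein_part 4)); auto.
    - apply absb_mul; auto. }
  pose proof (Bsub 1 (eisenstein_part 3) M1 M3 B1 B3) as BA.
  set (q := 1 - eisenstein_part 7 - (1 - eisenstein_part 3) * B).
  assert (Hq : forall k, q k = RtoC 0).
  { apply (series_identity q (rho / 2) (M1 + M7 + (M1 + M3) * (M1 + M4 + MG * MXX)));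
      [lra| |].
    - apply Bsub; [apply Bsub; auto|]. apply absb_mul; auto.
    - intros z Hz0 Hz.
      destruct (eisenstein_val z 3 Hz0 Hz ltac:(lia)) as (s3 & V3 & E3).
      destruct (eisenstein_val z 4 Hz0 Hz ltac:(lia)) as (s4 & V4 & E4).
      destruct (eisenstein_val z 7 Hz0 Hz ltac:(lia)) as (s7 & V7 & E7).
      assert (HzL : ~ L z).
      { intros H. assert (nonzero_points L z) as Hn by (split; auto).
        apply Hmin in Hn. lra. }
      assert (H4 : is_sum (nonzero_points L) (fun x => (/ x ^ 4)%C) (G 4%nat)).
      { destruct HG as (_ & _ & _ & GS). eapply is_sum_ext; [|apply (GS 4%nat); lia].
        intros x [_ Hx]. cbv beta. apply Cpow_inv. auto. }
      pose proof (eisenstein_relation w1 w2 L HB z _ _ _ _ HzL H4 E3 E4 E7) as ER.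
      assert (Hz7 : (z ^ 7 <> RtoC 0)%C) by (apply Cpow_nz; auto).
      replace (RtoC 0) with (RtoC 1 - s7 - (RtoC 1 - s3) * (RtoC 1 + s4 + (RtoC 2 * G 4%nat) * (z * z * z * z)))%C.
      + apply (val_sub (1 - eisenstein_part 7) ((1 - eisenstein_part 3) * B)).
        * apply (val_sub 1 (eisenstein_part 7)); [apply (val_cst (RtoC 1))|exact V7].
        * eapply val_mul; [exact Hz|exact BA|exact BB| |].
          -- apply (val_sub 1 (eisenstein_part 3)); [apply (val_cst (RtoC 1))|exact V3].
          -- apply (val_add (1 + eisenstein_part 4)).
             ++ apply (val_add 1 (eisenstein_part 4)); [apply (val_cst (RtoC 1))|exact V4].
             ++ eapply val_mul; [exact Hz|exact BG|exact BXX|apply val_cst|].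
                unfold XX.
                eapply val_mul; [exact Hz| |exact BX| |apply val_X].
                { repeat (apply absb_mul; [exact Hr| |exact BX]). exact BX. }
                eapply val_mul; [exact Hz| |exact BX| |apply val_X].
                { apply absb_mul; [exact Hr|exact BX|exact BX]. }
                eapply val_mul; [exact Hz|exact BX|exact BX|apply val_X|apply val_X].
      + transitivity (z ^ 7 * ((RtoC 1 + (- RtoC 1) ^ 7 * s7) / z ^ 7 -
          (RtoC 1 + (- RtoC 1) ^ 3 * s3) / z ^ 3 *
          ((RtoC 1 + (- RtoC 1) ^ 4 * s4) / z ^ 4 + RtoC 2 * G 4%nat)))%C.
        * field. auto.
        * rewrite ER. ring. }
  transitivity (q + (1 - eisenstein_part 3) * B); [unfold q; ring|].
  replace q with (@azero (series CC)); [unfold B; ring|].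
  symmetry. apply functional_extensionality. exact Hq.
Qed.

Lemma eisenstein_part_shifted k : (1 <= k)%nat ->
  shifted _ euler (Z.of_nat k) (eisenstein_part k) = zr (Z.of_nat k) * eisenstein_part (S k).
Proof.
  intros Hk. apply functional_extensionality. intros j. rewrite coef_zr, coef_shifted.
  change (eisenstein_part k j) with (geom_pow k j * (G j : CC)).
  change (eisenstein_part (S k) j) with (geom_pow (S k) j * (G j : CC)).
  transitivity ((zr (Z.of_nat j) - zr (Z.of_nat k)) * geom_pow k j * (G j : CC)); [ring|].
  rewrite <- geom_pow_coef by auto. ring.
Qed.

(** The derivatives of wp are multiples of [E3], [E4] and [E7]; 30 [G 4] is g2/2. *)
Lemma lattice_fifth_order : satisfies_fifth_order CC (zr 30 * (G 4%nat : CC)) wp_series.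
Proof.
  pose proof (euler_derivation CC) as HD.
  assert (S1 : forall n m (c : series CC), shifted _ euler n (zr m * c) = zr m * shifted _ euler n c).
  { intros n m c. unfold shifted. rewrite (d_mul _ HD), (d_zr _ _ _ HD). ring. }
  assert (Sp : forall n k, (1 <= k)%nat -> n = Z.of_nat k ->
    shifted _ euler n (1 + eisenstein_part k) = zr n * (zr (-1) + eisenstein_part (S k))).
  { intros n k Hk ->. transitivity (shifted _ euler (Z.of_nat k) (eisenstein_part k) - zr (Z.of_nat k)).
    - unfold shifted. rewrite (d_add _ HD). replace (euler 1) with (@azero (series CC)); [ring|].
      symmetry. apply euler_const.
    - rewrite eisenstein_part_shifted by auto. ring. }
  assert (Sm : forall n k, (1 <= k)%nat -> n = Z.of_nat k ->
    shifted _ euler n (zr (-1) + eisenstein_part k) = zr n * (1 + eisenstein_part (S k))).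
  { intros n k Hk ->. transitivity (shifted _ euler (Z.of_nat k) (eisenstein_part k) + zr (Z.of_nat k)).
    - unfold shifted. rewrite (d_add _ HD), (d_zr _ _ _ HD). ring.
    - rewrite eisenstein_part_shifted by auto. ring. }
  unfold satisfies_fifth_order, wp_series.
  rewrite (Sp 2%Z 2%nat), !S1, (Sm 3%Z 3%nat), !S1, (Sp 4%Z 4%nat), !S1, (Sm 5%Z 5%nat), !S1,
    (Sp 6%Z 6%nat) by (auto; lia).
  change (eisenstein_part (S 6)) with (eisenstein_part 7). change (eisenstein_part (S 3)) with (eisenstein_part 4).
  change (eisenstein_part (S 2)) with (eisenstein_part 3).
  (* [wp^(5) = -6! E7]: each shift contributes one of the factors 2, 3, 4, 5, 6 and changes the
     sign. *)
  transitivity (zr (-720) * (1 - eisenstein_part 7)).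
  { ring. }
  rewrite eisenstein_series_relation.
  replace (cst (zr 30 * (G 4%nat : CC))) with (zr 15 * cst (A := CC) (RtoC 2 * G 4%nat)%C).
  - ring.
  - apply functional_extensionality. intros j. rewrite coef_zr.
    destruct j as [|j]; unfold cst; simpl sconst; [|apply Cmult_0_r].
    change (RtoC 15 * (RtoC 2 * G 4%nat) = RtoC 30 * G 4%nat)%C.
    replace (RtoC 30) with (RtoC 15 * RtoC 2)%C; [apply Cmult_assoc|].
    rewrite <- RtoC_mult. f_equal. ring.
Qed.

End Relation.

End LatticeSeries.

(** * The Weierstrass product *)

Section ExpSeries.
Variable B : calg.
Add Ring B_ring5 : (calg_ring B) (morphism (zr_morph B), constants [zr_cst]).
Add Ring SB_ring5 : (calg_ring (series B)) (morphism (zr_morph (series B)), constants [zr_cst]).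
Local Open Scope calg_scope.

(** The series exp(X + X^2/2), as the solution for [Z = 1 + X + X^2] of the equation that defines
    sigma. *)
Lemma ex_exp_series : exists i : series B, i O = 1 /\ euler i = (sX + sX * sX) * i.
Proof.
  destruct (ex_sigma_series B (1 + sX + sX * sX)) as (s & H0 & H).
  - change ((1 + sX + sX * sX) O) with (1 + 0 + 0 * 0 : B). ring.
  - exists s. split; auto. rewrite H. ring.
Qed.

(* [(1 - X) i] is the primary factor [(1 - X) exp (X + X^2 / 2)]. *)
Lemma euler_primary (i : series B) : euler i = (sX + sX * sX) * i ->
  euler ((1 - sX) * i) = - (sX * sX * sX * (1 + geom) * ((1 - sX) * i)).
Proof.
  intros H. pose proof (euler_derivation B) as HD.
  rewrite (d_mul _ HD), (d_sub _ _ _ _ HD), euler_X, H.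
  rewrite (euler_const B 1 : euler 1 = 0).
  assert (I : (1 - sX) * (1 + geom) = @aone (series B)).
  { transitivity (1 + @geom B - sX * (1 + geom)); [ring|]. rewrite <- geom_X. ring. }
  transitivity (- (sX * sX * sX * ((1 - sX) * (1 + @geom B)) * i)); [|ring].
  rewrite I. ring.
Qed.

End ExpSeries.

(** * Values of exp(w + w^2/2) *)

Section Decay.
Variable i : series CC.
Hypothesis i_0 : i O = RtoC 1.
Hypothesis euler_i : euler i = ((sX + sX * sX) * i)%A.

Lemma exp_series_S n : RtoC (INR (S (S n))) * i (S (S n)) = i (S n) + i n.
Proof.
  pose proof (f_equal (fun f => f (S (S n))) euler_i) as H. cbv beta in H.
  unfold euler in H. rewrite INR_IZR_INZ.
  etransitivity; [exact H|].
  replace ((sX + sX * sX) * i)%A with (sX * i + sX * (sX * i))%A.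
  - rewrite coef_add, !smul_X. reflexivity.
  - rewrite (Rdistr_l (calg_ring (series CC))), (Rmul_assoc (calg_ring (series CC))).
    reflexivity.
Qed.

Lemma exp_series_1 : i 1%nat = RtoC 1.
Proof.
  pose proof (f_equal (fun f => f 1%nat) euler_i) as H. cbv beta in H.
  unfold euler in H.
  replace ((sX + sX * sX) * i)%A with (sX * i + sX * (sX * i))%A in H.
  - rewrite coef_add, !smul_X, i_0 in H.
    change (RtoC 1 * i 1%nat = RtoC 1 + RtoC 0)%C in H.
    rewrite Cmult_1_l, Cplus_0_r in H. exact H.
  - rewrite (Rdistr_l (calg_ring (series CC))), (Rmul_assoc (calg_ring (series CC))).
    reflexivity.
Qed.

(** The recurrence divides by n + 2, so the bound [K q^n] propagates once n + 2 >= 1/q + 1/q^2; [K]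
    takes care of the finitely many earlier indices. *)
Lemma exp_series_decay (q : R) : (0 < q)%R -> exists K, (0 <= K)%R /\
  forall n, (Cmod (i n) <= K * q ^ n)%R.
Proof.
  intros Hq. assert (Hq' : (0 < / q)%R) by (apply Rinv_0_lt_compat; auto).
  destruct (nfloor_ex (/ q + / q * / q)) as [N HN]; [nra|].
  set (h := fun k => (Cmod (i k) * (/ q) ^ k)%R).
  assert (Hh : forall k, (0 <= h k)%R).
  { intros k. apply Rmult_le_pos; [apply Cmod_ge_0|apply pow_le; lra]. }
  set (K := rsum h (seq 0 (S (S N)))). exists K.
  assert (HK : (0 <= K)%R) by (apply rsum_ge_0; auto). split; auto.
  intros n. induction n as [n IH] using lt_wf_ind.
  destruct (le_lt_dec n (S N)) as [Hn|Hn].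
  - assert (Hle : (h n <= K)%R).
    { replace (h n) with (rsum h (n :: nil)) by (unfold rsum; simpl; ring).
      apply rsum_incl; auto using seq_NoDup.
      - repeat constructor; auto.
      - intros x [<-|[]]. apply in_seq. lia. }
    unfold h in Hle. apply Rmult_le_compat_r with (r := (q ^ n)%R) in Hle;
      [|apply pow_le; lra].
    rewrite Rmult_assoc, <- Rpow_mult_distr, Rinv_l, pow1, Rmult_1_r in Hle by lra. exact Hle.
  - destruct n as [|[|n]]; try lia.
    pose proof (IH (S n) ltac:(lia)) as I1. pose proof (IH n ltac:(lia)) as I0.
    assert (HI : (0 < INR (S (S n)))%R) by (apply lt_0_INR; lia).
    assert (Hbig : (/ q + / q * / q <= INR (S (S n)))%R).
    { apply Rlt_le. eapply Rlt_le_trans; [apply HN|]. rewrite <- S_INR. apply le_INR. lia. }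
    apply Rmult_le_reg_l with (INR (S (S n))); auto.
    replace (INR (S (S n)) * Cmod (i (S (S n))))%R with (Cmod (i (S n) + i n)).
    2:{ rewrite <- exp_series_S, Cmod_mult, Cmod_R, Rabs_pos_eq by lra. reflexivity. }
    eapply Rle_trans; [apply Cmod_triangle|].
    assert (Hqn : (0 <= K * q ^ (S (S n)))%R) by (apply Rmult_le_pos; auto; apply pow_le; lra).
    apply Rle_trans with ((/ q + / q * / q) * (K * q ^ S (S n)))%R.
    + replace ((/ q + / q * / q) * (K * q ^ S (S n)))%R with (K * q ^ S n + K * q ^ n)%R
        by (simpl; field; lra). lra.
    + apply Rmult_le_compat_r; auto.
Qed.

Lemma absb_of_decay (f : nat -> C) (q r K : R) : (0 <= q)%R -> (0 <= r)%R -> (0 <= K)%R ->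
  (q * r <= / 2)%R -> (forall n, Cmod (f n) <= K * q ^ n)%R -> absb f r (2 * K).
Proof.
  intros Hq Hr HK Hqr H n.
  apply Rle_trans with (2 * K * rsum (fun k => (/ 2) ^ S k)%R (seq 0 n))%R.
  - rewrite <- rsum_scal. apply rsum_le. intros k _.
    apply Rle_trans with (K * q ^ k * r ^ k)%R.
    + apply Rmult_le_compat_r; [apply pow_le; auto|apply H].
    + rewrite Rmult_assoc, <- Rpow_mult_distr. simpl.
      assert ((q * r) ^ k <= (/ 2) ^ k)%R by (apply pow_incr; nra). nra.
  - pose proof (pow_half_sum n). assert (0 < (/ 2) ^ n)%R by (apply pow_lt; lra). nra.
Qed.

Lemma absb_exp_series r : (0 <= r)%R -> exists M, absb i r M.
Proof.
  intros Hr. set (q := (/ (2 * r + 1))%R).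
  assert (Hq : (0 < q)%R) by (apply Rinv_0_lt_compat; lra).
  destruct (exp_series_decay q Hq) as (K & HK & H).
  exists (2 * K)%R. apply (absb_of_decay i q); auto; [lra|].
  unfold q. apply Rmult_le_reg_l with (2 * r + 1)%R; [lra|].
  rewrite <- Rmult_assoc, Rinv_r by lra. lra.
Qed.

End Decay.

(** Passage to ordinary real series, whose differentiation theory serves to evaluate the exponential
    series. *)
Lemma is_sum_series (h : nat -> C) v : is_sum (fun _ => True) h v ->
  is_series (fun k => Re (h k)) (Re v) /\ is_series (fun k => Im (h k)) (Im v).
Proof.
  intros H. rewrite is_sum_net in H.
  assert (E : forall (p : C -> R) n, (forall x y, p (x + y) = (p x + p y)%R) ->
     sum_n (fun k => p (h k)) n = p (lsum h (seq 0 (S n)))).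
  { intros p n Hp. assert (Hp0 : p 0 = 0%R).
    { pose proof (Hp 0 0) as H0. replace (0 + 0) with (RtoC 0) in H0 by ring. lra. }
    induction n as [|n IH].
    - rewrite sum_O. unfold lsum. simpl. rewrite Hp, Hp0. ring.
    - rewrite sum_Sn, IH, (seq_S_end (S n)), lsum_app, Hp. unfold lsum at 3. simpl.
      rewrite Hp, Hp0. unfold plus. simpl. ring. }
  assert (K : forall p : C -> R, (forall x y, p (x + y) = (p x + p y)%R) ->
     (forall x, Rabs (p x) <= Cmod x)%R -> is_series (fun k => p (h k)) (p v)).
  { intros p Hp Hle. apply (filterlim_locally (F := eventually)). intros eps.
    destruct (H eps (cond_pos eps)) as (l0 & L1 & L2 & L3).
    destruct (nat_list_bound l0) as [N HN]. exists N. intros n Hn.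
    specialize (L3 (seq 0 (S n)) (seq_NoDup _ _) (Forall_True _)).
    cut (Rabs (p (lsum h (seq 0 (S n))) - p v) < eps)%R.
    { rewrite <- (E p n Hp). intros Hlt. exact Hlt. }
    assert (Hm : forall x y, p (x - y) = (p x - p y)%R).
    { intros x y. pose proof (Hp (x - y) y) as H0. replace (x - y + y) with x in H0 by ring.
      lra. }
    rewrite <- Hm. eapply Rle_lt_trans; [apply Hle|]. apply L3.
    intros x Hx. apply in_seq. specialize (HN x Hx). lia. }
  split; apply K; auto using re_le_Cmod, im_le_Cmod.
Qed.

Lemma CV_radius_entire (a : nat -> R) :
  (forall r, (0 <= r)%R -> exists M, forall n, (Rabs (a n) * r ^ n <= M)%R) ->
  CV_radius a = p_infty.
Proof.
  intros H. destruct (CV_radius_bounded a) as [Hub _].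
  destruct (CV_radius a) as [x| |] eqn:E; auto; exfalso.
  - destruct (H (Rabs x + 1)%R) as [M HM]; [pose proof (Rabs_pos x); lra|].
    assert (Hle : Rbar_le (Finite (Rabs x + 1)) (Finite x)).
    { apply Hub. exists M. intros n. rewrite Rabs_mult, <- RPow_abs.
      rewrite (Rabs_pos_eq (Rabs x + 1)); auto. pose proof (Rabs_pos x). lra. }
    simpl in Hle. pose proof (Rle_abs x). lra.
  - destruct (H 0%R ltac:(lra)) as [M HM].
    assert (Hle : Rbar_le (Finite 0) m_infty).
    { apply Hub. exists M. intros n. rewrite Rabs_mult, <- RPow_abs.
      rewrite Rabs_R0. auto. }
    exact Hle.
Qed.

Lemma PSeries_recurrence (u v : nat -> R) (c1 c2 c3 c4 t : R) :
  ex_pseries u t -> ex_pseries v t ->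
  PSeries (PS_plus (PS_plus (PS_scal c1 u) (PS_scal c2 v))
    (PS_incr_1 (PS_plus (PS_scal c3 u) (PS_scal c4 v)))) t =
  (c1 * PSeries u t + c2 * PSeries v t + t * (c3 * PSeries u t + c4 * PSeries v t))%R.
Proof.
  intros Hu Hv.
  assert (E : forall (c : R) (w : nat -> R), ex_pseries w t -> ex_pseries (PS_scal c w) t).
  { intros c w Hw. apply ex_pseries_scal; auto. apply Rmult_comm. }
  assert (P : forall c d : R, ex_pseries (PS_plus (PS_scal c u) (PS_scal d v)) t).
  { intros c d. apply ex_pseries_plus; auto. }
  rewrite (PSeries_plus (PS_plus (PS_scal c1 u) (PS_scal c2 v))); auto.
  - rewrite (PSeries_plus (PS_scal c1 u)), PSeries_incr_1, (PSeries_plus (PS_scal c3 u)),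
      !PSeries_scal; auto.
  - apply ex_pseries_incr_1. auto.
Qed.

(* Both sides solve the same linear differential equation along the segment from [0] to [w]. *)
Lemma val_exp_series (i : series CC) (w : C) : i O = RtoC 1 ->
  euler i = ((sX + sX * sX) * i)%A -> val i w (Cexp (w + w ^ 2 / 2)).
Proof.
  intros i_0 euler_i.
  set (a := fun k => i k * w ^ k).
  set (ra := fun k => Re (a k)). set (ia := fun k => Im (a k)).
  assert (Hbd : forall r, (0 <= r)%R -> exists M, forall n, (Cmod (a n) * r ^ n <= M)%R).
  { intros r Hr. pose proof (Cmod_ge_0 w) as Hw.
    destruct (absb_exp_series i euler_i (Cmod w * r)) as [M HM];
      [apply Rmult_le_pos; auto|].
    exists M. intros n. unfold a. rewrite Cmod_mult, Cmod_pow, Rmult_assoc, <- Rpow_mult_distr.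
    apply absb_coef; auto. apply Rmult_le_pos; auto. }
  assert (Rra : CV_radius ra = p_infty).
  { apply CV_radius_entire. intros r Hr. destruct (Hbd r Hr) as [M HM]. exists M. intros n.
    eapply Rle_trans; [|apply (HM n)]. apply Rmult_le_compat_r; [apply pow_le; auto|].
    apply re_le_Cmod. }
  assert (Ria : CV_radius ia = p_infty).
  { apply CV_radius_entire. intros r Hr. destruct (Hbd r Hr) as [M HM]. exists M. intros n.
    eapply Rle_trans; [|apply (HM n)]. apply Rmult_le_compat_r; [apply pow_le; auto|].
    apply im_le_Cmod. }
  set (A := PSeries ra). set (B := PSeries ia).
  assert (Era : forall t, ex_pseries ra t).
  { intros t. apply CV_radius_inside. rewrite Rra. exact I. }
  assert (Eia : forall t, ex_pseries ia t).
  { intros t. apply CV_radius_inside. rewrite Ria. exact I. }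
  set (x := Re w). set (y := Im w). set (x2 := Re (w ^ 2)). set (y2 := Im (w ^ 2)).
  assert (Hrec : forall n, RtoC (INR (S (S n))) * a (S (S n)) = w * a (S n) + w ^ 2 * a n).
  { intros n. unfold a.
    transitivity (RtoC (INR (S (S n))) * i (S (S n)) * w ^ S (S n)); [ring|].
    rewrite (exp_series_S i euler_i). simpl. ring. }
  assert (Hrec0 : a 1%nat = w * a O).
  { unfold a. rewrite i_0, (exp_series_1 i i_0 euler_i). simpl. ring. }
  (* Together with [HB]: [(A + iB)' = (w + t w^2)(A + iB)], the coefficient recurrence read along
     the segment t w. *)
  assert (HA : forall t : R, is_derive A t ((x + t * x2) * A t - (y + t * y2) * B t)%R).
  { intros t. replace ((x + t * x2) * A t - (y + t * y2) * B t)%R with (PSeries (PS_derive ra) t).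
    { apply is_derive_PSeries. rewrite Rra. exact I. }
    rewrite (PSeries_ext _ (PS_plus (PS_plus (PS_scal x ra) (PS_scal (- y)%R ia))
      (PS_incr_1 (PS_plus (PS_scal x2 ra) (PS_scal (- y2)%R ia))))).
    - rewrite PSeries_recurrence; auto. unfold A, B. ring.
    - clearbody a. intros [|n]; unfold PS_derive, PS_plus, PS_scal, PS_incr_1, ra, ia, plus, scal, zero;
        simpl; unfold mult; simpl.
      + rewrite Hrec0. unfold x, y. destruct w as [p q], (a O) as [c d]. simpl. ring.
      + pose proof (f_equal Re (Hrec n)) as E. 
        change (match n with O => 1 | S _ => INR n + 1 end)%R with (INR (S n)).
        transitivity (Re (RtoC (INR (S (S n))) * a (S (S n)))).
        * rewrite !S_INR. destruct (a (S (S n))) as [c d]. simpl. ring.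
        * rewrite E. unfold x, y, x2, y2.
          destruct (w ^ 2) as [p2 q2], w as [p q], (a n) as [c d], (a (S n)) as [c' d'].
          simpl. ring. }
  assert (HB : forall t : R, is_derive B t ((y + t * y2) * A t + (x + t * x2) * B t)%R).
  { intros t. replace ((y + t * y2) * A t + (x + t * x2) * B t)%R with (PSeries (PS_derive ia) t).
    { apply is_derive_PSeries. rewrite Ria. exact I. }
    rewrite (PSeries_ext _ (PS_plus (PS_plus (PS_scal y ra) (PS_scal x ia))
      (PS_incr_1 (PS_plus (PS_scal y2 ra) (PS_scal x2 ia))))).
    - rewrite PSeries_recurrence; auto. unfold A, B. ring.
    - clearbody a. intros [|n]; unfold PS_derive, PS_plus, PS_scal, PS_incr_1, ra, ia, plus, scal, zero;
        simpl; unfold mult; simpl.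
      + rewrite Hrec0. unfold x, y. destruct w as [p q], (a O) as [c d]. simpl. ring.
      + pose proof (f_equal Im (Hrec n)) as E. 
        change (match n with O => 1 | S _ => INR n + 1 end)%R with (INR (S n)).
        transitivity (Im (RtoC (INR (S (S n))) * a (S (S n)))).
        * rewrite !S_INR. destruct (a (S (S n))) as [c d]. simpl. ring.
        * rewrite E. unfold x, y, x2, y2.
          destruct (w ^ 2) as [p2 q2], w as [p q], (a n) as [c d], (a (S n)) as [c' d'].
          simpl. ring. }
  set (qr := fun t : R => (x * t + x2 * t ^ 2 / 2)%R).
  set (qi := fun t : R => (y * t + y2 * t ^ 2 / 2)%R).
  (* U + iV is [exp(-(t w + t^2 w^2 / 2)) (A + iB)], which is constant. *)
  set (U := fun t => (exp (- qr t) * (A t * cos (qi t) + B t * sin (qi t)))%R).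
  set (V := fun t => (exp (- qr t) * (B t * cos (qi t) - A t * sin (qi t)))%R).
  assert (HU : forall t : R, is_derive U t 0%R).
  { intros t. unfold U, qr, qi. auto_derive.
    - repeat split; eexists; [apply HA|apply HB].
    - replace (Derive (fun x0 : R => A x0) t) with ((x + t * x2) * A t - (y + t * y2) * B t)%R
        by (symmetry; apply is_derive_unique, HA).
      replace (Derive (fun x0 : R => B x0) t) with ((y + t * y2) * A t + (x + t * x2) * B t)%R
        by (symmetry; apply is_derive_unique, HB).
      field. }
  assert (HV : forall t : R, is_derive V t 0%R).
  { intros t. unfold V, qr, qi. auto_derive.
    - repeat split; eexists; [apply HB|apply HA].
    - replace (Derive (fun x0 : R => A x0) t) with ((x + t * x2) * A t - (y + t * y2) * B t)%R
        by (symmetry; apply is_derive_unique, HA).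
      replace (Derive (fun x0 : R => B x0) t) with ((y + t * y2) * A t + (x + t * x2) * B t)%R
        by (symmetry; apply is_derive_unique, HB).
      field. }
  assert (U01 : U 0%R = U 1%R) by (apply eq_is_derive; [intros; apply HU|lra]).
  assert (V01 : V 0%R = V 1%R) by (apply eq_is_derive; [intros; apply HV|lra]).
  assert (A0 : A 0%R = 1%R).
  { unfold A. rewrite PSeries_0. unfold ra, a. rewrite i_0. simpl. ring. }
  assert (B0 : B 0%R = 0%R).
  { unfold B. rewrite PSeries_0. unfold ia, a. rewrite i_0. simpl. ring. }
  assert (Q0 : qr 0%R = 0%R) by (unfold qr; field).
  assert (Q0' : qi 0%R = 0%R) by (unfold qi; field).
  unfold U, V in U01, V01. rewrite A0, B0, Q0, Q0', Ropp_0, exp_0, cos_0, sin_0 in *.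
  set (e := exp (- qr 1)%R) in *. set (c := cos (qi 1%R)) in *. set (s := sin (qi 1%R)) in *.
  assert (He : (e * exp (qr 1%R) = 1)%R).
  { unfold e. rewrite <- exp_plus, Rplus_opp_l, exp_0. reflexivity. }
  assert (Hcs : (c * c + s * s = 1)%R).
  { pose proof (sin2_cos2 (qi 1%R)) as H. unfold Rsqr in H. unfold c, s. lra. }
  assert (HA1 : A 1%R = (exp (qr 1%R) * c)%R).
  { transitivity (A 1%R * (c * c + s * s) * (e * exp (qr 1%R)))%R.
    - rewrite He, Hcs. ring.
    - transitivity (exp (qr 1%R) * (c * (e * (A 1%R * c + B 1%R * s))
         - s * (e * (B 1%R * c - A 1%R * s))))%R; [ring|].
      rewrite <- U01, <- V01. ring. }
  assert (HB1 : B 1%R = (exp (qr 1%R) * s)%R).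
  { transitivity (B 1%R * (c * c + s * s) * (e * exp (qr 1%R)))%R.
    - rewrite He, Hcs. ring.
    - transitivity (exp (qr 1%R) * (s * (e * (A 1%R * c + B 1%R * s))
         + c * (e * (B 1%R * c - A 1%R * s))))%R; [ring|].
      rewrite <- U01, <- V01. ring. }
  destruct (absb_exp_series i euler_i (Cmod w) (Cmod_ge_0 w)) as [M HM].
  destruct (ex_val i (Cmod w) M w (Rle_refl _) HM) as [v Hv].
  destruct (is_sum_series _ _ Hv) as [Sr Si].
  assert (Er : Re v = A 1%R).
  { unfold A, PSeries. rewrite <- (is_series_unique _ _ Sr). apply Series_ext.
    intros n. unfold ra, a. rewrite pow1, Rmult_1_r. reflexivity. }
  assert (Ei : Im v = B 1%R).
  { unfold B, PSeries. rewrite <- (is_series_unique _ _ Si). apply Series_ext.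
    intros n. unfold ia, a. rewrite pow1, Rmult_1_r. reflexivity. }
  replace (Cexp (w + w ^ 2 / 2)) with v; auto.
  assert (Hw2 : w ^ 2 / 2 = (x2 / 2, y2 / 2)%R).
  { unfold x2, y2. destruct (w ^ 2) as [p q]. unfold Cdiv, Cinv, Cmult. simpl.
    apply injective_projections; simpl; field. }
  assert (R1 : Re (w + w ^ 2 / 2) = qr 1%R).
  { rewrite Hw2. unfold qr, x. destruct w as [p q]. simpl. field. }
  assert (I1 : Im (w + w ^ 2 / 2) = qi 1%R).
  { rewrite Hw2. unfold qi, y. destruct w as [p q]. simpl. field. }
  unfold Cexp. rewrite R1, I1. fold c s.
  apply injective_projections.
  - change (fst v) with (Re v). rewrite Er, HA1. simpl. ring.
  - change (snd v) with (Im v). rewrite Ei, HB1. simpl. ring.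
Qed.

Lemma Cinv_mul_cancel (u v : C) : u <> 0 -> v = / u * (u * v).
Proof. intros H. field. exact H. Qed.

Ltac to_C := match goal with |- ?a = ?b => change (@eq C a b) end.

Section RingIdentities.
Variable A : calg.
Add Ring A_ring6 : (calg_ring A) (morphism (zr_morph A), constants [zr_cst]).
Local Open Scope calg_scope.

Lemma one_sub_mul (x y : A) : (1 - x) * y = y - x * y.
Proof. ring. Qed.

Lemma opp_mul_leibniz (a b f p : A) :
  - (a * f) * p + f * - (b * p) = - ((a + b) * (f * p)).
Proof. ring. Qed.

End RingIdentities.

Lemma smul_one_r (f : series CC) n : smul f (@aone (series CC)) n = f n.
Proof. rewrite smul_comm. etransitivity; [apply smul_const_l|apply Cmult_1_l]. Qed.

Definition scale (w : C) (f : nat -> C) : series CC := fun k => f k * w ^ k.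

Lemma scale_mul w (f g : series CC) : scale w (f * g)%A = (scale w f * scale w g)%A.
Proof.
  apply functional_extensionality. intros n.
  change (smul f g n * w ^ n = smul (scale w f) (scale w g) n).
  rewrite !smul_antidiag, Cmult_comm, <- lsum_scal. apply lsum_ext.
  intros p Hp. apply in_antidiag in Hp. rewrite <- Hp, Cpow_add_r. unfold scale. ring.
Qed.

Lemma scale_euler w (f : series CC) : euler (scale w f) = scale w (euler f).
Proof. apply functional_extensionality. intros n. apply Cmult_assoc. Qed.

Lemma scale_opp w (f : series CC) : scale w (- f)%A = (- scale w f)%A.
Proof.
  apply functional_extensionality. intros n.
  change (- f n * w ^ n = - (f n * w ^ n)). ring.
Qed.

Lemma val_scale w (f : nat -> C) z v : val f (w * z) v -> val (scale w f) z v.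
Proof.
  intros H. eapply is_sum_ext; [|exact H]. intros k _. simpl. unfold scale.
  rewrite Cpow_mult_l. ring.
Qed.

Lemma val_tail (h : nat -> C) v K N : (0 <= K)%R ->
  (forall k, Cmod (h k) <= K * (/ 2) ^ k)%R -> is_sum (fun _ => True) h v ->
  (Cmod (v - lsum h (seq 0 N)) <= 2 * K * (/ 2) ^ N)%R.
Proof.
  intros HK Hh Hv.
  set (t := fun k => if le_lt_dec N k then h k else 0).
  assert (Ht : is_sum (fun _ : nat => True) t (v - lsum h (seq 0 N))).
  { assert (Hf : is_sum (fun _ : nat => True) (fun k => if le_lt_dec N k then 0 else h k)
                   (lsum h (seq 0 N))).
    { apply (is_sum_extend (fun k => In k (seq 0 N))); auto.
      - intros k _ Hk. destruct (le_lt_dec N k); auto. exfalso. apply Hk, in_seq. lia.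
      - eapply is_sum_ext; [|apply is_sum_finite; [apply seq_NoDup|reflexivity]].
        intros k Hk. apply in_seq in Hk. simpl. destruct (le_lt_dec N k); [lia|auto]. }
    eapply is_sum_ext; [|apply (is_sum_minus _ _ _ _ _ Hv Hf)].
    intros k _. unfold t. simpl. destruct (le_lt_dec N k); ring. }
  apply (is_sum_le _ _ _ (2 * K * (/ 2) ^ N)) in Ht; auto.
  apply summable_nat; [intros; apply Cmod_ge_0|].
  assert (HN : (0 < (/ 2) ^ N)%R) by (apply pow_lt; lra).
  assert (Hm : forall m, (rsum (fun k => Cmod (t k)) (seq 0 (N + m)) <=
                          2 * K * (/ 2) ^ N * (1 - (/ 2) ^ m))%R).
  { induction m as [|m IH].
    - rewrite Nat.add_0_r. simpl. rewrite Rminus_diag, Rmult_0_r.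
      apply Rle_trans with (rsum (fun k => 0 * Cmod (t k)) (seq 0 N))%R.
      + apply rsum_le. intros k Hk. apply in_seq in Hk. unfold t.
        destruct (le_lt_dec N k); [lia|]. rewrite Cmod_0. lra.
      + rewrite rsum_scal. lra.
    - rewrite Nat.add_succ_r, seq_S_end, rsum_app. unfold rsum at 2. simpl map. simpl fold_right.
      assert (H1 : (Cmod (t (N + m)%nat) <= K * ((/ 2) ^ N * (/ 2) ^ m))%R).
      { rewrite <- pow_add. unfold t. destruct (le_lt_dec N (N + m)); [apply Hh|lia]. }
      assert (Hm0 : (0 < (/ 2) ^ m)%R) by (apply pow_lt; lra). simpl. nra. }
  intros n. apply Rle_trans with (rsum (fun k => Cmod (t k)) (seq 0 (N + n))).
  - apply rsum_incl; auto using seq_NoDup.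
    + intros k Hk. apply in_seq in Hk. apply in_seq. lia.
    + intros; apply Cmod_ge_0.
  - eapply Rle_trans; [apply Hm|]. assert (0 < (/ 2) ^ n)%R by (apply pow_lt; lra).
    assert (0 <= 2 * K * (/ 2) ^ N)%R by nra. nra.
Qed.

Lemma net_lim_lsum {T U : Type} (A : T -> Prop) (F : U -> list T -> C) (s : U -> C) (l : list U) :
  (forall u, In u l -> net_lim A (F u) (s u)) ->
  net_lim A (fun x => lsum (fun u => F u x) l) (lsum s l).
Proof.
  induction l as [|u l IH]; intros H.
  - apply (net_lim_const A 0).
  - apply (net_lim_plus A (F u) (fun x => lsum (fun u => F u x) l)).
    + apply H. left; auto.
    + apply IH. intros v Hv. apply H. right; auto.
Qed.

Lemma net_lim_smul {T : Type} (A : T -> Prop) (F H : list T -> series CC) (f h : series CC) n :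
  (forall j, (j <= n)%nat -> net_lim A (fun l => F l j) (f j)) ->
  (forall j, (j <= n)%nat -> net_lim A (fun l => H l j) (h j)) ->
  net_lim A (fun l => smul (F l) (H l) n) (smul f h n).
Proof.
  intros HF HH. rewrite smul_antidiag.
  eapply net_lim_ext; [intros; symmetry; apply smul_antidiag|].
  apply (net_lim_lsum A (fun p l => F l (fst p) * H l (snd p))).
  intros p Hp. apply in_antidiag in Hp. apply net_lim_mult; [apply HF|apply HH]; lia.
Qed.

(** * Convergence of the Weierstrass product *)

Section Product.
Variables (w1 w2 : C) (L : C -> Prop).
Hypothesis HB : is_basis w1 w2 L.
Variable rho : R.
Hypothesis Hrho : (0 < rho)%R.
Hypothesis Hmin : forall x, nonzero_points L x -> (rho <= Cmod x)%R.
Variable G : nat -> C.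
Hypothesis HG : lattice_sums L G.
Variable i : series CC.
Hypothesis i_0 : i O = RtoC 1.
Hypothesis euler_i : euler i = ((sX + sX * sX) * i)%A.

(** Its coefficients of degree 1 and 2 vanish, which reduces convergence of the product to
    summability of [|x|^-3]. *)
Definition primary : series CC := ((aone - sX) * i)%A.

Lemma primary_coef n : (primary (S n) : C) = i (S n) - i n.
Proof.
  unfold primary. replace ((aone - sX) * i)%A with (i - sX * i)%A.
  - rewrite coef_sub, smul_X. reflexivity.
  - symmetry. apply one_sub_mul.
Qed.

Lemma primary_0 : (primary 0%nat : C) = RtoC 1.
Proof.
  change ((RtoC 1 - 0) * i O = RtoC 1). rewrite i_0. ring.
Qed.

Lemma primary_1 : (primary 1%nat : C) = RtoC 0.
Proof. rewrite primary_coef, (exp_series_1 i i_0 euler_i), i_0. ring. Qed.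

Lemma primary_2 : (primary 2%nat : C) = RtoC 0.
Proof.
  rewrite primary_coef. pose proof (exp_series_S i euler_i 0) as H.
  rewrite i_0, (exp_series_1 i i_0 euler_i) in *.
  assert (E : RtoC (INR 2) = 2) by (f_equal; simpl; ring). rewrite E in H.
  assert (N : RtoC 2 <> 0) by (intros E0; apply RtoC_inj in E0; lra).
  transitivity (/ 2 * (2 * i 2%nat) - 1).
  - field.
  - rewrite H. replace (RtoC 1 + RtoC 1) with (RtoC 2).
    + field.
    + rewrite <- RtoC_plus. f_equal.
Qed.

Lemma absb_primary r : (0 <= r)%R -> exists M, absb primary r M.
Proof.
  intros Hr. destruct (absb_exp_series i euler_i r Hr) as [M HM].
  destruct (absb_X r Hr) as [MX HX]. destruct (absb_cst (RtoC 1) r Hr) as [M1 H1].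
  exists ((M1 + MX) * M)%R. apply absb_mul; auto.
  apply (absb_plus (aone : series CC) (fun k => - (@sX CC) k)); auto.
  intros n. eapply Rle_trans; [|apply (HX n)]. apply rsum_le. intros k _.
  rewrite Cmod_opp. lra.
Qed.

Lemma val_primary u : val primary u ((1 - u) * Cexp (u + u ^ 2 / 2)).
Proof.
  pose proof (Cmod_ge_0 u) as Hu.
  destruct (absb_exp_series i euler_i (Cmod u) Hu) as [M HM].
  destruct (absb_X (Cmod u) Hu) as [MX HX]. destruct (absb_cst (RtoC 1) (Cmod u) Hu) as [M1 H1].
  eapply val_mul; [apply Rle_refl| |exact HM| |apply val_exp_series; auto].
  - apply (absb_plus (aone : series CC) (fun k => - (@sX CC) k)); [exact Hu|exact H1|].
    intros n. eapply Rle_trans; [|apply (HX n)]. apply rsum_le. intros k _.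
    rewrite Cmod_opp. apply Rle_refl.
  - apply val_sub; [apply (val_cst (RtoC 1))|apply val_X].
Qed.

Definition factor (x : C) : series CC := scale (/ x) primary.

Definition factor_value (z x : C) : C := (1 - z / x) * Cexp (z / x + z ^ 2 / (2 * x ^ 2)).

Lemma val_factor (z x : C) : x <> 0 -> val (factor x) z (factor_value z x).
Proof.
  intros Hx. apply val_scale. unfold factor_value.
  replace (z / x) with (/ x * z) by (unfold Cdiv; ring).
  replace (z ^ 2 / (2 * x ^ 2)) with ((/ x * z) ^ 2 / 2).
  2:{ field. auto. }
  apply val_primary.
Qed.

(** From degree 3 on, [(rho / |x|)^k] is at most [(rho / |x|)^3], so D can be taken as [rho^3] times
    the norm of [primary] at radius [r / rho]. *)
Lemma absb_factor r : (0 <= r)%R -> exists D, (0 <= D)%R /\ forall x, nonzero_points L x ->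
  absb (factor x) r (1 + D * Cmod ((/ x) ^ 3)).
Proof.
  intros Hr. destruct (absb_primary (r / rho)) as [M HM].
  { apply Rmult_le_pos; auto. apply Rlt_le, Rinv_0_lt_compat; auto. }
  pose proof (absb_pos _ _ _ HM) as HM0.
  assert (Hr3 : (0 < rho ^ 3)%R) by (apply pow_lt; auto).
  exists (rho ^ 3 * M)%R. split; [nra|]. intros x Hx. pose proof (Hmin x Hx) as Hm.
  destruct Hx as [_ Hx0].
  assert (Hix : (0 < / Cmod x)%R) by (apply Rinv_0_lt_compat; lra).
  assert (Hix3 : (0 < (/ Cmod x) ^ 3)%R) by (apply pow_lt; auto).
  intros n.
  apply Rle_trans with (rsum (fun k => (if Nat.eq_dec k 0 then 1 else 0) +
     rho ^ 3 * (/ Cmod x) ^ 3 * (Cmod (primary k) * (r / rho) ^ k))%R (seq 0 n)).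
  - apply rsum_le. intros k _. unfold factor, scale.
    rewrite Cmod_mult, Cmod_pow, Cmod_inv by auto.
    assert (P : (0 <= rho ^ 3 * (/ Cmod x) ^ 3 * (Cmod (primary k) * (r / rho) ^ k))%R).
    { apply Rmult_le_pos; [nra|]. apply Rmult_le_pos; [apply Cmod_ge_0|]. apply pow_le.
      apply Rmult_le_pos; auto. apply Rlt_le, Rinv_0_lt_compat; auto. }
    destruct k as [|[|[|k]]].
    + rewrite primary_0, Cmod_1 in *. simpl in *. lra.
    + rewrite primary_1, Cmod_0 in *. simpl in *. lra.
    + rewrite primary_2, Cmod_0 in *. simpl in *. lra.
    + destruct (Nat.eq_dec (S (S (S k))) 0); [lia|]. rewrite Rplus_0_l.
      set (m := S (S (S k))) in *.
      replace (Cmod (primary m) * (/ Cmod x) ^ m * r ^ m)%R with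
        ((/ Cmod x * rho) ^ m * (Cmod (primary m) * (r / rho) ^ m))%R.
      2:{ replace (r ^ m)%R with ((r / rho) ^ m * rho ^ m)%R
            by (rewrite <- Rpow_mult_distr; f_equal; field; lra).
          rewrite Rpow_mult_distr. ring. }
      apply Rmult_le_compat_r.
      { apply Rmult_le_pos; [apply Cmod_ge_0|]. apply pow_le.
        apply Rmult_le_pos; auto. apply Rlt_le, Rinv_0_lt_compat; auto. }
      rewrite <- Rpow_mult_distr, (Rmult_comm rho).
      assert (Hq : (0 <= / Cmod x * rho <= 1)%R).
      { split; [nra|]. apply Rmult_le_reg_l with (Cmod x); [lra|].
        rewrite <- Rmult_assoc, Rinv_r by lra. lra. }
      set (q := (/ Cmod x * rho)%R) in *.
      replace m with (3 + k)%nat by (unfold m; lia). rewrite pow_add.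
      assert (q ^ k <= 1)%R by (rewrite <- (pow1 k); apply pow_incr; lra).
      assert (0 <= q ^ 3)%R by (apply pow_le; lra). nra.
  - assert (E : forall (f g : nat -> R) l, rsum (fun k => f k + g k)%R l = (rsum f l + rsum g l)%R).
    { clear. intros f g l. unfold rsum. induction l as [|k l IH]; simpl; [ring|].
      rewrite IH. ring. }
    rewrite E, rsum_scal. apply Rplus_le_compat.
    + destruct n as [|n]; [unfold rsum; simpl; lra|].
      change (seq 0 (S n)) with (0%nat :: seq 1 n).
      change (1 + rsum (fun k => if Nat.eq_dec k 0 then 1 else 0) (seq 1 n) <= 1)%R.
      assert (rsum (fun k => if Nat.eq_dec k 0 then 1 else 0)%R (seq 1 n) <=
              rsum (fun k => 0 * 0)%R (seq 1 n))%R.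
      { apply rsum_le. intros k Hk. apply in_seq in Hk. destruct (Nat.eq_dec k 0); [lia|lra]. }
      rewrite rsum_scal in H. lra.
    + rewrite Cmod_pow, Cmod_inv by auto.
      replace (rho ^ 3 * M * (/ Cmod x) ^ 3)%R with (rho ^ 3 * (/ Cmod x) ^ 3 * M)%R by ring.
      apply Rmult_le_compat_l; [nra|]. apply HM.
Qed.

Definition pseries (l : list C) : series CC :=
  fold_right (fun x s => (factor x * s)%A) aone l.

(** The norm is submultiplicative and 1 + t <= exp t, so the bound is the exponential of a
    convergent sum. *)
Lemma absb_pseries r : (0 <= r)%R -> exists K, (0 <= K)%R /\ forall l, NoDup l ->
  Forall (nonzero_points L) l -> absb (pseries l) r K.
Proof.
  intros Hr. destruct (absb_factor r Hr) as (D & HD & Hf).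
  destruct (inv_pow_summable w1 w2 L HB rho Hrho Hmin) as (M & HM0 & HM).
  specialize (HM 3%nat ltac:(lia)).
  assert (Hr3 : (0 < rho ^ 3)%R) by (apply pow_lt; auto).
  exists (exp (D * (/ rho ^ 3 * M))). split; [apply Rlt_le, exp_pos|].
  intros l Hn Hl.
  assert (Hs : (rsum (fun x => Cmod ((/ x) ^ 3)) l <= / rho ^ 3 * M)%R).
  { specialize (HM l Hn Hl). apply Rmult_le_reg_l with (rho ^ 3)%R; auto.
    rewrite <- Rmult_assoc, Rinv_r, Rmult_1_l by lra. rewrite <- rsum_scal.
    eapply Rle_trans; [|exact HM]. apply rsum_le. intros. lra. }
  assert (Hb : absb (pseries l) r (exp (D * rsum (fun x => Cmod ((/ x) ^ 3)) l))).
  { clear - Hl Hf HD Hr. induction Hl as [|x l Hx Hl IH].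
    - unfold rsum. simpl. rewrite Rmult_0_r, exp_0. intros n.
      destruct n as [|n]; [unfold rsum; simpl; lra|].
      pose proof (absb_zero_beyond (aone : series CC) r 1 Hr) as H.
      eapply Rle_trans; [apply H|].
      + intros [|k] Hk; [lia|reflexivity].
      + unfold rsum. simpl. change ((aone : series CC) 0%nat) with (RtoC 1).
        rewrite Cmod_1. lra.
    - change (pseries (x :: l)) with (factor x * pseries l)%A.
      change (rsum (fun x => Cmod ((/ x) ^ 3)) (x :: l))
        with (Cmod ((/ x) ^ 3) + rsum (fun x => Cmod ((/ x) ^ 3)) l)%R.
      rewrite Rmult_plus_distr_l, exp_plus. intros n.
      pose proof (absb_mul _ _ r _ _ Hr (Hf x Hx) IH n) as H.
      eapply Rle_trans; [exact H|]. apply Rmult_le_compat_r; [apply Rlt_le, exp_pos|].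
      apply exp_ineq1_le. }
  intros n. eapply Rle_trans; [apply Hb|].
  assert (Hle : (D * rsum (fun x => Cmod ((/ x) ^ 3)) l <= D * (/ rho ^ 3 * M))%R)
    by (apply Rmult_le_compat_l; auto).
  destruct Hle as [Hlt|E]; [left; apply exp_increasing; auto|rewrite E; lra].
Qed.

Lemma val_pseries z l : NoDup l -> Forall (nonzero_points L) l ->
  val (pseries l) z (fold_right Cmult 1 (map (factor_value z) l)).
Proof.
  pose proof (Cmod_ge_0 z) as Hz.
  destruct (absb_factor (Cmod z) Hz) as (D & HD & Hf).
  destruct (absb_pseries (Cmod z) Hz) as (K & HK & HP).
  intros Hn Hl. induction Hn as [|x l Hx Hn IH].
  - apply (val_cst (RtoC 1)).
  - inversion Hl as [|? ? Hx1 Hl1]; subst.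
    change (pseries (x :: l)) with (factor x * pseries l)%A.
    eapply val_mul; [apply Rle_refl|apply (Hf x Hx1)|apply (HP l); auto| |apply IH; auto].
    apply val_factor, Hx1.
Qed.

Definition cubic_tail : series CC := (sX * sX * sX * (aone + geom))%A.

Lemma cubic_tail_coef j : (cubic_tail j : C) = if le_lt_dec 3 j then RtoC 1 else RtoC 0.
Proof.
  assert (E : cubic_tail = (@sX CC * (@sX CC * (@sX CC * (aone + @geom CC))))%A).
  { unfold cubic_tail. rewrite !(Rmul_assoc (calg_ring (series CC))). reflexivity. }
  rewrite E. clear E.
  rewrite <- geom_X. destruct j as [|[|[|j]]]; rewrite ?smul_X; reflexivity.
Qed.

(** [G] restricted to a finite set; its negative is the logarithmic derivative z d/dz of the partial
    product. *)
Definition log_sums (l : list C) : series CC :=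
  fun j => if le_lt_dec 3 j then lsum (fun x => (/ x) ^ j) l else RtoC 0.

Lemma euler_pseries l : euler (pseries l) = (- (log_sums l * pseries l))%A.
Proof.
  assert (Hf : forall x, euler (factor x) = (- (scale (/ x) cubic_tail * factor x))%A).
  { intros x. unfold factor. rewrite scale_euler. unfold primary.
    rewrite (euler_primary CC i euler_i), scale_opp, scale_mul. reflexivity. }
  induction l as [|x l IH].
  - change (pseries nil) with (aone : series CC).
    rewrite (euler_const CC (aone : CC) : euler (aone : series CC) = azero).
    apply functional_extensionality. intros n.
    change (RtoC 0 = - smul (log_sums nil) (aone : series CC) n).
    rewrite smul_one_r.
    unfold log_sums. destruct (le_lt_dec 3 n); unfold lsum; simpl; ring.
  - change (pseries (x :: l)) with (factor x * pseries l)%A.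
    rewrite (d_mul _ (euler_derivation CC)), Hf, IH.
    replace (log_sums (x :: l)) with (scale (/ x) cubic_tail + log_sums l)%A.
    + apply opp_mul_leibniz.
    + apply functional_extensionality. intros j. rewrite coef_add. unfold scale.
      rewrite cubic_tail_coef. unfold log_sums. destruct (le_lt_dec 3 j).
      * change (1 * (/ x) ^ j + lsum (fun x => (/ x) ^ j) l = lsum (fun x => (/ x) ^ j) (x :: l)).
        rewrite Cmult_1_l. reflexivity.
      * change (0 * (/ x) ^ j + 0 = 0). ring.
Qed.

Variable c : series CC.
Hypothesis c_0 : c O = RtoC 1.
Hypothesis euler_c : euler c = (zeta_series CC (wp_series G) * c - c)%A.

(** The expansion zeta = 1/z - sum [G k z^(k-1)]: the factor k - 1 in wp cancels on integration. *)
Lemma zeta_wp_coef j : tl (zeta_series CC (wp_series G)) j = - G (S j).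
Proof.
  destruct HG as (G0 & G1 & G2 & GS). unfold tl.
  destruct j as [|j].
  - change (@eq C (RtoC 0) (- G 1%nat)). rewrite G1. ring.
  - change (zeta_series CC (wp_series G) (S (S j))) with
      (/ RtoC (IZR (Z.of_nat (S (S j)) - 1)) * - (0 + @geom_pow CC 2 (S (S j)) * G (S (S j)))).
    pose proof (geom_pow_coef CC 1 (S (S j)) ltac:(lia)) as H.
    rewrite <- zr_sub in H. 
    change (RtoC 1 * @geom_pow CC 2 (S (S j)) =
      RtoC (IZR (Z.of_nat (S (S j)) - 1)) * @geom_pow CC 1 (S (S j))) in H.
    rewrite Cmult_1_l in H. rewrite H.
    replace (@geom_pow CC 1 (S (S j))) with (RtoC 1).
    + to_C. generalize (G (S (S j)) : C). intros g. field. intros E. apply RtoC_inj, eq_IZR in E. lia.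
    + unfold geom_pow. change (RtoC 1 = smul geom (aone : series CC) (S (S j))).
      rewrite smul_one_r. reflexivity.
Qed.

Lemma sigma_series_S n : c (S n) = / RtoC (IZR (Z.of_nat (S n))) *
  smul (tl (zeta_series CC (wp_series G))) c n.
Proof.
  pose proof (f_equal (fun f => f (S n)) euler_c) as H. cbv beta in H.
  rewrite coef_sub, coef_mul in H. unfold euler in H.
  change (RtoC (IZR (Z.of_nat (S n))) * c (S n) =
    (RtoC 1 * c (S n) + smul (tl (zeta_series CC (wp_series G))) c n - c (S n))%C) in H.
  replace (smul (tl (zeta_series CC (wp_series G))) c n : C)
    with (RtoC (IZR (Z.of_nat (S n))) * c (S n)).
  - apply Cinv_mul_cancel. intros E. apply RtoC_inj, eq_IZR in E. lia.
  - rewrite H. ring.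
Qed.

Lemma pseries_S l n : pseries l (S n) = / RtoC (IZR (Z.of_nat (S n))) *
  smul (A := CC) (fun j => - log_sums l (S j)) (pseries l) n.
Proof.
  pose proof (f_equal (fun f => f (S n)) (euler_pseries l)) as H. cbv beta in H.
  rewrite coef_opp, coef_mul in H. unfold euler in H.
  change (RtoC (IZR (Z.of_nat (S n))) * pseries l (S n) =
    - (RtoC 0 * pseries l (S n) + smul (tl (log_sums l)) (pseries l) n)%C) in H.
  replace (smul (A := CC) (fun j => - log_sums l (S j)) (pseries l) n : C)
    with (RtoC (IZR (Z.of_nat (S n))) * pseries l (S n)).
  - apply Cinv_mul_cancel. intros E. apply RtoC_inj, eq_IZR in E. lia.
  - rewrite H, !smul_antidiag.
    rewrite (lsum_ext (fun p => - log_sums l (S (fst p)) * pseries l (snd p))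
      (fun p => - (1) * (tl (log_sums l) (fst p) * pseries l (snd p)))).
    + rewrite lsum_scal. ring.
    + intros p _. unfold tl. ring.
Qed.

Lemma pseries_0 l : pseries l O = RtoC 1.
Proof.
  induction l as [|x l IH]; [reflexivity|].
  change (factor x O * pseries l O = RtoC 1). rewrite IH. unfold factor, scale.
  rewrite primary_0. simpl. ring.
Qed.

(** [pseries_S] and [sigma_series_S] are the same recursion, with finite sums [log_sums] in place of
    [G]; the limit passes through the finite convolution. *)
Lemma pseries_lim k : net_lim (nonzero_points L) (fun l => pseries l k) (c k).
Proof.
  induction k as [k IH] using lt_wf_ind. destruct k as [|n].
  - rewrite c_0. eapply net_lim_ext; [|apply net_lim_const].
    intros l _ _. symmetry. apply pseries_0.
  - rewrite sigma_series_S. eapply net_lim_ext; [intros; symmetry; apply pseries_S|].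
    apply (net_lim_mult _ (fun _ => / RtoC (IZR (Z.of_nat (S n))))); [apply net_lim_const|].
    apply (net_lim_smul _ (fun l j => - log_sums l (S j))).
    + intros j Hj. rewrite zeta_wp_coef. destruct HG as (G0 & G1 & G2 & GS).
      unfold log_sums. destruct (le_lt_dec 3 (S j)) as [Hj3|Hj3].
      * specialize (GS (S j) Hj3). apply is_sum_net in GS.
        replace (- G (S j)) with (- (1) * G (S j)) by ring.
        eapply net_lim_ext; [|apply net_lim_mult; [apply (net_lim_const _ (- (1)))|exact GS]].
        intros l _ _. simpl. ring.
      * replace (- G (S j)) with (- (0)); [apply net_lim_const|].
        destruct j as [|[|j]]; [rewrite G1|rewrite G2|lia]; reflexivity.
    + intros j Hj. apply IH. lia.
Qed.

Lemma sigma_product z : exists p, is_prod (nonzero_points L) (factor_value z) p /\ val c z p.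
Proof.
  (* This radius gives |z| / r <= 1/2, so a norm bound at r becomes the majorant [K / 2^k] for the
     terms at z. *)
  pose proof (Cmod_ge_0 z) as Hz. set (r := (2 * Cmod z + 1)%R).
  destruct (absb_pseries r) as (K & HK & HP); [unfold r; lra|].
  assert (Hzr : (Cmod z / r <= / 2)%R).
  { apply Rle_div_l; unfold r; lra. }
  assert (Hzr0 : (0 <= Cmod z / r)%R).
  { apply Rmult_le_pos; auto. apply Rlt_le, Rinv_0_lt_compat. unfold r; lra. }
  assert (Hterm : forall f : nat -> C, (forall k, Cmod (f k) * r ^ k <= K)%R ->
     forall k, (Cmod (f k * z ^ k) <= K * (/ 2) ^ k)%R).
  { intros f Hf k. rewrite Cmod_mult, Cmod_pow.
    replace (Cmod z ^ k)%R with (r ^ k * (Cmod z / r) ^ k)%R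
      by (rewrite <- Rpow_mult_distr; f_equal; field; unfold r; lra).
    rewrite <- Rmult_assoc. apply Rmult_le_compat; auto.
    - apply Rmult_le_pos; [apply Cmod_ge_0|]. apply pow_le. unfold r; lra.
    - apply pow_le; auto.
    - apply pow_incr; auto. }
  assert (Hpb : forall l, NoDup l -> Forall (nonzero_points L) l ->
     forall k, (Cmod (pseries l k) * r ^ k <= K)%R).
  { intros l Hn Hl k. apply absb_coef; [unfold r; lra|auto]. }
  assert (Hcb : forall k, (Cmod (c k) * r ^ k <= K)%R).
  { intros k. assert (Hrk : (0 < r ^ k)%R) by (apply pow_lt; unfold r; lra).
    assert (H : (Cmod (c k) <= K / r ^ k)%R).
    { apply (net_lim_le (nonzero_points L) (fun l => pseries l k)); [|apply pseries_lim].
      intros l Hn Hl. apply Rle_div_r; auto. }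
    apply Rle_div_r in H; auto. }
  pose proof (Hterm c Hcb) as Hc.
  assert (Hcv : exists p, val c z p).
  { destruct (ex_is_sum (fun _ : nat => True) (fun k => c k * z ^ k) (2 * K)) as (p & Hp & _).
    - apply summable_nat; [intros; apply Cmod_ge_0|]. intros n.
      apply Rle_trans with (2 * K * rsum (fun k => (/ 2) ^ S k)%R (seq 0 n))%R.
      + rewrite <- rsum_scal. apply rsum_le. intros k _. simpl. specialize (Hc k). lra.
      + pose proof (pow_half_sum n). assert (0 < (/ 2) ^ n)%R by (apply pow_lt; lra). nra.
    - exists p. exact Hp. }
  destruct Hcv as [p Hp]. exists p. split; auto.
  apply (net_lim_filterlim (nonzero_points L)
    (fun l => fold_right Cmult 1 (map (factor_value z) l))).
  intros eps He.
  (* [N] makes the tails of the partial product and of the limit at most eps/4 each; the head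
     converges coefficientwise and takes another eps/4. *)
  destruct (pow_lt_1_zero (/ 2) ltac:(rewrite Rabs_pos_eq; lra) (eps / (8 * (K + 1))))
    as [N HN]; [apply Rdiv_lt_0_compat; lra|].
  specialize (HN N (le_n N)). rewrite Rabs_pos_eq in HN by (apply pow_le; lra).
  assert (Htail : (2 * K * (/ 2) ^ N <= eps / 4)%R).
  { assert (0 < (/ 2) ^ N)%R by (apply pow_lt; lra).
    apply Rle_trans with (2 * (K + 1) * (eps / (8 * (K + 1))))%R.
    - apply Rmult_le_compat; lra.
    - right. field. lra. }
  assert (Hfin : net_lim (nonzero_points L) (fun l => lsum (fun k => pseries l k * z ^ k) (seq 0 N))
                   (lsum (fun k => c k * z ^ k) (seq 0 N))).
  { apply (net_lim_lsum _ (fun k l => pseries l k * z ^ k)). intros k _.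
    apply (net_lim_mult _ (fun l => pseries l k) (fun _ => z ^ k));
      [apply pseries_lim|apply net_lim_const]. }
  destruct (Hfin (eps / 4)%R ltac:(lra)) as (l0 & L1 & L2 & L3).
  exists l0. split; [|split]; auto. intros l Hn Hl Hi. specialize (L3 l Hn Hl Hi).
  pose proof (val_pseries z l Hn Hl) as Hv. set (v := fold_right _ _ _) in *.
  pose proof (val_tail _ v K N HK (Hterm _ (Hpb l Hn Hl)) Hv) as T1.
  pose proof (val_tail _ p K N HK Hc Hp) as T2.
  set (s1 := lsum (fun k => pseries l k * z ^ k) (seq 0 N)) in *.
  set (s2 := lsum (fun k => c k * z ^ k) (seq 0 N)) in *.
  replace (v - p) with ((v - s1) + ((s1 - s2) + - (p - s2))) by ring.
  eapply Rle_lt_trans; [apply Cmod_triangle|].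
  assert (Cmod (s1 - s2 + - (p - s2)) <= Cmod (s1 - s2) + Cmod (p - s2))%R.
  { eapply Rle_trans; [apply Cmod_triangle|]. rewrite Cmod_opp. lra. }
  lra.
Qed.

End Product.

(** * Holomorphy in three variables *)

Lemma pow_half_summable : summable (fun _ : nat => True) (fun n => (/ 2) ^ n)%R 2.
Proof.
  apply summable_nat; [intros; apply pow_le; lra|]. intros n.
  apply Rle_trans with (2 * rsum (fun k => (/ 2) ^ S k)%R (seq 0 n))%R.
  - rewrite <- rsum_scal. apply rsum_le. intros k _. simpl. lra.
  - pose proof (pow_half_sum n). assert (0 < (/ 2) ^ n)%R by (apply pow_lt; lra). lra.
Qed.

Definition sigma_term (a : Z -> Z -> C) (p : C * C * C) (mn : nat * nat) : C :=
  a (Z.of_nat (fst mn)) (Z.of_nat (snd mn)) * snd (fst p) ^ fst mn * snd p ^ snd mn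
  * fst (fst p) ^ (4 * fst mn + 6 * snd mn + 1).

(** The exponents add up to at most 7(m+n) + 1, so decay at rate [(2 r^7)^-(m+n)] leaves a double
    geometric series. *)
Lemma weight_summable a r : is_sigma_coefficients a -> (1 <= r)%R -> exists S,
  summable (fun _ : nat * nat => True)
    (fun mn => Cmod (a (Z.of_nat (fst mn)) (Z.of_nat (snd mn))) *
               r ^ (fst mn + snd mn + (4 * fst mn + 6 * snd mn + 1)))%R S.
Proof.
  intros Ha Hr. assert (H7 : (1 <= r ^ 7)%R) by (apply pow_R1_Rle; auto).
  destruct (sigma_coefficient_decay a (2 * r ^ 7) Ha ltac:(lra)) as [M HM].
  assert (HM0 : (0 <= M)%R).
  { eapply Rle_trans; [|apply (HM 0%nat 0%nat)].
    apply Rmult_le_pos; [apply Cmod_ge_0|apply pow_le; lra]. }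
  assert (Hsum : summable (cross (fun _ : nat => True) (fun _ : nat => True))
     (fun mn => (M * r) * ((/ 2) ^ fst mn * (/ 2) ^ snd mn))%R (M * r * (2 * 2))).
  { apply (summable_scal _ (fun mn => (/ 2) ^ fst mn * (/ 2) ^ snd mn)%R);
      [apply Rmult_le_pos; lra|].
    apply (summable_prod _ _ (fun n => (/ 2) ^ n)%R (fun n => (/ 2) ^ n)%R);
      try (intros; apply pow_le; lra); apply pow_half_summable. }
  exists (M * r * (2 * 2))%R.
  intros l Hn _. eapply Rle_trans; [|apply (Hsum l Hn)].
  2:{ apply Forall_forall. intros x _. split; exact I. }
  apply rsum_le. intros [m n] _. cbn [fst snd]. specialize (HM m n).
  rewrite Rpow_mult_distr in HM.
  set (A := Cmod (a (Z.of_nat m) (Z.of_nat n))) in *.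
  assert (HA : (0 <= A)%R) by apply Cmod_ge_0.
  rewrite <- pow_add, pow_inv.
  assert (H2 : (0 < 2 ^ (m + n))%R) by (apply pow_lt; lra).
  apply Rle_trans with (A * ((r ^ 7) ^ (m + n) * r))%R.
  - apply Rmult_le_compat_l; auto. rewrite <- pow_mult.
    replace ((r ^ (7 * (m + n)) * r))%R with (r ^ (7 * (m + n) + 1))%R
      by (rewrite pow_add; simpl; ring).
    apply Rle_pow; auto. lia.
  - apply Rmult_le_reg_r with (2 ^ (m + n))%R; auto.
    replace (M * r * / 2 ^ (m + n) * 2 ^ (m + n))%R with (M * r)%R by (field; lra).
    replace (A * ((r ^ 7) ^ (m + n) * r) * 2 ^ (m + n))%R
      with (A * (2 ^ (m + n) * (r ^ 7) ^ (m + n)) * r)%R by ring.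
    apply Rmult_le_compat_r; lra.
Qed.

Section Differentiability.
Variables (z0 u0 v0 : C).

Definition dist3 (p : C * C * C) : R :=
  (Cmod (fst (fst p) - z0) + Cmod (snd (fst p) - u0) + Cmod (snd p - v0))%R.

Definition lin3 (d : C * C * C) (p : C * C * C) : C :=
  fst (fst d) * (fst (fst p) - z0) + snd (fst d) * (snd (fst p) - u0) + snd d * (snd p - v0).

Definition center3 : C * C * C := (z0, u0, v0).

Lemma dist3_pos p : (0 <= dist3 p)%R.
Proof.
  unfold dist3. pose proof (Cmod_ge_0 (fst (fst p) - z0)).
  pose proof (Cmod_ge_0 (snd (fst p) - u0)). pose proof (Cmod_ge_0 (snd p - v0)). lra.
Qed.

(* First-order expansion of [f] at [center3] with differential [d]; the single constant [M] makes
   the class closed under products. *)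
Definition expands (M : R) (f : C * C * C -> C) (d : C * C * C) : Prop :=
  (Cmod (fst (fst d)) <= M)%R /\ (Cmod (snd (fst d)) <= M)%R /\ (Cmod (snd d) <= M)%R /\
  forall p, (dist3 p <= 1)%R ->
    (Cmod (f p) <= M)%R /\ (Cmod (f p - f center3) <= M * dist3 p)%R /\
    (Cmod (f p - f center3 - lin3 d p) <= M * (dist3 p * dist3 p))%R.

Lemma lin3_le M d p : (Cmod (fst (fst d)) <= M)%R -> (Cmod (snd (fst d)) <= M)%R ->
  (Cmod (snd d) <= M)%R -> (Cmod (lin3 d p) <= M * dist3 p)%R.
Proof.
  intros H1 H2 H3. unfold lin3, dist3.
  eapply Rle_trans; [apply Cmod_triangle|].
  eapply Rle_trans; [apply Rplus_le_compat_r, Cmod_triangle|].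
  rewrite !Cmod_mult, !Rmult_plus_distr_l.
  repeat apply Rplus_le_compat; apply Rmult_le_compat_r; auto using Cmod_ge_0.
Qed.

Lemma dist3_center3 : dist3 center3 = 0%R.
Proof.
  unfold dist3, center3. simpl. replace (z0 - z0) with (RtoC 0) by ring.
  replace (u0 - u0) with (RtoC 0) by ring. replace (v0 - v0) with (RtoC 0) by ring.
  rewrite Cmod_0. ring.
Qed.

(** Leibniz' rule. The remainder is a sum of three products, each bounded by M N times the squared
    distance, whence the factor 3. *)
Lemma expands_mul M N f g d e : expands M f d -> expands N g e ->
  exists h, expands (3 * M * N) (fun p => f p * g p) h.
Proof.
  intros (D1 & D2 & D3 & Hf) (E1 & E2 & E3 & Hg).
  destruct (Hf center3) as [F0 _]; [rewrite dist3_center3; lra|].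
  destruct (Hg center3) as [G0 _]; [rewrite dist3_center3; lra|].
  pose proof (Cmod_ge_0 (f center3)) as Pf. pose proof (Cmod_ge_0 (g center3)) as Pg.
  assert (HM : (0 <= M)%R) by lra. assert (HN : (0 <= N)%R) by lra.
  assert (HMN : (0 <= M * N)%R) by (apply Rmult_le_pos; auto).
  exists (g center3 * fst (fst d) + f center3 * fst (fst e), g center3 * snd (fst d) + f center3 * snd (fst e),
          g center3 * snd d + f center3 * snd e).
  assert (Hc : forall x y, (Cmod x <= M)%R -> (Cmod y <= N)%R ->
     (Cmod (g center3 * x + f center3 * y) <= 3 * M * N)%R).
  { intros x y Hx Hy. eapply Rle_trans; [apply Cmod_triangle|]. rewrite !Cmod_mult.
    assert (Cmod (g center3) * Cmod x <= N * M)%R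
      by (apply Rmult_le_compat; auto using Cmod_ge_0).
    assert (Cmod (f center3) * Cmod y <= M * N)%R
      by (apply Rmult_le_compat; auto using Cmod_ge_0). lra. }
  split; [|split; [|split]]; try (apply Hc; auto).
  intros p Hp. destruct (Hf p Hp) as (F1 & F2 & F3). destruct (Hg p Hp) as (G1 & G2 & G3).
  pose proof (dist3_pos p) as Hd. set (t := dist3 p) in *.
  pose proof (lin3_le M d p D1 D2 D3) as HL. fold t in HL.
  assert (K1 : forall x y (A B : R), (Cmod x <= A)%R -> (Cmod y <= B)%R ->
             (Cmod (x * y) <= A * B)%R).
  { intros x y A B Hx Hy. rewrite Cmod_mult. apply Rmult_le_compat; auto using Cmod_ge_0. }
  split; [|split].
  - eapply Rle_trans; [apply K1; eauto|]. lra.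
  - replace (f p * g p - f center3 * g center3) with ((f p - f center3) * g p + f center3 * (g p - g center3)) by ring.
    eapply Rle_trans; [apply Cmod_triangle|].
    pose proof (K1 _ _ _ _ F2 G1). pose proof (K1 _ _ _ _ F0 G2).
    assert (0 <= M * N * t)%R by (apply Rmult_le_pos; auto). lra.
  - replace (f p * g p - f center3 * g center3 - lin3 _ p) with
      ((f p - f center3 - lin3 d p) * g p + (lin3 d p * (g p - g center3)
        + f center3 * (g p - g center3 - lin3 e p))) by (unfold lin3; simpl; ring).
    eapply Rle_trans; [apply Cmod_triangle|].
    eapply Rle_trans; [apply Rplus_le_compat_l, Cmod_triangle|].
    pose proof (K1 _ _ _ _ F3 G1). pose proof (K1 _ _ _ _ HL G2). pose proof (K1 _ _ _ _ F0 G3).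
    lra.
Qed.

Variable r : R.
Hypothesis Hr : (1 <= r)%R.
Hypotheses (Hz : (Cmod z0 + 1 <= r)%R) (Hu : (Cmod u0 + 1 <= r)%R) (Hv : (Cmod v0 + 1 <= r)%R).

Lemma Cmod_near (x y : C) : (Cmod x <= Cmod y + Cmod (x - y))%R.
Proof.
  replace x with (y + (x - y)) at 1 by ring. apply Cmod_triangle.
Qed.

Lemma expands_z : expands r (fun p => fst (fst p)) (RtoC 1, RtoC 0, RtoC 0).
Proof.
  split; [|split; [|split]]; cbn [fst snd]; rewrite ?Cmod_1, ?Cmod_0; try lra.
  intros p Hp. pose proof (dist3_pos p) as Hd. unfold lin3, center3. cbn [fst snd].
  assert (Hrd : (dist3 p <= r * dist3 p)%R) by nra.
  assert (Hdd : (0 <= r * (dist3 p * dist3 p))%R) by nra.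
  pose proof (Cmod_ge_0 (snd (fst p) - u0)). pose proof (Cmod_ge_0 (snd p - v0)).
  pose proof (Cmod_near (fst (fst p)) z0). unfold dist3 in *.
  split; [lra|]. split; [lra|].
  match goal with |- (Cmod ?x <= _)%R => replace x with (RtoC 0) by ring end.
  rewrite Cmod_0. exact Hdd.
Qed.

Lemma expands_u : expands r (fun p => snd (fst p)) (RtoC 0, RtoC 1, RtoC 0).
Proof.
  split; [|split; [|split]]; cbn [fst snd]; rewrite ?Cmod_1, ?Cmod_0; try lra.
  intros p Hp. pose proof (dist3_pos p) as Hd. unfold lin3, center3. cbn [fst snd].
  assert (Hrd : (dist3 p <= r * dist3 p)%R) by nra.
  assert (Hdd : (0 <= r * (dist3 p * dist3 p))%R) by nra.
  pose proof (Cmod_ge_0 (fst (fst p) - z0)). pose proof (Cmod_ge_0 (snd p - v0)).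
  pose proof (Cmod_near (snd (fst p)) u0). unfold dist3 in *.
  split; [lra|]. split; [lra|].
  match goal with |- (Cmod ?x <= _)%R => replace x with (RtoC 0) by ring end.
  rewrite Cmod_0. exact Hdd.
Qed.

Lemma expands_v : expands r (fun p => snd p) (RtoC 0, RtoC 0, RtoC 1).
Proof.
  split; [|split; [|split]]; cbn [fst snd]; rewrite ?Cmod_1, ?Cmod_0; try lra.
  intros p Hp. pose proof (dist3_pos p) as Hd. unfold lin3, center3. cbn [fst snd].
  assert (Hrd : (dist3 p <= r * dist3 p)%R) by nra.
  assert (Hdd : (0 <= r * (dist3 p * dist3 p))%R) by nra.
  pose proof (Cmod_ge_0 (fst (fst p) - z0)). pose proof (Cmod_ge_0 (snd (fst p) - u0)).
  pose proof (Cmod_near (snd p) v0). unfold dist3 in *.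
  split; [lra|]. split; [lra|].
  match goal with |- (Cmod ?x <= _)%R => replace x with (RtoC 0) by ring end.
  rewrite Cmod_0. exact Hdd.
Qed.

Lemma expands_pow f d n : expands r f d ->
  exists e, expands ((3 * r) ^ n) (fun p => f p ^ n) e.
Proof.
  intros Hf. induction n as [|n [e He]].
  - exists (RtoC 0, RtoC 0, RtoC 0).
    split; [|split; [|split]]; cbn [fst snd]; rewrite ?Cmod_0; simpl; try lra.
    intros p Hp. pose proof (dist3_pos p). rewrite Cmod_1. split; [lra|].
    unfold lin3. simpl. split.
    + replace (1 - 1) with (RtoC 0) by ring. rewrite Cmod_0. lra.
    + match goal with |- (Cmod ?x <= _)%R => replace x with (RtoC 0) by ring end.
      rewrite Cmod_0. nra.
  - destruct (expands_mul _ _ _ _ _ _ Hf He) as [h Hh]. exists h.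
    simpl. replace (3 * r * (3 * r) ^ n)%R with (3 * r * (3 * r) ^ n)%R by ring. exact Hh.
Qed.

(** The three powers give [3 r] to the total degree, and the two multiplications joining them give
    9. *)
Lemma expands_term a mn : exists h,
  expands (9 * (Cmod (a (Z.of_nat (fst mn)) (Z.of_nat (snd mn))) *
    (3 * r) ^ (fst mn + snd mn + (4 * fst mn + 6 * snd mn + 1))))
    (fun p => sigma_term a p mn) h.
Proof.
  destruct mn as [m n]. cbn [fst snd]. set (k := (4 * m + 6 * n + 1)%nat).
  destruct (expands_pow _ _ m expands_u) as [d1 H1].
  destruct (expands_pow _ _ n expands_v) as [d2 H2].
  destruct (expands_pow _ _ k expands_z) as [d3 H3].
  destruct (expands_mul _ _ _ _ _ _ H1 H2) as [d4 H4].
  destruct (expands_mul _ _ _ _ _ _ H4 H3) as [d5 H5].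
  set (c := a (Z.of_nat m) (Z.of_nat n)).
  exists (c * fst (fst d5), c * snd (fst d5), c * snd d5).
  destruct H5 as (A1 & A2 & A3 & H5).
  replace (9 * (Cmod c * (3 * r) ^ (m + n + k)))%R
    with (Cmod c * (3 * (3 * (3 * r) ^ m * (3 * r) ^ n) * (3 * r) ^ k))%R
    by (rewrite !pow_add; ring).
  set (W := (3 * (3 * (3 * r) ^ m * (3 * r) ^ n) * (3 * r) ^ k)%R) in *.
  pose proof (Cmod_ge_0 c) as Hc.
  split; [|split; [|split]]; cbn [fst snd]; rewrite ?Cmod_mult;
    try (apply Rmult_le_compat_l; auto).
  intros p Hp. destruct (H5 p Hp) as (B1 & B2 & B3). unfold sigma_term. cbn [fst snd].
  fold c k.
  assert (E : forall q : C * C * C, c * snd (fst q) ^ m * snd q ^ n * fst (fst q) ^ k =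
     c * (snd (fst q) ^ m * snd q ^ n * fst (fst q) ^ k)) by (intros; ring).
  rewrite !E. split; [|split].
  - rewrite Cmod_mult. apply Rmult_le_compat_l; auto.
  - match goal with |- (Cmod (?x * ?s - ?x * ?t) <= _)%R =>
      replace (x * s - x * t) with (x * (s - t)) by ring end.
    rewrite Cmod_mult, Rmult_assoc. apply Rmult_le_compat_l; auto.
  - replace (lin3 _ p) with (c * lin3 d5 p) by (unfold lin3; simpl; ring).
    match goal with |- (Cmod (?x * ?s - ?x * ?t - ?x * ?w) <= _)%R =>
      replace (x * s - x * t - x * w) with (x * (s - t - w)) by ring end.
    rewrite Cmod_mult, Rmult_assoc. apply Rmult_le_compat_l; auto.
Qed.

(** The constants of the terms are summable, so the differentials and the remainders can be summed
    termwise. *)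
Lemma expands_series a (F : C * C * C -> C) : is_sigma_coefficients a ->
  (forall p, is_sum (fun _ : nat * nat => True) (sigma_term a p) (F p)) ->
  exists S d, (0 <= S)%R /\ forall p, (dist3 p <= 1)%R ->
    (Cmod (F p - F center3 - lin3 d p) <= S * (dist3 p * dist3 p))%R.
Proof.
  intros Ha HF. destruct (weight_summable a (3 * r) Ha ltac:(lra)) as [S0 HS0].
  set (W := fun mn : nat * nat => (9 * (Cmod (a (Z.of_nat (fst mn)) (Z.of_nat (snd mn))) *
    (3 * r) ^ (fst mn + snd mn + (4 * fst mn + 6 * snd mn + 1))))%R) in *.
  assert (HW : summable (fun _ : nat * nat => True) W (9 * S0)).
  { apply summable_scal; auto. lra. }
  destruct (choice (fun mn h => expands (W mn) (fun p => sigma_term a p mn) h)) as [h Hh].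
  { intros mn. apply expands_term. }
  assert (Hs : forall pr : C * C * C -> C, (forall mn, Cmod (pr (h mn)) <= W mn)%R ->
     exists s, is_sum (fun _ : nat * nat => True) (fun mn => pr (h mn)) s).
  { intros pr Hpr. destruct (ex_is_sum (fun _ : nat * nat => True) (fun mn => pr (h mn)) (9 * S0))
      as (s & Hs & _); [|eauto]. eapply summable_le; [|exact HW]. auto. }
  destruct (Hs (fun d => fst (fst d))) as [s1 Hs1]; [intros mn; apply Hh|].
  destruct (Hs (fun d => snd (fst d))) as [s2 Hs2]; [intros mn; apply Hh|].
  destruct (Hs (fun d => snd d)) as [s3 Hs3]; [intros mn; apply Hh|].
  exists (9 * S0)%R, (s1, s2, s3). split.
  { apply (HW nil); [constructor|constructor]. }
  intros p Hp. pose proof (dist3_pos p) as Hd.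
  rewrite Rmult_comm.
  apply (is_sum_le (fun _ : nat * nat => True)
    (fun mn => sigma_term a p mn - sigma_term a center3 mn - lin3 (h mn) p)).
  - eapply summable_le; [|apply summable_scal; [|exact HW]].
    + intros mn _. simpl. rewrite Rmult_comm. destruct (Hh mn) as (_ & _ & _ & H).
      apply (H p Hp).
    + apply Rmult_le_pos; auto.
  - apply is_sum_minus; [apply is_sum_minus; apply HF|].
    unfold lin3 at 2. cbn [fst snd].
    rewrite (Cmult_comm s1), (Cmult_comm s2), (Cmult_comm s3).
    eapply is_sum_ext; [|apply is_sum_plus; [apply is_sum_plus|]; apply is_sum_scal;
      [exact Hs1|exact Hs2|exact Hs3]].
    intros mn _. unfold lin3. simpl. ring.
Qed.

End Differentiability.

Lemma Cmod_le_norm3 (x y z : C) :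
  (Cmod x <= norm (K := C_AbsRing) (x, y, z))%R /\
  (Cmod y <= norm (K := C_AbsRing) (x, y, z))%R /\
  (Cmod z <= norm (K := C_AbsRing) (x, y, z))%R.
Proof.
  destruct (norm_prod (U := prod_NormedModule C_AbsRing C_NormedModule C_NormedModule)
    (V := C_NormedModule) (x, y) z) as [H1 _].
  destruct (norm_prod (U := C_NormedModule) (V := C_NormedModule) x y) as [H2 _].
  pose proof (Rle_trans _ _ _ (Rmax_l _ _) H1) as H3.
  pose proof (Rle_trans _ _ _ (Rmax_r _ _) H1) as H4.
  pose proof (Rle_trans _ _ _ (Rmax_l _ _) H2) as H5.
  pose proof (Rle_trans _ _ _ (Rmax_r _ _) H2) as H6.
  change (norm (K := C_AbsRing) x) with (Cmod x) in *.
  change (norm (K := C_AbsRing) y) with (Cmod y) in *.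
  change (norm (K := C_AbsRing) z) with (Cmod z) in *.
  split; [|split]; auto; eapply Rle_trans; eauto.
Qed.

Lemma entire_sigma a (F : C * C * C -> C) : is_sigma_coefficients a ->
  (forall p, is_sum (fun _ : nat * nat => True) (sigma_term a p) (F p)) -> entire3 F.
Proof.
  intros Ha HF [[z0 u0] v0].
  set (r := (1 + Cmod z0 + Cmod u0 + Cmod v0)%R).
  pose proof (Cmod_ge_0 z0) as Z0. pose proof (Cmod_ge_0 u0) as U0.
  pose proof (Cmod_ge_0 v0) as V0.
  destruct (expands_series z0 u0 v0 r) with (a := a) (F := F) as (S & d & HS & H);
    try (unfold r; lra); auto.
  set (l := fun h : C * C * C =>
    fst (fst d) * fst (fst h) + snd (fst d) * snd (fst h) + snd d * snd h).
  exists l. split.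
  - constructor.
    + intros [[x y] z] [[x' y'] z']. unfold l.
      change (plus (x, y, z) (x', y', z')) with (x + x', y + y', z + z').
      change (plus (G := C_AbelianGroup)) with Cplus. cbn [fst snd].
      match goal with |- _ = plus ?s ?t => change (plus s t) with (s + t) end.
      to_C. ring.
    + intros k [[x y] z]. unfold l.
      change (scal k (x, y, z)) with (k * x, k * y, k * z). cbn [fst snd].
      match goal with |- _ = scal ?s ?t => change (scal s t) with (s * t) end.
      to_C. ring.
    + set (M := (1 + Cmod (fst (fst d)) + Cmod (snd (fst d)) + Cmod (snd d))%R).
      exists M. pose proof (Cmod_ge_0 (fst (fst d))). pose proof (Cmod_ge_0 (snd (fst d))).
      pose proof (Cmod_ge_0 (snd d)). split; [unfold M; lra|].
      intros [[x y] z]. destruct (Cmod_le_norm3 x y z) as (N1 & N2 & N3).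
      match goal with |- (_ <= _ * ?n)%R => set (nn := n) in * end.
      change (norm (l (x, y, z))) with (Cmod (l (x, y, z))). unfold l. cbn [fst snd].
      eapply Rle_trans; [apply Cmod_triangle|].
      eapply Rle_trans; [apply Rplus_le_compat_r, Cmod_triangle|].
      rewrite !Cmod_mult.
      assert (Cmod (fst (fst d)) * Cmod x <= Cmod (fst (fst d)) * nn)%R
        by (apply Rmult_le_compat_l; auto).
      assert (Cmod (snd (fst d)) * Cmod y <= Cmod (snd (fst d)) * nn)%R
        by (apply Rmult_le_compat_l; auto).
      assert (Cmod (snd d) * Cmod z <= Cmod (snd d) * nn)%R
        by (apply Rmult_le_compat_l; auto).
      assert (0 <= nn)%R by (eapply Rle_trans; [apply (Cmod_ge_0 x)|exact N1]).
      unfold M. lra.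
  - intros q Hq.
    set (V3 := prod_NormedModule C_AbsRing
      (prod_NormedModule C_AbsRing C_NormedModule C_NormedModule) C_NormedModule).
    pose proof (is_filter_lim_locally_unique (K := C_AbsRing) (V := V3) _ _ Hq) as E.
    subst q. intros eps. apply (locally_le_locally_norm (K := C_AbsRing) (V := V3)).
    (* [dist3] is at most three times the norm: 1/3 keeps it within the unit ball, and the quadratic
       remainder is at most 9 S times the squared norm. *)
    set (e := Rmin (1 / 3) (eps / (9 * (S + 1)))).
    assert (He : (0 < e)%R).
    { apply Rmin_glb_lt; [lra|]. apply Rdiv_lt_0_compat; [apply cond_pos|lra]. }
    exists (mkposreal e He). intros [[x y] z] Hb. unfold ball_norm in Hb. simpl pos in Hb.
    change (minus (x, y, z) (z0, u0, v0)) with (x - z0, y - u0, z - v0) in *.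
    destruct (Cmod_le_norm3 (x - z0) (y - u0) (z - v0)) as (N1 & N2 & N3).
    match type of Hb with (?n < _)%R => set (nn := n) in * end.
    match goal with |- (_ <= _ * ?n)%R => change n with nn end.
    assert (Hn0 : (0 <= nn)%R) by (eapply Rle_trans; [apply (Cmod_ge_0 (x - z0))|exact N1]).
    assert (E1 : (e <= 1 / 3)%R) by apply Rmin_l.
    assert (E2 : (e <= eps / (9 * (S + 1)))%R) by apply Rmin_r.
    assert (Hd : (dist3 z0 u0 v0 (x, y, z) <= 3 * nn)%R).
    { unfold dist3. cbn [fst snd].
      assert (Cmod (x - z0) <= nn)%R by exact N1. assert (Cmod (y - u0) <= nn)%R by exact N2.
      assert (Cmod (z - v0) <= nn)%R by exact N3. lra. }
    specialize (H (x, y, z) ltac:(lra)).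
    match goal with |- (norm ?w <= _)%R =>
      change (norm w) with (Cmod (F (x, y, z) - F (center3 z0 u0 v0) - lin3 z0 u0 v0 d (x, y, z))) end.
    eapply Rle_trans; [exact H|].
    pose proof (dist3_pos z0 u0 v0 (x, y, z)) as Hd0.
    set (t := dist3 z0 u0 v0 (x, y, z)) in *.
    assert (Hdd : (t * t <= 9 * nn * nn)%R) by nra.
    apply Rle_trans with (S * (9 * nn * nn))%R; [apply Rmult_le_compat_l; auto|].
    assert (Hsn : (9 * (S + 1) * nn <= eps)%R).
    { apply Rle_trans with (9 * (S + 1) * (eps / (9 * (S + 1))))%R.
      - apply Rmult_le_compat_l; lra.
      - right. field. lra. }
    nra.
Qed.

(** * The sigma function of a lattice *)

Lemma is_fsum_is_sum {T : Type} (f : T -> C) (S : C) :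
  is_fsum (B := CC) f S -> is_sum (fun _ : T => True) f S.
Proof.
  intros (l & Hn & H0 & ->). apply (is_sum_extend (fun x => In x l)); auto.
  apply (is_sum_finite (fun x => In x l) f l Hn). tauto.
Qed.

Lemma apow_CC (x : CC) n : apow CC x n = Cpow x n.
Proof.
  induction n as [|n IH]; [reflexivity|]. change (x * apow CC x n = x * Cpow x n).
  rewrite IH. reflexivity.
Qed.

Lemma ex_sigma_value a p : is_sigma_coefficients a ->
  exists s, is_sum (fun _ : nat * nat => True) (sigma_term a p) s.
Proof.
  intros Ha. destruct p as [[z u] v].
  set (r := (1 + Cmod z + Cmod u + Cmod v)%R).
  pose proof (Cmod_ge_0 z). pose proof (Cmod_ge_0 u). pose proof (Cmod_ge_0 v).
  destruct (weight_summable a r Ha ltac:(unfold r; lra)) as [S HS].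
  destruct (ex_is_sum (fun _ : nat * nat => True) (sigma_term a (z, u, v)) S) as (s & Hs & _);
    [|eauto].
  eapply summable_le; [|exact HS]. intros [m n] _. unfold sigma_term. cbn [fst snd].
  rewrite !Cmod_mult, !Cmod_pow, !pow_add.
  assert (K : forall (x : C) k, (Cmod x <= r)%R -> (0 <= Cmod x ^ k <= r ^ k)%R).
  { intros x k Hx. pose proof (Cmod_ge_0 x). split; [apply pow_le; auto|].
    apply pow_incr. lra. }
  rewrite <- !pow_add.
  rewrite !Rmult_assoc. apply Rmult_le_compat_l; [apply Cmod_ge_0|].
  rewrite !(pow_add r (m + n)), (pow_add r m n), !Rmult_assoc.
  destruct (K u m ltac:(unfold r; lra)), (K v n ltac:(unfold r; lra)),
    (K z (4 * m + 6 * n + 1)%nat ltac:(unfold r; lra)).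
  apply Rmult_le_compat; auto; [apply Rmult_le_pos; auto|].
  apply Rmult_le_compat; auto.
Qed.

(** A single series [c] is both the value of the product and, by [formal_sigma], the double series
    collected by degree. *)
Lemma weierstrass_sigma_value a (L : C -> Prop) (g2 g3 z s : C) :
  is_sigma_coefficients a -> is_lattice L -> has_invariants L g2 g3 ->
  is_sum (fun _ : nat * nat => True) (sigma_term a (z, g2, g3)) s ->
  is_weierstrass_sigma L z s.
Proof.
  intros Ha (w1 & w2 & HB) (e4 & e6 & H4 & H6 & E2 & E3) Hs.
  fold (is_basis w1 w2 L) in HB.
  destruct (min_norm w1 w2 L HB) as (rho & Hrho & Hmin).
  destruct (ex_lattice_sums w1 w2 L HB rho Hrho Hmin) as [G HG].
  pose proof HG as (G0 & G1 & G2 & GS).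
  assert (HG4 : G 4%nat = e4).
  { apply (is_sum_unique (nonzero_points L) (fun l => / l ^ 4)); auto.
    eapply is_sum_ext; [|apply (GS 4%nat); lia]. intros x [_ Hx].
    apply Cpow_inv. exact Hx. }
  assert (HG6 : G 6%nat = e6).
  { apply (is_sum_unique (nonzero_points L) (fun l => / l ^ 6)); auto.
    eapply is_sum_ext; [|apply (GS 6%nat); lia]. intros x [_ Hx].
    apply Cpow_inv. exact Hx. }
  assert (HG3 : G 3%nat = 0) by (apply (odd_lattice_sum w1 w2 L HB G HG); auto).
  assert (HG5 : G 5%nat = 0) by (apply (odd_lattice_sum w1 w2 L HB G HG); auto; lia).
  set (P := wp_series G). set (e := (zr 30 * (G 4%nat : CC))%A : CC).
  destruct (ex_sigma_series CC (zeta_series CC P) eq_refl) as (c & C0 & HC).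
  destruct (ex_exp_series CC) as (i & I0 & HI).
  destruct (sigma_product w1 w2 L HB rho Hrho Hmin G HG i I0 HI c C0 HC z)
    as (p & Hp & Hv).
  (* The classical coefficients (j-1) [G j] of [z^2 wp]. They turn [10 P_4] into [30 G_4] and
     [28 P_6] into [140 G_6], the normalizations of g2/2 and g3. *)
  assert (HP : forall j k : nat, (j = S (S k))%nat ->
    (P j : C) = RtoC (IZR (Z.of_nat j - 1)) * G j).
  { intros j k ->. pose proof (geom_pow_coef CC 1 (S (S k)) ltac:(lia)) as H.
    rewrite <- zr_sub in H.
    assert (Hg : @geom_pow CC 1 (S (S k)) = RtoC 1).
    { unfold geom_pow. change (smul geom (@aone (series CC)) (S (S k)) = RtoC 1).
      rewrite smul_one_r. reflexivity. }
    rewrite Hg in H.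
    change (RtoC 1 * @geom_pow CC 2 (S (S k)) = RtoC (IZR (Z.of_nat (S (S k)) - 1)) * RtoC 1) in H.
    rewrite Cmult_1_l, Cmult_1_r in H.
    change (0 + @geom_pow CC 2 (S (S k)) * G (S (S k)) =
            RtoC (IZR (Z.of_nat (S (S k)) - 1)) * G (S (S k))).
    rewrite H. apply Cplus_0_l. }
  assert (Hck : forall k, is_fsum (graded CC (Z.of_nat k) (term CC a e g3)) (c k)).
  { apply (formal_sigma a e g3 P c Ha).
    - change (RtoC 1 + @geom_pow CC 2 0%nat * G 0%nat = RtoC 1). rewrite G0.
      rewrite Cmult_0_r. apply Cplus_0_r.
    - change (RtoC 0 + @geom_pow CC 2 1%nat * G 1%nat = RtoC 0). rewrite G1.
      rewrite Cmult_0_r. apply Cplus_0_r.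
    - etransitivity; [apply (HP 2%nat 0%nat eq_refl)|]. rewrite G2. apply Cmult_0_r.
    - etransitivity; [apply (HP 3%nat 1%nat eq_refl)|]. rewrite HG3. apply Cmult_0_r.
    - change (RtoC 10 * (P 4%nat : C) = RtoC 30 * G 4%nat).
      rewrite (HP 4%nat 2%nat eq_refl). change (Z.of_nat 4 - 1)%Z with 3%Z.
      rewrite Cmult_assoc, <- RtoC_mult. do 2 f_equal; ring.
    - etransitivity; [apply (HP 5%nat 3%nat eq_refl)|]. rewrite HG5. apply Cmult_0_r.
    - change (RtoC 28 * (P 6%nat : C) = g3).
      rewrite (HP 6%nat 4%nat eq_refl), HG6, E3. change (Z.of_nat 6 - 1)%Z with 5%Z.
      rewrite Cmult_assoc, <- RtoC_mult. do 2 f_equal; ring.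
    - apply (lattice_fifth_order w1 w2 L HB rho Hrho Hmin G HG).
    - exact C0.
    - exact HC. }
  assert (Hg2 : @amul CC (zr 2) e = g2).
  { unfold e. change (RtoC 2 * (RtoC 30 * G 4%nat) = g2). rewrite HG4, E2.
    rewrite Cmult_assoc, <- RtoC_mult. do 2 f_equal; ring. }
  exists p. split; [exact Hp|].
  apply (is_sum_unique (fun _ : nat => True) (fun k => z * (c k * z ^ k))).
  2:{ apply is_sum_scal. exact Hv. }
  (* The double series is grouped by 4m + 6n; the remaining factor z of each term is the factor in
     front of the product. *)
  eapply (is_sum_fibers (fun _ => True) (fun _ => True)
    (fun mn : nat * nat => (4 * fst mn + 6 * snd mn)%nat)); [auto| |exact Hs].
  intros k _. specialize (Hck k). apply is_fsum_is_sum in Hck.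
  (* The support of the graded sum, in bijection with the pairs of natural numbers of the same
     degree. *)
  set (A := fun x : Z * Z => (0 <= fst x)%Z /\ (0 <= snd x)%Z /\
              (4 * fst x + 6 * snd x = Z.of_nat k)%Z).
  assert (HA : is_sum A (graded CC (Z.of_nat k) (term CC a e g3)) (c k)).
  { apply (is_sum_extend A (fun _ => True)); auto. intros [m n] _ Hn. unfold graded.
    cbn [fst snd]. destruct (Z.eqb_spec (4 * m + 6 * n) (Z.of_nat k)) as [E|E]; [|reflexivity].
    change (term CC a e g3 m n = @azero CC). apply term_neg; auto.
    unfold A in Hn. cbn [fst snd] in Hn. lia. }
  apply (is_sum_bij (fun mn : nat * nat => True /\ (4 * fst mn + 6 * snd mn)%nat = k) A
    (fun mn => (Z.of_nat (fst mn), Z.of_nat (snd mn)))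
    (fun x => (Z.to_nat (fst x), Z.to_nat (snd x)))) in HA.
  - apply (is_sum_scal _ _ (z * z ^ k)) in HA.
    replace (z * (c k * z ^ k)) with (z * z ^ k * c k)
      by (generalize (c k : C); intros; ring).
    eapply is_sum_ext; [|exact HA]. intros [m n] [_ E]. cbn [fst snd] in E.
    unfold graded, sigma_term. cbn [fst snd].
    replace (4 * Z.of_nat m + 6 * Z.of_nat n =? Z.of_nat k)%Z with true
      by (symmetry; apply Z.eqb_eq; lia).
    unfold term, monom. rewrite !Nat2Z.id, Hg2, (apow_CC g2 m), (apow_CC g3 n), E.
    change (z * z ^ k * (a (Z.of_nat m) (Z.of_nat n) * (g2 ^ m * g3 ^ n)) =
            a (Z.of_nat m) (Z.of_nat n) * g2 ^ m * g3 ^ n * z ^ (k + 1)).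
    rewrite Cpow_add_r. simpl. ring.
  - intros [m n] [_ E]. unfold A. cbn [fst snd] in *. rewrite !Nat2Z.id. repeat split; lia.
  - intros [m n] (Hm & Hn & E). cbn [fst snd] in *. split; [split; auto; lia|].
    f_equal; lia.
Qed.

Theorem theoremA4 :
  exists a : Z -> Z -> C,
    is_sigma_coefficients a /\
    (forall b : Z -> Z -> C, is_sigma_coefficients b ->
       forall m n : Z, b m n = a m n) /\
    exists sigma : C * C * C -> C,
      entire3 sigma /\
      (forall g2 g3 : C, g2 ^ 3 - 27 * g3 ^ 2 <> 0 ->
         forall L : C -> Prop, is_lattice L -> has_invariants L g2 g3 ->
         forall z : C, is_weierstrass_sigma L z (sigma (z, g2, g3))) /\
      (forall z g2 g3 : C,
         is_sum (fun _ : nat * nat => True)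
           (fun mn => a (Z.of_nat (fst mn)) (Z.of_nat (snd mn))
                      * g2 ^ fst mn * g3 ^ snd mn
                      * z ^ (4 * fst mn + 6 * snd mn + 1))
           (sigma (z, g2, g3))).
Proof.
  destruct ex_sigma_coefficients as [a Ha]. exists a.
  split; [exact Ha|]. split; [intros b Hb; apply sigma_coefficients_unique; auto|].
  (* [sigma] is taken to be the sum of the double series, so the expansion holds by construction. *)
  destruct (choice (fun p s => is_sum (fun _ : nat * nat => True) (sigma_term a p) s))
    as [sigma Hsigma].
  { intros p. apply ex_sigma_value. exact Ha. }
  exists sigma. split; [|split].
  - exact (entire_sigma a sigma Ha Hsigma).
  - intros g2 g3 _ L HL Hinv z. eapply weierstrass_sigma_value; eauto.
  - intros z g2 g3. exact (Hsigma (z, g2, g3)).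
Qed.
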